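(* Let $q$ be a prime power. Let $p_1,p_3\in\mathbf{P}^2(\mathbf{F}_{q^2})$ be two distinct points conjugate over $\mathbf{F}_q$, let $p_2$ be a point infinitely near $p_1$ and $p_4$ a point infinitely near $p_3$ (i.e. $p_2$, resp. $p_4$, lies on the exceptional curve over $p_1$, resp. $p_3$, of the blow-up of $\mathbf{P}^2$ at $p_1,p_3$), such that $p_2,p_4$ are conjugate points of degree $2$, and such that the strict transform of the line through $p_1$ and $p_3$ passes through neither $p_2$ nor $p_4$. Let $X$ be the weak del Pezzo surface over $\mathbf{F}_q$ obtained by blowing up $p_1,p_3$ and then $p_2,p_4$. Then the anticanonical code associated to $X$ has parameters $[q^2+q+1,\,6,\,q^2-q-1]$.
   Context: Parameters $[n,k,d]$ of a linear code over $\mathbf{F}_q$: length $n$, dimension $k$, minimum distance $d$. ''Conjugate'' means permuted transitively by the $q$-Frobenius. Weak del Pezzo surface: a smooth projective surface $X$ whose anticanonical divisor $-K_X$ is big ($K_X^2>0$) and nef; its degree is $d=K_X^2$. Anticanonical model: for $X$ a weak del Pezzo surface of degree $d$ with $3\le d\le 6$, the complete linear system $|-K_X|$ is base point free and defines a morphism $\varphi:X\to\mathbf{P}(H^0(X,-K_X))=\mathbf{P}^d$. Its image $X_s=\varphi(X)$ is the anticanonical model (a normal surface). Put $K_{X_s}=\varphi_*(K_X)$; it is a Cartier divisor on $X_s$ with $\varphi^*K_{X_s}=K_X$. Evaluation code: for an irreducible (not necessarily smooth) surface $S$ over $\mathbf{F}_q$, a Cartier divisor $D=(U_i,f_i)_i$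 on $S$ and a set $\mathcal P$ of rational points of $S$, $\mathcal{C}_S(D,\mathcal P)$ is the image of $H^0(S,D)\to \mathbf{F}_q^{\#\mathcal P}$, $s\mapsto ((sf_{i_p})(p))_{p\in\mathcal P}$, where $H^0(S,D)=\{s\in\mathbf{F}_q(S) : sf_i\in\mathcal{O}_S(U_i)\ \forall i\}$ and $i_p$ is chosen with $p\in U_{i_p}$ (other choices rescale coordinates by nonzero constants). Anticanonical code associated to $X$: the code $\mathcal{C}_{X_s}(-K_{X_s},X_s(\mathbf{F}_q))$. *)

(* Defs.v *)
From HB Require Import structures.
From mathcomp Require Import all_boot all_order all_algebra all_field.
From mathcomp.multinomials Require Import mpoly.

Set Implicit Arguments.
Unset Strict Implicit.
Unset Printing Implicit Defensive.

Import GRing.Theory.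
Local Open Scope ring_scope.

(** F is the finite field with q elements and k an algebraic closure of it.
    Varieties are integral, so they are described in the language of models in
    a function field: a geometric closed point of a surface birational to P^2
    is given by its local ring, a subring of k(P^2), and a surface by the set
    of these local rings.  The function field k(P^2) is the degree 0 part of
    Frac k[X_0, X_1, X_2].  "Over F_q" is expressed by coefficients in F and by
    the Frobenius. *)

Section Geometry.

Variables (F : finFieldType) (k : closedFieldType) (iota : {rmorphism F -> k}).

Notation K := {fraction {mpoly k[3]}}.
Notation subring := (K -> Prop).
Local Notation "x %:F" := (@FracField.tofrac _ x).

Definition cst (c : k) : K := (c%:MP)%:F.

Definition proj_eq (E : fieldType) n (x y : 'rV[E]_n) : Prop :=
  exists2 c : E, c != 0 & y = c *: x.

Definition same_ring (O O' : subring) : Prop := forall f, O f <-> O' f.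

Definition frob_pt n (P : 'rV[k]_n) : 'rV[k]_n := \row_i (P 0 i ^+ #|F|).

Definition frob_mpoly (A : {mpoly k[3]}) : {mpoly k[3]} :=
  map_mpoly (fun c => c ^+ #|F|) A.

(* The Frobenius automorphism of k(P^2): it acts on the coefficients only. *)
Definition frob_fun (f : K) : K :=
  (frob_mpoly (\n_(repr f)))%:F / (frob_mpoly (\d_(repr f)))%:F.

(* O' is the image of O under the Frobenius. *)
Definition frob_ring (O O' : subring) : Prop :=
  forall f, O f <-> O' (frob_fun f).

Definition is_unit (O : subring) (f : K) : Prop := [/\ f != 0, O f & O f^-1].

(* The nonunits of O; 0 is singled out because 0^-1 = 0. *)
Definition maxid (O : subring) (f : K) : Prop := O f /\ (f = 0 \/ ~ O f^-1).

(* f is regular at the point with local ring O and takes the value c there. *)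
Definition local_value (O : subring) (f : K) (c : k) : Prop :=
  O f /\ maxid O (f - cst c).

(* u, v generate the maximal ideal of O. *)
Definition regular_params (O : subring) (u v : K) : Prop :=
  [/\ maxid O u, maxid O v &
      forall f, maxid O f -> exists a b, [/\ O a, O b & f = a * u + b * v]].

Definition geval n (s : 'I_n -> K) (A : {mpoly k[n]}) : K := mmap cst s A.

(* For the subvariety of P^(n-1) with homogeneous generic point s: its local
   ring at the geometric point P, and its function field over F. *)
Definition local_ring n (s : 'I_n -> K) (P : 'rV[k]_n) : subring := fun f =>
  exists d (A B : {mpoly k[n]}),
    [/\ A \is d.-homog, B \is d.-homog, B.@[P 0] != 0 &
        f = geval s A / geval s B].

Definition function_field n (s : 'I_n -> K) : subring := fun f =>
  exists d (A B : {mpoly F[n]}),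
    [/\ A \is d.-homog, B \is d.-homog, geval s (map_mpoly iota B) != 0 &
        f = geval s (map_mpoly iota A) / geval s (map_mpoly iota B)].

Definition surface := subring -> Prop.

Definition P2gen (i : 'I_3) : K := ('X_i)%:F.

Definition P2ring (P : 'rV[k]_3) : subring := local_ring P2gen P.

Definition P2 : surface := fun O =>
  exists2 P : 'rV[k]_3, P != 0 & same_ring O (P2ring P).

(* The local ring at the generic point of the line through P and Q, the union
   of the local rings of P^2 at the points of that line. *)
Definition line_ring (P Q : 'rV[k]_3) : subring := fun f =>
  exists a b : k, P2ring (a *: P + b *: Q) f.

(* A model contains the strict transform of a curve whose generic point has
   local ring V; it passes through the point with local ring O exactly when V
   is a localization of O, i.e. when V contains O. *)
Definition curve_passes_through (V O : subring) : Prop :=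
  forall f, O f -> V f.

(* O' is the local ring of a point of the exceptional curve of the blow-up of
   the point with local ring O: the localization of O[v/u] at the maximal ideal
   (u, v/u) for some regular parameters u, v of O.  An element p.[v/u] lies in
   that ideal iff its constant coefficient lies in the maximal ideal of O.
   All directions are reached since u, v may be any regular parameters. *)
Definition infinitely_near (O O' : subring) : Prop :=
  exists u v, regular_params O u v /\
    forall f, O' f <->
      exists p r : {poly K},
        [/\ forall i, O p`_i, forall i, O r`_i, ~ maxid O r`_0 &
            f = p.[v / u] / r.[v / u]].

Definition blowup (S : surface) (Z : subring -> Prop) : surface := fun O =>
  (S O /\ ~ Z O) \/ (exists O0, [/\ S O0, Z O0 & infinitely_near O0 O]).

Definition two_points (O1 O2 : subring) : subring -> Prop := fun O =>
  same_ring O O1 \/ same_ring O O2.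

Definition pderiv (i : 'I_3) (f : K) : K :=
  let n := \n_(repr f) in let d := \d_(repr f) in
  (mderiv i n * d - n * mderiv i d)%:F / (d ^+ 2)%:F.

(* du /\ dv = jac u v * dx /\ dy with x = X_1/X_0 and y = X_2/X_0; on functions
   of degree 0 one has d/dx = X_0 d/dX_1 and d/dy = X_0 d/dX_2. *)
Definition jac (u v : K) : K :=
  P2gen 0 ^+ 2 * (pderiv 1 u * pderiv 2%:R v - pderiv 2%:R u * pderiv 1 v).

(* w is a local equation, at the point with local ring O, of the divisor K_X of
   the rational 2-form g dx /\ dy = w du /\ dv. *)
Definition canonical_eq (g : K) (O : subring) (w : K) : Prop :=
  exists u v, regular_params O u v /\ w = g / jac u v.

(* H^0(X, -K_X), with K_X the divisor of g dx /\ dy; regularity is tested at the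
   geometric points. *)
Definition anticanonical_section (X : surface) (g f : K) : Prop :=
  function_field P2gen f /\
  forall O w, X O -> canonical_eq g O w -> O (f / w).

Definition is_basis n (s : 'I_n -> K) (V : K -> Prop) : Prop :=
  (forall i, V (s i)) /\
  (forall f, V f ->
     exists! c : 'rV[F]_n, f = \sum_i cst (iota (c 0 i)) * s i).

(* The morphism (s_0 : ... : s_(n-1)) given by sections of -K_X sends the point
   of X with local ring O to P. *)
Definition anticanonical_map (g : K) n (s : 'I_n -> K)
    (O : subring) (P : 'rV[k]_n) : Prop :=
  P != 0 /\
  exists2 w, canonical_eq g O w & forall i, local_value O (s i / w) (P 0 i).

(* gen is a homogeneous generic point with values in k(P^2), pts the set of
   homogeneous coordinate vectors of the geometric points. *)
Record pvariety n := PVariety {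
  gen : 'I_n -> K;
  pts : 'rV[k]_n -> Prop }.

Definition anticanonical_model (X : surface) (g : K) n (s : 'I_n -> K) :
    pvariety n :=
  PVariety s (fun P => exists2 O, X O & anticanonical_map g s O P).

Definition Fpoint n (x : 'rV[F]_n) : 'rV[k]_n := map_mx iota x.

Definition is_open n (S : pvariety n) (U : 'rV[k]_n -> Prop) : Prop :=
  exists Z : {mpoly F[n]} -> Prop,
    (forall A, Z A -> exists d, A \is d.-homog) /\
    (forall P, U P <->
       pts S P /\ exists2 A, Z A & (map_mpoly iota A).@[P 0] != 0).

Record cartier n (S : pvariety n) := Cartier {
  cidx : Type;
  copen : cidx -> 'rV[k]_n -> Prop;
  ceq : cidx -> K;
  copenP : forall i, is_open S (copen i);
  ccover : forall P, pts S P -> exists i, copen i P;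
  ceqP : forall i, function_field (gen S) (ceq i) /\ ceq i != 0;
  ccompat : forall i j P, copen i P -> copen j P ->
    is_unit (local_ring (gen S) P) (ceq i / ceq j) }.

Arguments copen {n S} c i P.
Arguments ceq {n S} c i.

(* The pullback of D to X is -K_X: as w is a local equation of K_X, the pullback
   has local equation w^-1 up to units.  On a normal model this determines D as
   a Cartier divisor, namely as -K_{X_s}. *)
Definition is_anticanonical_divisor (X : surface) (g : K) n (s : 'I_n -> K)
    (D : cartier (anticanonical_model X g s)) : Prop :=
  forall O w P i, X O -> canonical_eq g O w -> anticanonical_map g s O P ->
    copen D i P -> is_unit O (ceq D i * w).

Definition global_section n (S : pvariety n) (D : cartier S) (f : K) : Prop :=
  function_field (gen S) f /\
  forall i P, copen D i P -> local_ring (gen S) P (f * ceq D i).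

(* p lists the set S(F) without repetition. *)
Definition enumerates_rational_points n (S : pvariety n) N
    (p : 'I_N -> 'rV[F]_n) : Prop :=
  [/\ forall j, pts S (Fpoint (p j)),
      forall j j', proj_eq (p j) (p j') -> j = j' &
      forall x, pts S (Fpoint x) -> exists j, proj_eq (p j) x].

Definition evaluation_code n (S : pvariety n) (D : cartier S) N
    (p : 'I_N -> 'rV[F]_n) (ip : 'I_N -> cidx D) : 'rV[F]_N -> Prop := fun c =>
  exists2 f, global_section D f &
    forall j, local_value (local_ring (gen S) (Fpoint (p j)))
                          (f * ceq D (ip j)) (iota (c 0 j)).

Definition hamming N (x y : 'rV[F]_N) : nat := #|[set i | x 0 i != y 0 i]|.

Definition is_min_distance N (C : {vspace 'rV[F]_N}) (d : nat) : Prop :=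
  (exists x y, [/\ x \in C, y \in C, x != y & hamming x y = d]) /\
  (forall x y, x \in C -> y \in C -> x != y -> (d <= hamming x y)%N).

Definition has_parameters N (C : 'rV[F]_N -> Prop) (n m d : nat) : Prop :=
  N = n /\
  exists V : {vspace 'rV[F]_N},
    [/\ forall c, c \in V <-> C c, \dim V = m & is_min_distance V d].

End Geometry.

Arguments copen {F k iota n S} c i P.
Arguments ceq {F k iota n S} c i.

(* Main.v *)
(** Let z = 0 be the line P1P3, and let y = 0 and x = 0 be the lines through P1
    and P3 with the tangent directions p2 and p4; z is defined over F and the
    Frobenius exchanges x and y.  The anticanonical sections of X are the cubics
    xy l1 + z^2 l2 with l1 and l2 linear forms, a space of dimension 6, and the
    anticanonical map sends a point over R in P^2 to ((xy)(R) l1(R) + z^2(R) l2(R)).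
    The image X_s is normal: it is smooth except for two A1 points, where a
    function that is regular on the minimal resolution is bounded by its Newton
    polygon in the coordinates of a chart.  Hence the sections of -K_{X_s} are the
    anticanonical sections of X.

    The exceptional curves over P1 and P3 are exchanged by the Frobenius and have
    disjoint images, so X_s(F) is in bijection with P^2(F), which has q^2 + q + 1
    points.  On P^2(F) the form xy is a norm form n(a, b) and z is the third
    coordinate c.  If l1 is not proportional to z, the cubic n l1 + c^2 l2 has at
    most one zero with c = 0 and, line by line, at most 2 q + 1 zeros elsewhere;
    otherwise it is c times a conic, with at most 2 (q + 1) zeros.  The bound
    2 q + 2 is reached by c (n(a, b) - b c). *)

Require Import Defs.
From HB Require Import structures.
From mathcomp Require Import all_boot all_order all_algebra all_field.
From mathcomp Require Import ring zify.
From mathcomp.multinomials Require Import mpoly.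
From Stdlib Require Import Classical.
Set Implicit Arguments.
Unset Strict Implicit.
Unset Printing Implicit Defensive.
Import GRing.Theory.
Local Open Scope ring_scope.

(** * Places of a function field *)

(** All local rings here are subrings of one field, and each is handled as a relation between
    functions and their values. Every point of X over p1 or p3 gets an explicit pair of parameters
    (a, b), and its ring is k[a, b] localized at the origin; an inclusion between two such rings
    then reduces to the values of two functions. For the anticanonical map three data per point
    matter: its image R in the plane, the value (tau : kappa) of (xy : z^2), and a local equation w
    of K_X. The section given by l1 and l2, divided by w, has the value tau l1(R) + kappa l2(R). The
    pair (R, (tau : kappa)) is constant along the strict transform of the first exceptional curve
    over p1, and likewise over p3; these are the curves that X_s contracts. At their images the
    local ring of X_s could be smaller than the ring of functions regular along the contracted
    curve, and normality closes this gap. Elsewhere parameters of X are quotients of sections and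
    the two rings agree at once. *)

Section Places.

Variables (k K : fieldType) (cst : {rmorphism k -> K}).
Implicit Types (V : K -> k -> Prop) (f g a b : K).

(* [V f c] reads: f is regular at the place and takes the value c there. *)
Record preplace V : Prop := Preplace {
  placeC : forall c, V (cst c) c;
  placeD : forall f g c d, V f c -> V g d -> V (f + g) (c + d);
  placeM : forall f g c d, V f c -> V g d -> V (f * g) (c * d);
  placeV : forall f c, V f c -> c != 0 -> V f^-1 c^-1 }.

(** The axioms of [preplace] allow several values for one function; the relation of
    [rational_preplace] ignores the value altogether. Excluding V 0 1 makes values unique.
    Domination lemmas are stated for a [preplace] as target, so that they also serve as closure
    properties. *)
Definition place V : Prop := preplace V /\ ~ V 0 1.

Definition ring_of V f : Prop := exists c, V f c.

Definition dominates V V' : Prop := forall f c, V f c -> V' f c.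

Lemma place0 V : preplace V -> V 0 0.
Proof. by move=> h; have := placeC h 0; rewrite rmorph0. Qed.

Lemma place1 V : preplace V -> V 1 1.
Proof. by move=> h; have := placeC h 1; rewrite rmorph1. Qed.

Lemma placeN V f c : preplace V -> V f c -> V (- f) (- c).
Proof.
move=> h Vf; have := placeM h (placeC h (-1)) Vf.
by rewrite rmorphN rmorph1 !mulN1r.
Qed.

Lemma placeB V f g c d : preplace V -> V f c -> V g d -> V (f - g) (c - d).
Proof. by move=> h Vf Vg; apply: (placeD h) => //; apply: placeN. Qed.

Lemma placeX V f c n : preplace V -> V f c -> V (f ^+ n) (c ^+ n).
Proof.
move=> h Vf; elim: n => [|n IH]; first by rewrite !expr0; apply: place1.
by rewrite !exprS; apply: (placeM h).
Qed.

Lemma place_div V f g c d : preplace V -> V f c -> V g d -> d != 0 ->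
  V (f / g) (c / d).
Proof. by move=> h Vf Vg d0; apply: (placeM h) => //; apply: (placeV h). Qed.

Lemma place_sum V (I : Type) (r : seq I) (f : I -> K) (c : I -> k) :
  preplace V -> (forall i, V (f i) (c i)) ->
  V (\sum_(i <- r) f i) (\sum_(i <- r) c i).
Proof.
move=> h Vf; elim: r => [|i r IH]; first by rewrite !big_nil; apply: place0.
by rewrite !big_cons; apply: (placeD h).
Qed.

(** Two values of f would give 0 the nonzero value c - d, and scaling by a constant turns this into
    V 0 1. *)
Lemma place_uniq V f c d : place V -> V f c -> V f d -> c = d.
Proof.
move=> [h cons] Vc Vd; apply/eqP; rewrite -subr_eq0; apply/negP => /negP cd0.
apply: cons; have := placeB h Vc Vd; rewrite subrr => V0.
by have := placeM h V0 (placeC h (c - d)^-1); rewrite mul0r mulfV.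
Qed.

Lemma place_neq0 V f c : place V -> V f c -> c != 0 -> f != 0.
Proof.
move=> hV Vf; apply: contra_neq => f0; rewrite f0 in Vf.
exact: place_uniq hV Vf (place0 hV.1).
Qed.

(** A nonzero value can be inverted, while a value 0 together with a regular inverse would give 1
    the value 0. This translates [maxid] into a statement about values. *)
Lemma maxid_of V (O : K -> Prop) f : place V ->
  (forall g, O g <-> ring_of V g) ->
  (O f /\ (f = 0 \/ ~ O f^-1)) <-> V f 0.
Proof.
move=> hV OV; split=> [[/OV[c Vf] [f0|nO]]|Vf].
- by rewrite f0; apply: place0 hV.1.
- have [c0|/eqP c0] := eqVneq c 0; first by rewrite -{1}c0.
  by case: nO; apply/OV; exists c^-1; apply: (placeV hV.1) => //; apply/eqP.
- split; first by apply/OV; exists 0.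
  have [->|f0] := eqVneq f 0; first by left.
  right=> /OV[d Vd]; apply/hV.2/(_ : V 0 1).
  have := placeM hV.1 Vf Vd; rewrite mulfV // mul0r => V10.
  by have := placeB hV.1 (place1 hV.1) V10; rewrite subrr subr0.
Qed.

Definition ev1 a : {rmorphism {poly k} -> K} :=
  horner_morph (fun c => mulrC a (cst c)).

Definition ev a b : {rmorphism {poly {poly k}} -> K} :=
  horner_morph (fun p => mulrC b (ev1 a p)).

Lemma ev1X a : ev1 a 'X = a. Proof. exact: horner_morphX. Qed.
Lemma ev1C a c : ev1 a c%:P = cst c. Proof. exact: horner_morphC. Qed.
Lemma evX a b : ev a b 'X = b. Proof. exact: horner_morphX. Qed.
Lemma evC a b p : ev a b p%:P = ev1 a p. Proof. exact: horner_morphC. Qed.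

Lemma place_ev1 V a (a0 : k) p : preplace V -> V a a0 -> V (ev1 a p) p.[a0].
Proof.
move=> h Va; elim/poly_ind: p => [|p c IH].
  by rewrite rmorph0 horner0; apply: place0.
rewrite rmorphD rmorphM /= ev1X ev1C hornerD hornerM hornerX hornerC.
by apply: (placeD h (placeM h IH Va)); apply: placeC.
Qed.

Lemma place_ev V a b (a0 b0 : k) p : preplace V -> V a a0 -> V b b0 ->
  V (ev a b p) p.[b0, a0].
Proof.
move=> h Va Vb; elim/poly_ind: p => [|p c IH].
  by rewrite rmorph0 !horner0; apply: place0.
rewrite rmorphD rmorphM /= evX evC hornerD hornerM hornerX hornerC.
rewrite hornerD hornerM hornerC.
by apply: (placeD h (placeM h IH Vb)); apply: place_ev1.
Qed.

Lemma place_horner V (p : {poly K}) t (t0 : k) :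
  preplace V -> (forall i, ring_of V p`_i) -> V t t0 -> ring_of V p.[t].
Proof.
move=> h Vp Vt; rewrite horner_coef; elim/big_ind: _ => [|f g [c Vf] [d Vg]|i _].
- by exists 0; apply: place0.
- by exists (c + d); apply: (placeD h).
- have [c Vc] := Vp i.
  by exists (c * t0 ^+ i); apply: (placeM h) => //; apply: placeX.
Qed.

Lemma place_horner0 V (p : {poly K}) t c :
  preplace V -> (forall i, ring_of V p`_i) -> V t 0 -> V p`_0 c -> V p.[t] c.
Proof.
elim/poly_ind: p => [|p d _] h Vp Vt.
  by rewrite coef0 horner0.
rewrite hornerD hornerMX hornerC coefD coefMX coefC /= add0r => Vc.
have [|e Ve] := place_horner (p := p) h _ Vt.
  by move=> i; have := Vp i.+1; rewrite coefD coefMX coefC /= addr0.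
by have := placeD h (placeM h Ve Vt) Vc; rewrite mulr0 add0r.
Qed.

Definition indep a b : Prop := forall A, ev a b A = 0 -> A = 0.

(* The localization of k[a, b] at the maximal ideal (a - a0, b - b0). *)
Definition chartat (a0 b0 : k) a b : K -> k -> Prop := fun f c =>
  exists A B, [/\ B.[b0, a0] != 0, f = ev a b A / ev a b B &
                  c = A.[b0, a0] / B.[b0, a0]].

Definition chart a b := chartat 0 0 a b.

Lemma indep_neq0 a b A : indep a b -> A != 0 -> ev a b A != 0.
Proof. by move=> h; apply: contra_neq; apply: h. Qed.

Lemma nz_horner2 (A : {poly {poly k}}) (a0 b0 : k) : A.[b0, a0] != 0 -> A != 0.
Proof. by apply: contra_neq => ->; rewrite !horner0. Qed.

Lemma indep_inj a b : indep a b -> injective (ev a b).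
Proof.
move=> h A B AB; apply/eqP; rewrite -subr_eq0; apply/eqP/h.
by rewrite rmorphB /= AB subrr.
Qed.

Lemma chartat_place (a0 b0 : k) a b : indep a b -> place (chartat a0 b0 a b).
Proof.
move=> h; have nz A : A.[b0, a0] != 0 -> ev a b A != 0.
  by move=> A0; apply: indep_neq0 => //; apply: nz_horner2 A0.
split; first split.
- move=> c; exists c%:P%:P, 1.
  by split; rewrite ?rmorph1 ?evC ?ev1C ?hornerE ?divr1 ?oner_neq0.
- move=> f g c d [A [B [B0 -> ->]]] [A' [B' [B'0 -> ->]]].
  exists (A * B' + A' * B), (B * B'); rewrite rmorphD !rmorphM /=.
  by rewrite !(hornerD, hornerM) mulf_neq0 // !addf_div //; apply: nz.
- move=> f g c d [A [B [B0 -> ->]]] [A' [B' [B'0 -> ->]]].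
  exists (A * A'), (B * B'); rewrite !rmorphM /=.
  by rewrite !hornerM mulf_neq0 // !mulf_div.
- move=> f c [A [B [B0 -> ->]]]; rewrite mulf_eq0 invr_eq0 negb_or => /andP[A0 _].
  by exists B, A; rewrite !invf_div.
- case=> A [B [B0 /esym/eqP]]; rewrite mulf_eq0 invr_eq0 (negPf (nz _ B0)) orbF.
  move=> /eqP/h ->; rewrite !horner0 mul0r => /eqP.
  by rewrite oner_eq0.
Qed.

Lemma chart_place a b : indep a b -> place (chart a b).
Proof. exact: chartat_place. Qed.

Lemma chartat_l (a0 b0 : k) a b : chartat a0 b0 a b a a0.
Proof.
by exists 'X%:P, 1; split; rewrite ?rmorph1 ?evC ?ev1X ?hornerE ?divr1 ?oner_neq0.
Qed.

Lemma chartat_r (a0 b0 : k) a b : chartat a0 b0 a b b b0.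
Proof.
by exists 'X, 1; split; rewrite ?rmorph1 ?evX ?hornerE ?divr1 ?oner_neq0.
Qed.

Lemma chart_l a b : chart a b a 0. Proof. exact: chartat_l. Qed.

Lemma chart_r a b : chart a b b 0. Proof. exact: chartat_r. Qed.

(** The values of a and b determine those of all polynomials in them, hence of all quotients with
    nonvanishing denominator. This is the main tool for inclusions of local rings: two values have
    to be checked. *)
Lemma chart_sub a b V : preplace V -> V a 0 -> V b 0 -> dominates (chart a b) V.
Proof.
move=> h Va Vb f c [A [B [B0 -> ->]]].
by apply: place_div => //; apply: place_ev.
Qed.

Lemma chart_ext a b a' b' : indep a b -> indep a' b' ->
  chart a' b' a 0 -> chart a' b' b 0 -> chart a b a' 0 -> chart a b b' 0 ->
  forall f c, chart a b f c <-> chart a' b' f c.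
Proof.
move=> ab a'b' ? ? ? ? f c.
by split; apply: chart_sub => //; apply: (chart_place _).1.
Qed.

Lemma ev_aug (A : {poly {poly k}}) : exists (c : k) (A1 A2 : {poly {poly k}}),
  A = c%:P%:P + 'X%:P * A1 + 'X * A2.
Proof.
elim/poly_ind: A => [|A p _]; first by exists 0, 0, 0; rewrite !mulr0 !addr0.
elim/poly_ind: p => [|p c _].
  by exists 0, 0, A; rewrite mulr0 !add0r addr0 mulrC.
by exists c, p%:P, A; rewrite rmorphD rmorphM /=; ring.
Qed.

Lemma chart_maxid a b f : indep a b -> chart a b f 0 ->
  exists x y, [/\ ring_of (chart a b) x, ring_of (chart a b) y & f = x * a + y * b].
Proof.
move=> h [A [B [B0 -> /esym/eqP]]]; rewrite mulf_eq0 invr_eq0 (negPf B0) orbF.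
have [c [A1 [A2 ->]]] := ev_aug A.
rewrite !hornerE => /eqP c0.
have V A' : ring_of (chart a b) (ev a b A' / ev a b B).
  by exists (A'.[0, 0] / B.[0, 0]), A', B.
exists (ev a b A1 / ev a b B), (ev a b A2 / ev a b B); split=> //.
by rewrite c0 !rmorphD !rmorphM /= !evC !rmorph0 ev1X evX; ring.
Qed.

(* The differentials of the parameters a, b are linearly independent. *)
Lemma chart_syz a b x y : indep a b -> ring_of (chart a b) x ->
  ring_of (chart a b) y -> x * a + y * b = 0 -> chart a b x 0 /\ chart a b y 0.
Proof.
move=> h [_ [A [B [B0 xE _]]]] [_ [A' [B' [B'0 yE _]]]] xy0.
have e: A * 'X%:P * B' + A' * 'X * B = 0.
  apply: (h); rewrite !rmorphD !rmorphM /= evC ev1X evX.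
  have nz := indep_neq0 h (nz_horner2 B0); have nz' := indep_neq0 h (nz_horner2 B'0).
  apply: (mulIf (invr_neq0 (mulf_neq0 nz nz'))); rewrite mul0r -[RHS]xy0 xE yE.
  by field; apply/andP.
(* The coefficient of a in [e] is A(0,0) B'(0,0): set the outer variable b to 0, differentiate in a,
   evaluate at 0. The next fact reads off the coefficient of b. *)
have eA : A.[0, 0] = 0.
  have := congr1 (fun P => (P.[0])^`().[0]) e.
  rewrite !hornerE !derivE !hornerE.
  by move/eqP; rewrite mulf_eq0 polyC0 in B'0 *; rewrite (negPf B'0) orbF => /eqP.
have eA' : A'.[0, 0] = 0.
  have := congr1 (fun P => (P^`().[0]).[0]) e.
  rewrite !derivE !hornerE.
  by move/eqP; rewrite mulf_eq0 polyC0 in B0 *; rewrite (negPf B0) orbF => /eqP.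
by split; [exists A, B | exists A', B']; rewrite ?eA ?eA' mul0r.
Qed.

End Places.

(** * Algebraically independent pairs and the local ring of an infinitely near point *)

Section Indep.

Variables (k K : fieldType) (cst : {rmorphism k -> K}).
Local Notation ev1 := (ev1 cst).
Local Notation ev := (ev cst).
Local Notation indep := (indep cst).
Local Notation chart := (chart cst).
Local Notation place := (place cst).
Local Notation preplace := (preplace cst).

Lemma ev_sum (a b : K) A : ev a b A = \sum_(j < size A) ev1 a A`_j * b ^+ j.
Proof.
rewrite -{1}[A]coefK poly_def rmorph_sum; apply: eq_bigr => j _ /=.
by rewrite -mul_polyC rmorphM rmorphXn /= evC evX.
Qed.

Lemma ev_comp (a b : K) (A Q : {poly {poly k}}) :
  ev a b (A \Po Q) = ev a (ev a b Q) A.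
Proof.
elim/poly_ind: A => [|A p IH]; first by rewrite comp_poly0 !rmorph0.
by rewrite comp_polyD comp_polyM comp_polyX comp_polyC !rmorphD !rmorphM /= IH !evC evX.
Qed.

(** The substitution of b - p(a) for b is triangular: composing with a polynomial of degree 1 in the
    outer variable kills only 0. *)
Lemma indep_shift (a b : K) p : indep a b -> indep a (b - ev1 a p).
Proof.
move=> h A; rewrite (_ : b - _ = ev a b ('X - p%:P)).
  by rewrite -ev_comp => /h/eqP; rewrite comp_poly2_eq0 ?size_XsubC // => /eqP.
by rewrite rmorphB /= evX evC.
Qed.

Lemma ev_swap (a b : K) A : ev b a (swapXY A) = ev a b A.
Proof.
have e p : ev b a (map_poly polyC p) = ev1 a p.
  elim/poly_ind: p => [|p c IH]; first by rewrite map_poly0 !rmorph0.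
  by rewrite !rmorphD !rmorphM /= map_polyX map_polyC /= IH evX evC !ev1C ev1X.
elim/poly_ind: A => [|A p IH]; first by rewrite !rmorph0.
by rewrite !rmorphD !rmorphM /= IH swapXY_X swapXY_polyC e !evC evX ev1X.
Qed.

Lemma indep_swap (a b : K) : indep a b -> indep b a.
Proof.
move=> h A; rewrite -ev_swap => /h A0.
by rewrite -[A]swapXYK A0 rmorph0.
Qed.

Lemma indep_l0 (a b : K) : indep a b -> a != 0.
Proof.
move=> h; rewrite -(ev1X cst a) -(evC cst a b); apply: indep_neq0 => //.
by rewrite polyC_eq0 polyX_eq0.
Qed.

Lemma indep_r0 (a b : K) : indep a b -> b != 0.
Proof. by move/indep_swap/indep_l0. Qed.

(** Multiplying a relation between a and b / a by a power of a gives a relation Q between a and b.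
    Different powers of b do not mix, so each coefficient of Q, which is one of A times a power of
    the variable, vanishes. *)
Lemma indep_div (a b : K) : indep a b -> indep a (b / a).
Proof.
move=> h A A0; have a0 := indep_l0 h.
pose n := size A; pose Q : {poly {poly k}} := \poly_(j < n) ('X^(n - j) * A`_j).
have Q0 : Q = 0.
  apply: (h); rewrite /Q poly_def rmorph_sum.
  transitivity (a ^+ n * ev a (b / a) A); last by rewrite A0 mulr0.
  rewrite ev_sum mulr_sumr; apply: eq_bigr => j _ /=.
  rewrite -mul_polyC [LHS]rmorphM /= evC !rmorphM !rmorphXn /= ev1X evX.
  have -> : a ^+ n = a ^+ (n - j) * a ^+ j by rewrite -exprD subnK // ltnW.
  by rewrite expr_div_n -!mulrA; congr (_ * _); rewrite mulrCA; congr (_ * _);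
     rewrite mulrCA mulfV ?mulr1 // expf_neq0.
apply/polyP => j; rewrite coef0; have [jn|nj] := ltnP j n; last exact: nth_default.
have /eqP := congr1 (fun P : {poly {poly k}} => P`_j) Q0.
by rewrite coef_poly jn coef0 mulf_eq0 expf_eq0 polyX_eq0 andbF /= => /eqP.
Qed.

Lemma indep_blow (a b : K) t : indep a b -> indep a (b / a - cst t).
Proof. by move=> h; rewrite -(ev1C cst a t); apply/indep_shift/indep_div. Qed.

Definition nearset (V : K -> k -> Prop) (t f : K) : Prop :=
  exists p r : {poly K}, [/\ forall i, ring_of V p`_i, forall i, ring_of V r`_i,
    ~ V r`_0 0 & f = p.[t] / r.[t]].

Lemma ring_of_coefM V (p q : {poly K}) : preplace V ->
  (forall i, ring_of V p`_i) -> (forall i, ring_of V q`_i) ->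
  forall i, ring_of V (p * q)`_i.
Proof.
move=> h Vp Vq i; rewrite coefM; elim/big_ind: _ => [|f g [c Vf] [d Vg]|j _].
- by exists 0; apply: place0 h.
- by exists (c + d); apply: (placeD h).
- by have [[c Vc] [d Vd]] := (Vp j, Vq (i - j)%N); exists (c * d); apply: (placeM h).
Qed.

Lemma ring_of_coefD V (p q : {poly K}) : preplace V ->
  (forall i, ring_of V p`_i) -> (forall i, ring_of V q`_i) ->
  forall i, ring_of V (p + q)`_i.
Proof.
move=> h Vp Vq i; rewrite coefD; have [[c Vc] [d Vd]] := (Vp i, Vq i).
by exists (c + d); apply: (placeD h).
Qed.

Lemma ring_of_coefC V f : preplace V -> ring_of V f -> forall i, ring_of V (f%:P)`_i.
Proof. by move=> h Vf i; rewrite coefC; case: eqP => // _; exists 0; apply: place0 h. Qed.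

(* The point of the blow-up only depends on the direction of v: here v is
   proportional to b to first order. *)
Lemma near_core (a b u v c d e f : K) V (d0 e0 : k) : indep a b ->
  (forall g x, V g x <-> chart a b g x) ->
  u = e * a + f * b -> v = c * a + d * b ->
  V c 0 -> V d d0 -> d0 != 0 -> V e e0 -> e0 != 0 -> ring_of V f ->
  (exists x y, [/\ ring_of V x, ring_of V y & a = x * u + y * v]) ->
  (exists x y, [/\ ring_of V x, ring_of V y & b = x * u + y * v]) ->
  forall g, nearset V (v / u) g <-> ring_of (chart a (b / a)) g.
Proof.
move=> ab VE uE vE Vc Vd d0n Ve e0n [f0 Vf].
move=> [a1 [a2 [[a10 Va1] [a20 Va2] aE]]] [b1 [b2 [[b10 Vb1] [b20 Vb2] bE]]].
have Vpl : place V.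
  have [[h1 h2 h3 h4] h5] := chart_place ab.
  split; [split|].
  - by move=> x; apply/VE/h1.
  - by move=> ? ? ? ? /VE ? /VE ?; apply/VE/h2.
  - by move=> ? ? ? ? /VE ? /VE ?; apply/VE/h3.
  - by move=> ? ? /VE ? ?; apply/VE/h4.
  - by move/VE.
have Vp := Vpl.1; pose t := b / a; have a0 := indep_l0 ab.
have syz x y : ring_of V x -> ring_of V y -> x * a + y * b = 0 -> V x 0 /\ V y 0.
  move=> [x0 /VE Vx] [y0 /VE Vy] xy; have [] := chart_syz ab _ _ xy; first by exists x0.
    by exists y0.
  by move=> /VE ? /VE ?.
have tri : indep a t by apply: indep_div.
have Wpl := chart_place tri; have Wp := Wpl.1.
have Wa : chart a t a 0 by apply: chart_l.
have Wt : chart a t t 0 by apply: chart_r.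
have VW : dominates V (chart a t).
  move=> g x /VE; apply: chart_sub => //.
  by rewrite -[b](divfK a0) -[0](mulr0 0); apply: (placeM Wp).
(* Substituting u and v into the expression of a by u and v gives a relation between a and b, whose
   coefficients vanish at the point by [syz]. This fact and the next are entries of a product of two
   inverse matrices modulo the maximal ideal. *)
have a10e : a10 * e0 = 1.
  have [|||V1 _] := syz (a1 * e + a2 * c - 1) (a1 * f + a2 * d).
  - exists (a10 * e0 + a20 * 0 - 1).
    by apply: (placeB Vp _ (place1 Vp)); apply: (placeD Vp); apply: (placeM Vp).
  - by exists (a10 * f0 + a20 * d0); apply: (placeD Vp); apply: (placeM Vp).
  - transitivity (a1 * u + a2 * v - a); last by rewrite -aE subrr.
    by rewrite uE vE; ring.
  have V2 := placeB Vp (placeD Vp (placeM Vp Va1 Ve) (placeM Vp Va2 Vc)) (place1 Vp).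
  by have /eqP := place_uniq Vpl V2 V1; rewrite mulr0 addr0 subr_eq0 => /eqP.
have b10e : b10 = 0.
  have [|||V1 _] := syz (b1 * e + b2 * c) (b1 * f + b2 * d - 1).
  - by exists (b10 * e0 + b20 * 0); apply: (placeD Vp); apply: (placeM Vp).
  - exists (b10 * f0 + b20 * d0 - 1).
    by apply: (placeB Vp _ (place1 Vp)); apply: (placeD Vp); apply: (placeM Vp).
  - transitivity (b1 * u + b2 * v - b); last by rewrite -bE subrr.
    by rewrite uE vE; ring.
  have V2 := placeD Vp (placeM Vp Vb1 Ve) (placeM Vp Vb2 Vc).
  have /eqP := place_uniq Vpl V2 V1; rewrite mulr0 addr0 mulf_eq0 (negPf e0n) orbF.
  by move/eqP.
have a10n : a10 != 0 by apply: contraTneq isT => z; move: a10e; rewrite z mul0r => /esym/eqP; rewrite oner_eq0.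
have Wden : chart a t (e + f * t) e0.
  have := placeD Wp (VW _ _ Ve) (placeM Wp (VW _ _ Vf) Wt); by rewrite mulr0 addr0.
have den0 := place_neq0 Wpl Wden e0n.
have uE' : u = a * (e + f * t) by rewrite uE /t; field.
have vE' : v = a * (c + d * t) by rewrite vE /t; field.
have u0 : u != 0 by rewrite uE' mulf_neq0.
have tE : v / u = (c + d * t) / (e + f * t).
  by rewrite uE' vE'; field; apply/andP.
pose s := v / u; have Ws : chart a t s 0.
  rewrite /s tE -[0](mul0r e0^-1); apply: (place_div Wp) => //.
  by have := placeD Wp (VW _ _ Vc) (placeM Wp (VW _ _ Vd) Wt); rewrite mulr0 addr0.
have hor0 (p : {poly K}) c0 : (forall i, ring_of V p`_i) -> V p`_0 c0 -> chart a t p.[s] c0.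
  move=> Vq Vc0; apply: (place_horner0 Wp _ Ws); last exact: VW.
  by move=> i; have [x Vx] := Vq i; exists x; apply: VW.
have hnz (p : {poly K}) c0 : (forall i, ring_of V p`_i) -> V p`_0 c0 -> c0 != 0 -> p.[s] != 0.
  by move=> Vq Vc0; apply: place_neq0 Wpl (hor0 _ _ Vq Vc0).
move=> g; split=> [[p [r [Vpi Vri Vr0 ->]]]|].
  have [[p0 Vp0] [r0 Vr0']] := (Vpi 0, Vri 0).
  have r0n : r0 != 0 by apply: contra_notN Vr0 => /eqP <-.
  by exists (p0 / r0); apply: (place_div Wp) => //; apply: hor0.
(* [W] collects the quotients p(s) / r(s) with their values. Once it is a preplace in which a and t
   have value 0, it dominates the chart at (a, t), which is the remaining inclusion. *)
pose W (g : K) (x : k) := exists (p r : {poly K}) (p0 r0 : k),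
  [/\ forall i, ring_of V p`_i, forall i, ring_of V r`_i, V p`_0 p0 /\ V r`_0 r0 &
      [/\ r0 != 0, g = p.[s] / r.[s] & x = p0 / r0]].
have VW' : dominates V W.
  move=> g' x Vx; exists g'%:P, 1%:P, x, 1; split.
  - exact: (ring_of_coefC Vp (ex_intro _ x Vx)).
  - exact: (ring_of_coefC Vp (ex_intro _ 1 (place1 Vp))).
  - by rewrite !coefC; split; [|apply: (place1 Vp)].
  - by rewrite oner_neq0 !hornerC !divr1.
have W'p : preplace W.
  split.
  - by move=> x; exact: (VW' _ _ (placeC Vp x)).
  - move=> g1 g2 x1 x2 [p [r [p0 [r0 [Vpi Vri [Vp0 Vr0] [r0n -> ->]]]]]].
    move=> [p' [r' [p'0 [r'0 [Vpi' Vri' [Vp'0 Vr'0] [r'0n -> ->]]]]]].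
    exists (p * r' + p' * r), (r * r'), (p0 * r'0 + p'0 * r0), (r0 * r'0); split.
    + by apply: ring_of_coefD => //; apply: ring_of_coefM.
    + exact: ring_of_coefM.
    + by rewrite coefD !coef0M; split; [apply: (placeD Vp)|]; apply: (placeM Vp).
    + have nr := hnz _ _ Vri Vr0 r0n; have nr' := hnz _ _ Vri' Vr'0 r'0n.
      by rewrite mulf_neq0 // hornerD !hornerM !addf_div.
  - move=> g1 g2 x1 x2 [p [r [p0 [r0 [Vpi Vri [Vp0 Vr0] [r0n -> ->]]]]]].
    move=> [p' [r' [p'0 [r'0 [Vpi' Vri' [Vp'0 Vr'0] [r'0n -> ->]]]]]].
    exists (p * p'), (r * r'), (p0 * p'0), (r0 * r'0); split.
    + exact: ring_of_coefM.
    + exact: ring_of_coefM.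
    + by rewrite !coef0M; split; apply: (placeM Vp).
    + by rewrite mulf_neq0 // !hornerM !mulf_div.
  - move=> g1 x [p [r [p0 [r0 [Vpi Vri [Vp0 Vr0] [r0n -> ->]]]]]].
    rewrite mulf_eq0 negb_or => /andP[p0n _].
    by exists r, p, r0, p0; rewrite !invf_div.
have Wa' : W a 0 by apply/VW'/VE/chart_l.
have Ws' : W s 0.
  exists 'X, 1%:P, 0, 1; split.
  - move=> i; rewrite coefX; case: eqP => _; first by exists 1; apply: (place1 Vp).
    by exists 0; apply: (place0 Vp).
  - exact: (ring_of_coefC Vp (ex_intro _ 1 (place1 Vp))).
  - by rewrite coefX coefC; split; [apply: (place0 Vp) | apply: (place1 Vp)].
  - by rewrite oner_neq0 hornerX hornerC !divr1.
(* Inverting the change of parameters writes t as a fractional linear function of s. Its numerator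
   vanishes at the point because b10 = 0; its denominator has the value a10. *)
have Wt' : W t 0.
  have -> : t = (b1 + b2 * s) / (a1 + a2 * s).
    have a12 : a = u * (a1 + a2 * s) by rewrite {1}aE /s; field.
    have b12 : b = u * (b1 + b2 * s) by rewrite {1}bE /s; field.
    have := a0; rewrite {1}a12 mulf_eq0 negb_or => /andP[_ n0].
    by rewrite /t {1}a12 {1}b12; field; apply/andP.
  rewrite -[0](mul0r a10^-1); apply: (place_div W'p) => //.
    have := placeD W'p (VW' _ _ Vb1) (placeM W'p (VW' _ _ Vb2) Ws').
    by rewrite mulr0 addr0 b10e.
  have := placeD W'p (VW' _ _ Va1) (placeM W'p (VW' _ _ Va2) Ws').
  by rewrite mulr0 addr0.
move=> [x /(chart_sub W'p Wa' Wt')[p [r [p0 [r0 [Vpi Vri [Vp0 Vr0] [r0n -> _]]]]]]].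
exists p, r; split=> // Vr00; move/eqP: r0n; apply.
exact: place_uniq Vpl Vr0 Vr00.
Qed.

End Indep.

(** * All directions at a point, and 2-forms under a change of parameters *)

Section NearChart.

Variables (k K : fieldType) (cst : {rmorphism k -> K}).
Local Notation ev1 := (ev1 cst).
Local Notation ev := (ev cst).
Local Notation indep := (indep cst).
Local Notation chart := (chart cst).
Local Notation place := (place cst).
Local Notation preplace := (preplace cst).

Lemma place_eq V V' : (forall f c, V' f c <-> V f c) -> place V -> place V'.
Proof.
move=> VE [[h1 h2 h3 h4] h5]; split; [split|].
- by move=> x; apply/VE/h1.
- by move=> ? ? ? ? /VE ? /VE ?; apply/VE/h2.
- by move=> ? ? ? ? /VE ? /VE ?; apply/VE/h3.
- by move=> ? ? /VE ? ?; apply/VE/h4.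
- by move/VE.
Qed.

Lemma indep_shear (a b : K) t : indep a b -> indep a (b - cst t * a).
Proof.
have := @indep_shift _ _ cst a b (t%:P * 'X).
by rewrite rmorphM /= ev1C ev1X.
Qed.

Lemma chart_shear (a b : K) t f c : indep a b ->
  chart a b f c <-> chart a (b - cst t * a) f c.
Proof.
move=> ab; have ab' := indep_shear (t := t) ab; apply: chart_ext => //; try exact: chart_l.
- have h := (chart_place ab').1; set b' := b - _.
  have := placeD h (chart_r _ a b') (placeM h (placeC h t) (chart_l _ a b')).
  by rewrite subrK mulr0 addr0.
- have h := (chart_place ab).1.
  have := placeB h (chart_r _ a b) (placeM h (placeC h t) (chart_l _ a b)).
  by rewrite mulr0 subr0.
Qed.

Lemma chart_swap (a b : K) f c : indep a b -> chart a b f c <-> chart b a f c.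
Proof.
move=> ab; have ba := indep_swap ab.
by apply: chart_ext => //; do ?[exact: chart_l | exact: chart_r].
Qed.

(** Since b / a - t = (b - t a) / a, the direction t for (a, b) is the direction 0 for the sheared
    parameters. *)
Lemma near_chart_r (a b : K) t g : indep a b ->
  nearset (chart a b) ((b - cst t * a) / a) g <->
  ring_of (chart a (b / a - cst t)) g.
Proof.
move=> ab; have ab' := indep_shear (t := t) ab; have h := (chart_place ab).1.
rewrite -(mulfK (indep_l0 ab) (cst t)) -mulrBl mulfK ?(indep_l0 ab) //.
apply: (near_core (e := 1) (f := 0) (c := 0) (d := 1) (d0 := 1) (e0 := 1)) => //.
- by move=> ? ?; apply: chart_shear.
- by ring.
- by ring.
- exact: (place0 h).
- exact: (place1 h).
- exact: oner_neq0.
- exact: (place1 h).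
- exact: oner_neq0.
- by exists 0; exact: (place0 h).
- exists 1, 0; split; last by ring.
  + by exists 1; exact: (place1 h).
  + by exists 0; exact: (place0 h).
- exists 0, 1; split; last by ring.
  + by exists 0; exact: (place0 h).
  + by exists 1; exact: (place1 h).
Qed.

(** Expressing a and b by u and v gives an inverse, modulo the maximal ideal, of the matrix of
    linear parts; by multiplicativity its determinant cannot vanish. *)
Lemma chart_det (a b u v u1 u2 v1 v2 : K) (u10 u20 v10 v20 : k) : indep a b ->
  u = u1 * a + u2 * b -> v = v1 * a + v2 * b ->
  chart a b u1 u10 -> chart a b u2 u20 -> chart a b v1 v10 -> chart a b v2 v20 ->
  (forall f, chart a b f 0 -> exists x y,
    [/\ ring_of (chart a b) x, ring_of (chart a b) y & f = x * u + y * v]) ->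
  u10 * v20 - u20 * v10 != 0.
Proof.
move=> ab uE vE V1 V2 V3 V4 gen; have hpl := chart_place ab; have h := hpl.1.
have [x [y [[x0 Vx] [y0 Vy] aE]]] := gen _ (chart_l _ a b).
have [z [w [[z0 Vz] [w0 Vw] bE]]] := gen _ (chart_r _ a b).
have xu := placeD h (placeM h Vx V1) (placeM h Vy V3).
have xv := placeD h (placeM h Vx V2) (placeM h Vy V4).
have zu := placeD h (placeM h Vz V1) (placeM h Vw V3).
have zv := placeD h (placeM h Vz V2) (placeM h Vw V4).
have [|||e1 e2] := chart_syz ab (x := x * u1 + y * v1 - 1) (y := x * u2 + y * v2).
- by exists (x0 * u10 + y0 * v10 - 1); apply: (placeB h xu (place1 h)).
- by exists (x0 * u20 + y0 * v20).
- by transitivity (x * u + y * v - a); [rewrite uE vE; ring | rewrite -aE subrr].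
have [|||e3 e4] := chart_syz ab (x := z * u1 + w * v1) (y := z * u2 + w * v2 - 1).
- by exists (z0 * u10 + w0 * v10).
- by exists (z0 * u20 + w0 * v20 - 1); apply: (placeB h zv (place1 h)).
- by transitivity (z * u + w * v - b); [rewrite uE vE; ring | rewrite -bE subrr].
have E1 := place_uniq hpl e1 (placeB h xu (place1 h)).
have E2 := place_uniq hpl e2 xv.
have E3 := place_uniq hpl e3 zu.
have E4 := place_uniq hpl e4 (placeB h zv (place1 h)).
move/esym/eqP: E1; rewrite subr_eq0 => /eqP E1.
move/esym/eqP: E4; rewrite subr_eq0 => /eqP E4.
apply: contraTneq isT => d0.
have : (x0 * w0 - y0 * z0) * (u10 * v20 - u20 * v10) = 1.
  transitivity ((x0 * u10 + y0 * v10) * (z0 * u20 + w0 * v20) -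
    (x0 * u20 + y0 * v20) * (z0 * u10 + w0 * v10)); first by ring.
  by rewrite E1 E4 -E2 -E3; ring.
by rewrite d0 mulr0 => /esym/eqP; rewrite oner_eq0.
Qed.

(** The point is the zero of the linear part v10 a + v20 b of v on the exceptional line: the
    direction b = t a with t = - v10 / v20, or a = 0 when v20 = 0. *)
Lemma near_chart (a b u v : K) : indep a b ->
  chart a b u 0 -> chart a b v 0 ->
  (forall f, chart a b f 0 -> exists x y,
    [/\ ring_of (chart a b) x, ring_of (chart a b) y & f = x * u + y * v]) ->
  (exists t, forall g, nearset (chart a b) (v / u) g <->
     ring_of (chart a (b / a - cst t)) g) \/
  (forall g, nearset (chart a b) (v / u) g <-> ring_of (chart b (a / b)) g).
Proof.
move=> ab Vu Vv gen; have hpl := chart_place ab; have h := hpl.1.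
have [u1 [u2 [[u10 Vu1] [u20 Vu2] uE]]] := chart_maxid ab Vu.
have [v1 [v2 [[v10 Vv1] [v20 Vv2] vE]]] := chart_maxid ab Vv.
have det := chart_det ab uE vE Vu1 Vu2 Vv1 Vv2 gen.
have [v20E|v20n] := eqVneq v20 0.
  right; apply: (near_core (V := chart a b) (indep_swap ab)
     (e := u2) (f := u1) (c := v2) (d := v1) (d0 := v10) (e0 := u20)) => //.
  - by move=> ? ?; apply: chart_swap.
  - by rewrite uE; ring.
  - by rewrite vE; ring.
  - by rewrite -v20E.
  - by apply: contra_neq det => ->; rewrite v20E; ring.
  - by apply: contra_neq det => ->; rewrite v20E; ring.
  - by exists u10.
  - exact: gen (chart_r _ a b).
  - exact: gen (chart_l _ a b).
left; pose t := - (v10 / v20); exists t.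
rewrite -(mulfK (indep_l0 ab) (cst t)) -mulrBl.
apply: (near_core (V := chart a b) (indep_shear (t := t) ab)
  (e := u1 + cst t * u2) (f := u2) (c := v1 + cst t * v2) (d := v2) (d0 := v20)
  (e0 := u10 + t * u20)) => //.
- by move=> ? ?; apply: chart_shear.
- by rewrite uE; ring.
- by rewrite vE; ring.
- have -> : 0 = v10 + t * v20 by rewrite /t; field.
  exact: (placeD h Vv1 (placeM h (placeC h _) Vv2)).
- exact: (placeD h Vu1 (placeM h (placeC h _) Vu2)).
- have -> : u10 + t * u20 = (u10 * v20 - u20 * v10) / v20 by rewrite /t; field.
  by rewrite mulf_neq0 ?invr_eq0.
- by exists u20.
- exact: gen (chart_l _ a b).
- by apply: gen; exact: (proj2 (@chart_shear a b t _ _ ab) (chart_r _ _ _)).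
Qed.

Record derivation (d : K -> K) : Prop := Derivation {
  derC : forall c, d (cst c) = 0;
  derD : forall f g, d (f + g) = d f + d g;
  derM : forall f g, d (f * g) = d f * g + f * d g }.

Lemma der0 d : derivation d -> d 0 = 0.
Proof. by move=> dd; have := derC dd 0; rewrite rmorph0. Qed.

Lemma der_div d f g : derivation d -> g != 0 ->
  d (f / g) = (d f - f / g * d g) / g.
Proof.
move=> dd g0; have := derM dd (f / g) g; rewrite divfK // => ->.
by rewrite addrK mulfK.
Qed.

(** Leibniz's rule handles polynomials in a and b, and the quotient rule divides only by functions
    that do not vanish at the point. The coefficients are chosen before d because [jacobian_params]
    uses them for two derivations at once. *)
Lemma chart_diff (a b f : K) : indep a b -> ring_of (chart a b) f ->
  exists f1 f2, [/\ ring_of (chart a b) f1, ring_of (chart a b) f2 &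
    forall d, derivation d -> d f = f1 * d a + f2 * d b].
Proof.
move=> ab; have h := (chart_place ab).1.
pose R := ring_of (chart a b).
have RD f1 f2 : R f1 -> R f2 -> R (f1 + f2).
  by move=> [c ?] [c' ?]; exists (c + c'); apply: (placeD h).
have RB f1 f2 : R f1 -> R f2 -> R (f1 - f2).
  by move=> [c ?] [c' ?]; exists (c - c'); apply: (placeB h).
have RM f1 f2 : R f1 -> R f2 -> R (f1 * f2).
  by move=> [c ?] [c' ?]; exists (c * c'); apply: (placeM h).
have R0 : R 0 by exists 0; apply: (place0 h).

have Rev A : R (ev a b A).
  by exists A.[0, 0]; apply: (place_ev _ h (chart_l _ a b) (chart_r _ a b)).
have Rev1 p : R (ev1 a p) by rewrite -(evC cst a b).
have diff1 p : exists2 g, R g & forall d, derivation d -> d (ev1 a p) = g * d a.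
  elim/poly_ind: p => [|p c [g Rg gE]].
    by exists 0 => // d dd; rewrite rmorph0 mul0r der0.
  exists (g * a + ev1 a p).
    by apply: (RD) => //; apply: RM => //; exists 0; exact: chart_l.
  move=> d dd; rewrite rmorphD rmorphM /= ev1X ev1C (derD dd) (derM dd) (derC dd).
  by rewrite gE //; ring.
have diff A : exists g1 g2, [/\ R g1, R g2 &
    forall d, derivation d -> d (ev a b A) = g1 * d a + g2 * d b].
  elim/poly_ind: A => [|A p [g1 [g2 [Rg1 Rg2 gE]]]].
    by exists 0, 0; split=> // d dd; rewrite rmorph0 !mul0r addr0 der0.
  have [g Rg gE'] := diff1 p.
  have Rb : R b by exists 0; exact: chart_r.
  exists (g1 * b + g), (g2 * b + ev a b A); split.
  - by apply: (RD) => //; apply: (RM).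
  - by apply: (RD) => //; apply: (RM).
  - move=> d dd; rewrite rmorphD rmorphM /= evX evC (derD dd) (derM dd) gE // gE' //.
    by ring.
move=> [c [A [B [B0 -> cE]]]]; have [x1 [x2 [Rx1 Rx2 xE]]] := diff A.
have [y1 [y2 [Ry1 Ry2 yE]]] := diff B.
have Bn := indep_neq0 ab (nz_horner2 B0).
have Ri : R (ev a b B)^-1.
  exists B.[0, 0]^-1; apply: (placeV h) => //.
  exact: (place_ev _ h (chart_l _ a b) (chart_r _ a b)).
exists ((x1 - ev a b A / ev a b B * y1) / ev a b B),
       ((x2 - ev a b A / ev a b B * y2) / ev a b B); split.
- by apply: (RM) => //; apply: (RB) => //; apply: (RM) => //; apply: (RM).
- by apply: (RM) => //; apply: (RB) => //; apply: (RM) => //; apply: (RM).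
- by move=> d dd; rewrite der_div // (xE _ dd) (yE _ dd); field.
Qed.

Definition jacobian (d1 d2 : K -> K) (u v : K) : K := d1 u * d2 v - d2 u * d1 v.

(** Differentiating u1 a + u2 b changes the coefficients u1 and u2 by functions vanishing at the
    point only, so the factor has the determinant of the linear parts as its value. *)
Lemma jacobian_params (a b u v : K) : indep a b ->
  chart a b u 0 -> chart a b v 0 ->
  (forall f, chart a b f 0 -> exists x y,
    [/\ ring_of (chart a b) x, ring_of (chart a b) y & f = x * u + y * v]) ->
  exists e c, [/\ chart a b e c, c != 0 & forall d1 d2, derivation d1 ->
    derivation d2 -> jacobian d1 d2 u v = e * jacobian d1 d2 a b].
Proof.
move=> ab Vu Vv gen; have hpl := chart_place ab; have h := hpl.1.
have [u1 [u2 [[u10 Vu1] [u20 Vu2] uE]]] := chart_maxid ab Vu.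
have [v1 [v2 [[v10 Vv1] [v20 Vv2] vE]]] := chart_maxid ab Vv.
have det := chart_det ab uE vE Vu1 Vu2 Vv1 Vv2 gen.
have aux w1 w2 c1 c2 : chart a b w1 c1 -> chart a b w2 c2 -> exists x y,
    [/\ chart a b x c1, chart a b y c2 & forall d, derivation d ->
       d (w1 * a + w2 * b) = x * d a + y * d b].
  move=> V1 V2; have [|x1 [y1 [[? Vx1] [? Vy1] E1]]] := chart_diff ab (f := w1).
    by exists c1.
  have [|x2 [y2 [[? Vx2] [? Vy2] E2]]] := chart_diff ab (f := w2); first by exists c2.
  exists (w1 + (x1 * a + x2 * b)), (w2 + (y1 * a + y2 * b)); split.
  - rewrite -[c1]addr0; apply: (placeD h V1); rewrite -[0]addr0.
    by apply: (placeD h); rewrite -(mulr0 (GRing.zero : k)); [have := placeM h Vx1 (chart_l _ a b) | have := placeM h Vx2 (chart_r _ a b)]; rewrite !mulr0.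
  - rewrite -[c2]addr0; apply: (placeD h V2); rewrite -[0]addr0.
    by apply: (placeD h); rewrite -(mulr0 (GRing.zero : k)); [have := placeM h Vy1 (chart_l _ a b) | have := placeM h Vy2 (chart_r _ a b)]; rewrite !mulr0.
  - by move=> d dd; rewrite (derD dd) !(derM dd) E1 // E2 //; ring.
have [x [y [Vx Vy E]]] := aux _ _ _ _ Vu1 Vu2.
have [z [w [Vz Vw E']]] := aux _ _ _ _ Vv1 Vv2.
exists (x * w - y * z), (u10 * v20 - u20 * v10); split=> //.
  exact: (placeB h (placeM h Vx Vw) (placeM h Vy Vz)).
by move=> d1 d2 dd1 dd2; rewrite /jacobian uE vE !E // !E' //; ring.
Qed.

(** The factor 1 / a says that the canonical divisor of a blow-up contains the exceptional curve a =
    0 with multiplicity one. *)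
Lemma jacobian_div (d1 d2 : K -> K) (a b : K) t : derivation d1 -> derivation d2 ->
  a != 0 -> jacobian d1 d2 a (b / a - cst t) = jacobian d1 d2 a b / a.
Proof.
move=> dd1 dd2 a0; rewrite /jacobian -rmorphN !(derD dd1) !(derD dd2).
by rewrite (derC dd1) (derC dd2) !der_div //; field.
Qed.

Lemma jacobian_scale (d1 d2 : K -> K) (a b : K) c : derivation d1 -> derivation d2 ->
  jacobian d1 d2 (cst c * a) b = cst c * jacobian d1 d2 a b.
Proof.
move=> dd1 dd2; rewrite /jacobian (derM dd1) (derM dd2) (derC dd1) (derC dd2).
by ring.
Qed.

Lemma jacobian_swap (d1 d2 : K -> K) (a b : K) :
  jacobian d1 d2 b a = - jacobian d1 d2 a b.
Proof. by rewrite /jacobian; ring. Qed.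

End NearChart.

(** * Regular rational functions in two variables *)

Section LowestTerms.

Variable k : closedFieldType.
Implicit Types (A B D N W : {poly {poly k}}).

Lemma nat_min (P : nat -> Prop) : (exists n, P n) ->
  exists2 n, P n & forall m, P m -> (n <= m)%N.
Proof.
move=> [n]; elim/ltn_ind: n => n IH Pn.
have [[m [mn Pm]]|H] := classic (exists m, (m < n)%N /\ P m); first exact: IH Pm.
by exists n => // m Pm; rewrite leqNgt; apply/negP => mn; apply: H; exists m.
Qed.

(** Restriction to the line on which the inner variable, the first of the two coordinates, equals
    c. *)
Definition inner (c : k) : {rmorphism {poly {poly k}} -> {poly k}} :=
  map_poly (horner_eval c).

Lemma horner_inner c A d : (inner c A).[d] = A.[d, c].
Proof.
elim/poly_ind: A => [|A p IH]; first by rewrite rmorph0 !horner0.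
rewrite rmorphD rmorphM /= map_polyX map_polyC /= !hornerE IH.
by rewrite /horner_eval.
Qed.

Lemma inner_eq0 c A : inner c A = 0 -> exists A1, A = ('X - c%:P)%:P * A1.
Proof.
move=> h; exists (map_poly (fun p => p %/ ('X - c%:P)) A).
apply/polyP => i; rewrite coefCM coef_map_id0 ?div0p // mulrC divpK //.
rewrite dvdp_XsubCl; have := congr1 (fun p : {poly k} => p`_i) h.
by rewrite coef0 coef_map /= /horner_eval => /eqP.
Qed.

Lemma innerC c p : inner c p%:P = (p.[c])%:P.
Proof. by rewrite /inner /= map_polyC. Qed.

(** A form of Gauss's lemma without gcds. A root c of e makes W or D vanish on the line of [inner]
    c. In the first case a linear factor is cancelled from e and W; in the second it divides B too,
    as it does not divide N, and is cancelled from D and B. The bound n controls the linear factors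
    left in e and in the leading coefficient of D. *)
Lemma dvd_of_coprime N n : forall D W A B (e : {poly k}),
  (size e + size (lead_coef D) <= n)%N -> e != 0 -> D != 0 ->
  (forall c, inner c D = 0 -> inner c N <> 0) ->
  N * B = A * D -> e%:P * B = W * D -> exists W', B = W' * D.
Proof.
elim: n => [|n IH] D W A B e.
  by rewrite leqn0 addn_eq0 size_poly_eq0 => /andP[/eqP-> _]; rewrite eqxx.
move=> sz e0 D0 cop NB eB; have [sz1|sz1] := leqP (size e) 1.
  have [c eE] : exists c, e = c%:P by exists e`_0; apply: size1_polyC.
  have c0 : c != 0 by apply: contra_neq e0 => c0; rewrite eE c0.
  exists ((c^-1)%:P%:P * W); rewrite -mulrA -eB eE mulrA -!polyCM mulVf //.
  by rewrite !polyC1 mul1r.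
have [c /factor_theorem[e1 eE]] : exists c, root e c.
  by apply/closed_rootP; rewrite neq_ltn sz1 orbT.
have x0 : ('X - c%:P)%:P != 0 :> {poly {poly k}}.
  by rewrite polyC_eq0 polyXsubC_eq0.
have e10 : e1 != 0 by apply: contra_neq e0 => e10; rewrite eE e10 mul0r.
have : inner c W * inner c D = 0.
  by rewrite -rmorphM -eB rmorphM /= innerC eE hornerM hornerXsubC subrr mulr0 mul0r.
move/eqP; rewrite mulf_eq0 => /orP[/eqP/inner_eq0[W1 WE]|/eqP iD].
  apply: (IH D W1 A B e1) => //.
    by move: sz; rewrite eE size_Mmonic ?monicXsubC // size_XsubC addn2.
  apply: (mulfI x0); rewrite mulrA -polyCM (mulrC ('X - _)) -eE eB WE.
  by rewrite mulrA.
have [D1 DE] := inner_eq0 iD.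
have : inner c N * inner c B = 0 by rewrite -rmorphM NB rmorphM /= iD mulr0.
move/eqP; rewrite mulf_eq0 => /orP[/eqP/(cop _ iD)//|/eqP/inner_eq0[B1 BE]].
have D10 : D1 != 0 by apply: contra_neq D0 => D10; rewrite DE D10 mulr0.
have [] := IH D1 W A B1 e.
- move: sz; rewrite DE lead_coefM lead_coefC mulrC size_Mmonic ?monicXsubC ?lead_coef_eq0 //.
  by rewrite size_XsubC addn2 addnS.
- by [].
- by [].
- by move=> d iD1; apply: cop; rewrite DE rmorphM iD1 mulr0.
- by apply: (mulfI x0); rewrite mulrCA -BE NB DE; ring.
- by apply: (mulfI x0); rewrite mulrCA -BE eB DE; ring.
- by move=> W' B1E; exists W'; rewrite BE B1E DE; ring.
Qed.

(** D is chosen of least degree in the outer variable, then with a leading coefficient of least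
    degree. The second choice excludes common factors in the inner variable; the first makes the
    pseudo-division of B by D exact. *)
Lemma lowest_terms N0 D0 : D0 != 0 -> exists N D,
  [/\ D != 0, N0 * D = N * D0 &
      forall A B, N0 * B = A * D0 -> exists W, B = W * D].
Proof.
move=> D00; pose I N D := D != 0 /\ N0 * D = N * D0.
have [|m [N1 [D1 [I1 szD1]]] mmin] := nat_min
  (P := fun m => exists N D, I N D /\ size D = m).
  by exists (size D0), N0, D0.
have [|l [N [D [IND szD szl]]] lmin] := nat_min
  (P := fun l => exists N D, [/\ I N D, size D = m & size (lead_coef D) = l]).
  by exists (size (lead_coef D1)), N1, D1.
have [Dn ND] := IND; exists N, D; split=> // A B NB.
have NB' : N * B = A * D.
  by apply: (mulIf D00); rewrite mulrAC -ND mulrAC NB mulrAC.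
have cop c : inner c D = 0 -> inner c N <> 0.
  move=> /inner_eq0[D' DE] /inner_eq0[N' NE].
  have x0 : ('X - c%:P)%:P != 0 :> {poly {poly k}}.
    by rewrite polyC_eq0 polyXsubC_eq0.
  have x0' : 'X - c%:P != 0 :> {poly k} by rewrite polyXsubC_eq0.
  have D'0 : D' != 0 by apply: contra_neq Dn => D'0; rewrite DE D'0 mulr0.
  have [|sz] := leqP l (size (lead_coef D')).
    rewrite -szl DE lead_coefM lead_coefC mulrC size_Mmonic ?monicXsubC ?lead_coef_eq0 //.
    by rewrite size_XsubC addn2 ltnn.
  suff /lmin : exists N D, [/\ I N D, size D = m & size (lead_coef D) = size (lead_coef D')].
    by rewrite leqNgt sz.
  exists N', D'; split=> //.
    by split=> //; apply: (mulfI x0); rewrite mulrCA -DE ND NE mulrA.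
  by rewrite -szD DE mul_polyC size_scale.
have := Pdiv.ComRing.rdivp_eq D B; set e := _ ^+ _; set Q := Pdiv.CommonRing.rdivp _ _.
set R := Pdiv.CommonRing.rmodp _ _; rewrite -mul_polyC => eB.
(* The remainder is again a denominator of the fraction, with numerator e A - Q N, and its degree is
   smaller than that of D. *)
have R0 : R = 0.
  apply/eqP/negPn/negP => Rn.
  have /mmin : exists N' D', I N' D' /\ size D' = size (R).
    exists (e%:P * A - Q * N), (R); split=> //; split=> //.
    have -> : R = e%:P * B - Q * D by rewrite eB addrC addKr.
    by rewrite mulrBr !(mulrCA N0) NB ND; ring.
  by rewrite leqNgt -szD Pdiv.CommonRing.ltn_rmodp Dn.
rewrite R0 addr0 in eB.
apply: (dvd_of_coprime (leqnn _) _ Dn cop NB' eB).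
by rewrite expf_neq0 // lead_coef_eq0.
Qed.

Lemma poly_all_roots (p : {poly k}) : (forall u, p.[u] = 0) -> p = 0.
Proof.
move=> h; apply/eqP/negPn/negP => /closed_nonrootP[x].
by rewrite /root h eqxx.
Qed.

Lemma inner_all0 A : (forall u, inner u A = 0) -> A = 0.
Proof.
move=> h; apply/polyP => i; rewrite coef0; apply: poly_all_roots => u.
have := congr1 (fun p : {poly k} => p`_i) (h u).
by rewrite coef0 coef_map.
Qed.

Lemma poly2_all_roots A : (forall u v, A.[v, u] = 0) -> A = 0.
Proof.
move=> h; apply: inner_all0 => u; apply: poly_all_roots => v.
by rewrite horner_inner.
Qed.

Lemma poly_no_root (p : {poly k}) : (forall u, p.[u] != 0) -> p = (p`_0)%:P.
Proof.
move=> h; apply: size1_polyC; rewrite leqNgt; apply/negP => sz.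
have /closed_rootP[x] : size p != 1%N by rewrite neq_ltn sz orbT.
by rewrite /root (negPf (h x)).
Qed.

Lemma poly2_no_root A : (forall u v, A.[v, u] != 0) ->
  exists2 c, c != 0 & A = c%:P%:P.
Proof.
move=> h; have A0 i : (0 < i)%N -> A`_i = 0.
  case: i => // i _; apply: poly_all_roots => u.
  have /(congr1 (fun p : {poly k} => p`_i.+1)) : inner u A = ((inner u A)`_0)%:P.
    by apply: poly_no_root => v; rewrite horner_inner.
  by rewrite coef_map coefC.
have AE : A = (A`_0)%:P.
  by apply/polyP => [[|i]]; rewrite coefC //= A0.
have A0E : A`_0 = (A`_0`_0)%:P.
  by apply: poly_no_root => u; have := h u 0; rewrite {1}AE hornerC.
exists A`_0`_0; last by rewrite -A0E.
by have := h 0 0; rewrite {1}AE hornerC {1}A0E hornerC.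
Qed.

Lemma dvdX_coprime (R : idomainType) (P Q S : {poly R}) n :
  P * Q = 'X^n * S -> Q`_0 != 0 -> forall i, (i < n)%N -> P`_i = 0.
Proof.
move=> PQ Q0; elim/ltn_ind => i IH iln.
have := congr1 (fun p : {poly R} => p`_i) PQ.
rewrite coefM coefXnM iln big_ord_recr /= subnn big1 => [|j _].
  by rewrite add0r => /eqP; rewrite mulf_eq0 (negPf Q0) orbF => /eqP.
by rewrite IH ?mul0r //=; apply: ltn_trans iln.
Qed.

Variables (K : fieldType) (cst : {rmorphism k -> K}).
Local Notation ev := (ev cst).

Definition rational (a b f : K) : Prop := exists A B, B != 0 /\ f = ev a b A / ev a b B.

Lemma chartat_reduced a b f : indep cst a b -> rational a b f ->
  exists N D, [/\ D != 0, f = ev a b N / ev a b D &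
    forall A B, B != 0 -> f = ev a b A / ev a b B -> exists W, B = W * D].
Proof.
move=> ab [N0 [D0 [D00 fE]]]; have [N [D [Dn ND low]]] := lowest_terms N0 D00.
have nz A := @indep_neq0 _ _ cst a b A ab.
exists N, D; split=> // [|A B Bn fE'].
  by rewrite fE; apply/eqP; rewrite eqr_div ?nz // -!rmorphM ND.
apply: (low A); apply: (indep_inj ab); rewrite !rmorphM /=; apply/eqP.
by rewrite -eqr_div ?nz // -fE -fE'.
Qed.

Lemma chart_transl a b a0 b0 f c : indep cst a b ->
  chart cst (a - cst a0) (b - cst b0) f c -> chartat cst a0 b0 a b f c.
Proof.
move=> ab; have h := (chartat_place a0 b0 ab).1; apply: chart_sub => //.
  by have := placeB h (chartat_l cst a0 b0 a b) (placeC h a0); rewrite subrr.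
by have := placeB h (chartat_r cst a0 b0 a b) (placeC h b0); rewrite subrr.
Qed.

(** Regularity at a point keeps the reduced denominator from vanishing there, and a polynomial
    without zeros on the whole plane over an algebraically closed field is constant. *)
Lemma regular_polynomial a b f : indep cst a b -> rational a b f ->
  (forall a0 b0, ring_of (chart cst (a - cst a0) (b - cst b0)) f) ->
  exists A, f = ev a b A.
Proof.
move=> ab /(chartat_reduced ab)[N [D [Dn fE low]]] reg.
have [|c c0 DE] := poly2_no_root (A := D).
  move=> u v; have [_ /(chart_transl ab)[A [B [B0 fE' _]]]] := reg u v.
  have [W BE] := low A B (nz_horner2 B0) fE'.
  by move: B0; rewrite BE !hornerM mulf_eq0 negb_or => /andP[].
exists ((c^-1)%:P%:P * N); rewrite fE DE rmorphM /= !evC !ev1C fmorphV.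
exact: mulrC.
Qed.

End LowestTerms.

(** * Functions on an A1 singularity *)

Section Monomials.

Variables (k : closedFieldType) (K : fieldType) (cst : {rmorphism k -> K}).
Local Notation ev := (ev cst).
Local Notation ev1 := (ev1 cst).
Local Notation indep := (indep cst).
Local Notation chart := (chart cst).
Local Notation chartat := (chartat cst).
Implicit Types A : {poly {poly k}}.

Lemma ev_sum2 (a b : K) A : ev a b A =
  \sum_(j < size A) \sum_(i < size A`_j) cst A`_j`_i * a ^+ i * b ^+ j.
Proof.
rewrite ev_sum; apply: eq_bigr => j _; rewrite -mulr_suml; congr (_ * _).
rewrite -{1}[A`_j]coefK poly_def rmorph_sum; apply: eq_bigr => i _ /=.
by rewrite -mul_polyC rmorphM rmorphXn /= ev1C ev1X.
Qed.

(** The effect on polynomials of a monomial substitution, up to a power of one variable. As g may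
    involve truncated subtraction, exponents can collide outside the support of A, hence the form of
    the hypothesis of [coef_reexp]. *)
Definition reexp (g u : nat -> nat -> nat) (A : {poly {poly k}}) : {poly {poly k}} :=
  \sum_(j < size A) \sum_(i < size A`_j) (A`_j`_i *: 'X^(u i j))%:P * 'X^(g i j).

Lemma ev_reexp g u (a b : K) A : ev a b (reexp g u A) =
  \sum_(j < size A) \sum_(i < size A`_j) cst A`_j`_i * a ^+ u i j * b ^+ g i j.
Proof.
rewrite rmorph_sum; apply: eq_bigr => j _; rewrite rmorph_sum.
apply: eq_bigr => i _; rewrite rmorphM rmorphXn /= evX evC -mul_polyC.
by rewrite rmorphM rmorphXn /= ev1C ev1X.
Qed.

Lemma coef_reexp g u A i j :
  (forall i' j', A`_j'`_i' != 0 -> g i' j' = g i j -> u i' j' = u i j ->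
     i' = i /\ j' = j) -> (reexp g u A)`_(g i j)`_(u i j) = A`_j`_i.
Proof.
move=> inj; have coefE i' j' : ((A`_j'`_i' *: 'X^(u i' j'))%:P * 'X^(g i' j'))`_(g i j)`_(u i j)
    = A`_j'`_i' *+ ((i' == i) && (j' == j)).
  have [A0|A0] := eqVneq A`_j'`_i' 0.
    by rewrite A0 scale0r mul0r !coef0 mul0rn.
  rewrite coefCM coefXn; have [gE|gN] := eqVneq (g i j) (g i' j'); last first.
    rewrite mulr0 coef0; case: (i' =P i) => [ii|//]; case: (j' =P j) => [jj|//].
    by move: gN; rewrite ii jj eqxx.
  rewrite mulr1 coefZ coefXn; have [uE|uN] := eqVneq (u i j) (u i' j'); last first.
    rewrite mulr0; case: (i' =P i) => [ii|//]; case: (j' =P j) => [jj|//].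
    by move: uN; rewrite ii jj eqxx.
  by have [-> ->] := inj _ _ A0 (esym gE) (esym uE); rewrite !eqxx mulr1.
rewrite /reexp coef_sum coef_sum.
under eq_bigr => j' _ do rewrite coef_sum coef_sum.
under eq_bigr => j' _ do under eq_bigr => i' _ do rewrite coefE.
have [jA|jA] := ltnP j (size A); last first.
  rewrite (nth_default _ jA) coef0 big1 // => j' _; rewrite big1 // => i' _.
  by rewrite (ltn_eqF (leq_trans (ltn_ord j') jA)) andbF.
rewrite (bigD1 (Ordinal jA)) //= [X in _ + X]big1 ?addr0 => [|j' jj']; last first.
  rewrite big1 // => i' _.
  by rewrite (_ : (val j' == j) = false) ?andbF //; apply: contra_neqF jj' => /eqP jj'; apply: val_inj.
have [iA|iA] := ltnP i (size A`_j); last first.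
  rewrite (nth_default _ iA) big1 // => i' _.
  by rewrite (ltn_eqF (leq_trans (ltn_ord i') iA)).
rewrite (bigD1 (Ordinal iA)) //= !eqxx big1 ?addr0 // => i' ii'.
by rewrite (_ : (val i' == i) = false) //; apply: contra_neqF ii' => /eqP ii'; apply: val_inj.
Qed.

(** A strict bound for i + j on the support; added to exponents, it makes the subtractions of
    natural numbers below exact. *)
Definition ebound (A : {poly {poly k}}) : nat := (size A + \max_(j < size A) size (A`_j)%R)%N.

Lemma ebound_lt (A : {poly {poly k}}) i j : A`_j`_i != 0 -> (i + j < ebound A)%N.
Proof.
move=> A0; have jA : (j < size A)%N.
  by rewrite ltnNge; apply: contraNN A0 => jA; rewrite (nth_default _ jA) coef0.
have iA : (i < size (A`_j)%R)%N.
  by rewrite ltnNge; apply: contraNN A0 => iA; rewrite (nth_default _ iA).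
rewrite addnC; apply: (leq_trans (n := (size A + size (A`_j)%R)%N)).
  by rewrite -addnS; apply: leq_add => //; apply: ltnW.
by rewrite leq_add2l; apply: (leq_bigmax (Ordinal jA)).
Qed.

Lemma ebound_ord (A : {poly {poly k}}) (j : 'I_(size A)) (i : 'I_(size A`_j)) :
  (i + j < ebound A)%N.
Proof.
rewrite addnC; apply: (leq_trans (n := (size A + size (A`_j)%R)%N)).
  by rewrite -addnS; apply: leq_add => //; apply: ltnW.
by rewrite leq_add2l; apply: (leq_bigmax j).
Qed.

(** One point of the line b = 0 suffices: a denominator that does not vanish there is not divisible
    by b, so h has nonnegative order along the whole line. The monomials of the sum being distinct,
    each of them has order at least m. *)
Lemma exponent_bound (a b : K) a0 A g m h : indep a b ->
  (forall i i' j, A`_j`_i != 0 -> A`_j`_i' != 0 -> g i j = g i' j -> i = i') ->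
  b ^+ m * h = \sum_(j < size A) \sum_(i < size A`_j) cst A`_j`_i * a ^+ j * b ^+ g i j ->
  ring_of (chartat a0 0 a b) h -> forall i j, A`_j`_i != 0 -> (m <= g i j)%N.
Proof.
move=> ab inj hE [_ [N [D [D0 hE' _]]]] i j A0; rewrite leqNgt; apply/negP => gm.
pose P := reexp g (fun _ j => j) A.
have PD : P * D = 'X^m * N.
  apply: (indep_inj ab); rewrite rmorphM [RHS]rmorphM rmorphXn /= evX ev_reexp -hE hE'.
  have Dn := indep_neq0 ab (nz_horner2 D0).
  by rewrite mulrA divfK.
have D00 : D`_0 != 0.
  by apply: contra_neq D0 => D00; rewrite polyC0 horner_coef0 D00 horner0.
have := congr1 (fun p : {poly k} => p`_j) (dvdX_coprime PD D00 gm).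
rewrite coef0 -[j in LHS]/((fun _ j => j) i j) coef_reexp.
  by move/eqP; rewrite (negPf A0).
by move=> i' j' A'0 gE jE; move: gE A'0; rewrite jE => gE A'0; split=> //; apply: inj gE.
Qed.

(** Used with b = z/x and a = y/x, so that x/z = 1/b and y/z = a/b: the order along the line z = 0
    bounds the total degree. *)
Lemma degree_bound (a b : K) a0 A : indep a b ->
  ring_of (chartat a0 0 a b) (b ^+ 3 * ev b^-1 (a / b) A) ->
  forall i j, A`_j`_i != 0 -> (i + j <= 3)%N.
Proof.
move=> ab hreg; have b0 := indep_r0 ab; pose m := ebound A.
have H i j : A`_j`_i != 0 -> (m <= m + 3 - (i + j))%N.
  move=> A0; apply: (@exponent_bound a b a0 A (fun i j => m + 3 - (i + j))%N m _ ab _ _ hreg i j A0) => [i0 i' j0 Ai Ai'|].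
    by have := ebound_lt Ai; have := ebound_lt Ai'; rewrite /m; lia.
  rewrite mulrA -exprD ev_sum2 mulr_sumr; apply: eq_bigr => j0 _.
  rewrite mulr_sumr; apply: eq_bigr => i0 _.
  have le : (i0 + j0 <= m + 3)%N by have := ebound_ord i0; rewrite /m; lia.
  rewrite -{1}(subnK le) !exprD expr_div_n exprVn; field.
  by rewrite !expf_neq0.
by move=> i j A0; have := H i j A0; have := ebound_lt A0; rewrite -/m; lia.
Qed.

(** Used with b = z/x and a = xy/z^2, for which b = 0 is the second exceptional curve. The factor b
    is what remains of (z/x)^3 after division by the equation b^2 of the relative canonical
    divisor. *)
Lemma slope_bound (a b : K) a0 A : indep a b ->
  ring_of (chartat a0 0 a b) (b * ev b^-1 (a * b) A) ->
  forall i j, A`_j`_i != 0 -> (i <= j.+1)%N.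
Proof.
move=> ab hreg; have b0 := indep_r0 ab; pose m := ebound A.
have H i j : A`_j`_i != 0 -> (m <= m + 1 + j - i)%N.
  move=> A0; apply: (@exponent_bound a b a0 A (fun i j => m + 1 + j - i)%N m _ ab _ _ hreg i j A0) => [i0 i' j0 Ai Ai'|].
    by have := ebound_lt Ai; have := ebound_lt Ai'; rewrite /m; lia.
  rewrite mulrA -exprSr ev_sum2 mulr_sumr; apply: eq_bigr => j0 _.
  rewrite mulr_sumr; apply: eq_bigr => i0 _.
  have le : (i0 <= m + 1 + j0)%N by have := ebound_ord i0; rewrite /m; lia.
  rewrite -addn1 exprMn exprVn; move: (congr1 (fun n => b ^+ n) (subnK le)).
  rewrite exprD [b ^+ (m + 1 + j0)]exprD => E.
  have n0 := expf_neq0 i0 b0.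
  apply: (mulIf n0); rewrite -[RHS]mulrA E; field.
  by [].
by move=> i j A0; have := H i j A0; have := ebound_lt A0; rewrite -/m; lia.
Qed.

(* The exchange (y, s) = (c t^2, 1/t) of the two charts of the resolution of an
   A1 singularity acts on polynomials by [flip], up to a power of t. *)
Definition flip n : {poly {poly k}} -> {poly {poly k}} :=
  reexp (fun i j => i.*2 + n - j)%N (fun i _ => i).

Lemma ev_flip n (c t : K) A : t != 0 -> (ebound A <= n)%N ->
  ev c t (flip n A) = t ^+ n * ev (c * t ^+ 2) t^-1 A.
Proof.
move=> t0 An; rewrite ev_reexp ev_sum2 mulr_sumr; apply: eq_bigr => j _.
rewrite mulr_sumr; apply: eq_bigr => i _.
have le : (j <= i.*2 + n)%N by have := ebound_ord i; lia.
rewrite exprMn exprVn -exprM mul2n.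
move: (congr1 (fun n => t ^+ n) (subnK le)).
rewrite exprD [t ^+ (_ + n)]exprD => E; have n0 := expf_neq0 j t0.
apply: (mulIf n0); rewrite -[LHS]mulrA E; field.
by [].
Qed.

Lemma coef_flip n A i j : (ebound A <= n)%N -> A`_j`_i != 0 ->
  (flip n A)`_(i.*2 + n - j)`_i = A`_j`_i.
Proof.
move=> An A0; apply: (@coef_reexp (fun i j => i.*2 + n - j)%N (fun i _ => i)).
move=> i' j' A'0 gE iE; split=> //; move: gE; rewrite iE.
by have := ebound_lt A0; have := ebound_lt A'0; lia.
Qed.

Lemma inner_flip n A : (ebound A <= n)%N ->
  inner 0 (flip n A) = \sum_(j < size A) (A`_j`_0)%:P * 'X^(n - j).
Proof.
move=> An; rewrite rmorph_sum; apply: eq_bigr => j _; rewrite rmorph_sum /=.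
have E (i : nat) : inner 0 ((A`_j`_i *: 'X^i)%:P * 'X^(i.*2 + n - j)) =
    (A`_j`_i *+ (i == 0%N))%:P * 'X^(n - j).
  rewrite rmorphM rmorphXn /= innerC map_polyX hornerZ hornerXn expr0n.
  by case: i => [|i]; rewrite ?mulr1 ?mulr1n // mulr0 mulr0n !mul0r.
rewrite (eq_bigr _ (fun (i : 'I_(size A`_j)) _ => E i)).
case: (size A`_j) (@nth_default _ 0 A`_j 0) => [->//|n' _].
  by rewrite big_ord0 mul0r.
by rewrite big_ord_recl big1 ?addr0 ?mulr1n // => i _; rewrite mulr0n mul0r.
Qed.

End Monomials.

Section Normality.

Variables (k : closedFieldType) (K : fieldType) (cst : {rmorphism k -> K}).
Local Notation ev := (ev cst).
Local Notation indep := (indep cst).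
Local Notation chart := (chart cst).
Local Notation chartat := (chartat cst).
Implicit Types A P W : {poly {poly k}}.

Lemma indep_flip (c t : K) : indep c t -> indep (c * t ^+ 2) t^-1.
Proof.
move=> ct A A0; have t0 := indep_r0 ct.
have F0 : flip (ebound A) A = 0.
  by apply: ct; rewrite ev_flip // A0 mulr0.
apply/polyP => j; apply/polyP => i; rewrite !coef0; apply/eqP/negPn/negP => Aij.
by move: (Aij); rewrite -(coef_flip (leqnn _) Aij) F0 !coef0 eqxx.
Qed.

Lemma lowest_coef (R : nzRingType) (Q : {poly R}) m : Q`_m != 0 ->
  exists f Q1, [/\ (f <= m)%N, Q = Q1 * 'X^f & Q1`_0 != 0].
Proof.
move=> Qm; have [|f Qf fmin] := nat_min (P := fun i => Q`_i != 0); first by exists m.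
exists f, (drop_poly f Q); split; first exact: fmin.
- rewrite -{1}[Q](poly_take_drop f) (_ : take_poly f Q = 0) ?add0r //.
  apply/polyP => i; rewrite coef_take_poly coef0; case: ltnP => // fi.
  by apply/eqP/negPn/negP => /fmin; rewrite leqNgt fi.
- by rewrite coef_drop_poly add0n.
Qed.

(** Flipping is an involution up to powers of the outer variable, because (c t^2) (1/t)^2 = c; the
    relation is checked by evaluating at (c t^2, 1/t). *)
Lemma flipM (c t : K) n m P W A : indep c t ->
  (ebound P <= n)%N -> (ebound W <= n)%N -> (ebound A <= m)%N -> (m <= n)%N ->
  P * W = flip m A -> flip n P * flip n W = 'X^(n + n - m) * A.
Proof.
move=> ct Pn Wn Am mn PW; have t0 := indep_r0 ct; have ys := indep_flip ct.
have s0 := invr_neq0 t0.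
have e : c * t ^+ 2 * t^-1 ^+ 2 = c by field.
apply: (indep_inj ys); rewrite !rmorphM rmorphXn /= evX !ev_flip //.
rewrite e invrK mulrACA -exprD -rmorphM PW ev_flip // mulrA; congr (_ * _).
rewrite !exprVn; apply: (mulfI (expf_neq0 (n + n) t0)).
rewrite mulVKf ?expf_neq0 // -{1}(subnK (leq_trans mn (leq_addr n n))).
by rewrite exprD mulrAC mulfV ?mul1r // expf_neq0.
Qed.

(** The claim says that the flip of P is divisible by X^n, that is 2 i + n - j >= n on the support.
    Its product with the flip of W is divisible by the power 2 n - m of X, and the flip of W
    accounts for at most n - m of it. *)
Lemma flip_bound (c t : K) n m W P A : indep c t ->
  (ebound P <= n)%N -> (ebound W <= n)%N -> (ebound A <= m)%N -> (m <= n)%N ->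
  (flip n W)`_(n - m) != 0 -> P * W = flip m A ->
  forall i j, P`_j`_i != 0 -> (j <= i.*2)%N.
Proof.
move=> ct Pn Wn Am mn W0 PW i j Pij.
have E := flipM ct Pn Wn Am mn PW.
have [f [Q1 [fnm QE Q10]]] := lowest_coef W0.
have E' : flip n P * Q1 = 'X^(n + n - m - f) * A.
  have X0 : 'X^f != 0 :> {poly {poly k}} by rewrite expf_neq0 // polyX_eq0.
  apply: (mulIf X0); rewrite -mulrA -QE E mulrAC -exprD subnK //.
  by apply: leq_trans fnm _; rewrite leq_sub2r // leq_addr.
rewrite leqNgt; apply/negP => ji.
have lt : (i.*2 + n - j < n + n - m - f)%N.
  by have := ebound_lt Pij; lia.
have := congr1 (fun p : {poly k} => p`_i) (dvdX_coprime E' Q10 lt).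
by rewrite coef_flip // coef0 => /eqP; rewrite (negPf Pij).
Qed.

(** A monomial c^i t^j with j <= 2 i is a product of factors c, ct and ct^2, which all have value 0;
    only the constant term survives. *)
Lemma place_cone V (c t : K) A : preplace cst V -> t != 0 ->
  V c 0 -> V (c * t) 0 -> V (c * t ^+ 2) 0 ->
  (forall i j, A`_j`_i != 0 -> (j <= i.*2)%N) -> V (ev c t A) A`_0`_0.
Proof.
move=> h t0 V1 V2 V3 cone.
have mono i j : (j <= i.*2)%N -> V (c ^+ i * t ^+ j) ((i == 0%N)%:R).
  elim: i j => [|i IH] j ji.
    by move: ji; rewrite leqn0 => /eqP->; rewrite !expr0 mulr1; apply: (place1 h).
  have [lt|] := ltnP j 2.
    rewrite exprS -mulrA; have [j0|j1] : j = 0%N \/ j = 1%N by lia.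
      by rewrite j0 -[_%:R](mul0r (i == 0%N)%:R); apply: (placeM h V1); apply: IH.
    rewrite j1 expr1 mulrCA.
    by have := placeM h (IH 0%N isT) V2; rewrite expr0 mulr1 mulr0.
  move=> j2; rewrite -(subnK j2) exprD exprS.
  have -> : c * c ^+ i * (t ^+ (j - 2) * t ^+ 2) = c * t ^+ 2 * (c ^+ i * t ^+ (j - 2)).
    by ring.
  by have := placeM h V3 (IH (j - 2)%N _); rewrite mul0r; apply; lia.
rewrite ev_sum2.
have E : A`_0`_0 = \sum_(j < size A) \sum_(i < size A`_j) A`_j`_i * (i == 0%N :> nat)%:R *+ (j == 0%N :> nat).
  case: (size A) (@nth_default _ 0 A 0) => [->|n _]; rewrite ?coef0 ?big_ord0 //.
  rewrite big_ord_recl /= [X in _ + X]big1 ?addr0 => [|j _]; last first.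
    by rewrite big1.
  case: (size A`_0) (@nth_default _ 0 A`_0 0) => [->|m _]; rewrite ?big_ord0 //.
  by rewrite big_ord_recl big1 ?addr0 ?mulr1 // => i _; rewrite mulr0.
rewrite E; apply: (place_sum _ h) => j; apply: (place_sum _ h) => i.
have [Aij|Aij] := eqVneq A`_j`_i 0.
  by rewrite Aij rmorph0 !mul0r mul0rn; apply: (place0 h).
have ji := cone i j Aij; rewrite -mulrA -mulrnAr.
have -> : (i == 0%N :> nat)%:R *+ (j == 0%N :> nat) = (i == 0%N :> nat)%:R :> k.
  by move: ji; case: eqP => [->|_]; [rewrite leqn0 => ->; rewrite mulr1n | rewrite mul0rn].
by apply: (placeM h (placeC h _)); apply: mono.
Qed.

(* c and t are the coordinates of a chart of the minimal resolution of the A1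
   singularity Spec k[c, ct, ct^2], with exceptional curve c = 0. *)
Lemma normal_A1 V (c t h : K) : indep c t -> rational cst c t h ->
  (forall t0, ring_of (chart c (t - cst t0)) h) ->
  ring_of (chart (c * t ^+ 2) t^-1) h ->
  preplace cst V -> V c 0 -> V (c * t) 0 -> V (c * t ^+ 2) 0 -> ring_of V h.
Proof.
move=> ct rat reg [_ [A2 [B2 [B20 hE2 _]]]] hV V1 V2 V3; have t0 := indep_r0 ct.
have [N [D [Dn hE low]]] := chartat_reduced ct rat.
(* D has no zero on the curve c = 0 in this chart, so its restriction to that curve is a constant,
   nonzero by the next fact. *)
have iD0 : inner 0 D = ((inner 0 D)`_0)%:P.
  apply: poly_no_root => v; rewrite horner_inner.
  have [x hc] := reg v; rewrite -[c]subr0 -(rmorph0 cst) in hc.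
  have [A [B [B0 hE' _]]] := chart_transl ct hc.
  have [W BE] := low A B (nz_horner2 B0) hE'.
  by move: B0; rewrite BE !hornerM mulf_eq0 negb_or => /andP[].
have D00 : D`_0`_0 != 0.
  have [x hc] := reg 0; rewrite -[c]subr0 -(rmorph0 cst) in hc.
  have [A [B [B0 hE' _]]] := chart_transl ct hc.
  have [W BE] := low A B (nz_horner2 B0) hE'.
  by move: B0; rewrite BE !hornerM mulf_eq0 negb_or polyC0 !horner_coef0 => /andP[].
have Dj j : (0 < j)%N -> D`_j`_0 = 0.
  move=> j0; have := congr1 (fun p : {poly k} => p`_j) iD0.
  by rewrite coefC gtn_eqF // coef_map /= /horner_eval horner_coef0.
pose m := maxn (ebound A2) (ebound B2).
have A2m : (ebound A2 <= m)%N by apply: leq_maxl.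
have B2m : (ebound B2 <= m)%N by apply: leq_maxr.
have flip0 A : (ebound A <= m)%N -> A != 0 -> flip m A != 0.
  move=> Am; apply: contra_neq => F0; apply: (indep_flip ct); apply/eqP.
  have /eqP := @ev_flip _ _ cst m c t A t0 Am; rewrite F0 rmorph0 eq_sym mulf_eq0.
  by rewrite expf_eq0 (negPf t0) andbF.
have B2n := nz_horner2 B20; have FB := flip0 _ B2m B2n.
have hE3 : h = ev c t (flip m A2) / ev c t (flip m B2).
  by rewrite !ev_flip // hE2 -mulf_div divff ?mul1r // expf_neq0.
(* Rewritten in the coordinates c and t, the denominator from the other chart is a multiple of the
   reduced one. *)
have [W BW] := low _ _ FB hE3.
have Wn : W != 0 by apply: contra_neq FB => W0; rewrite BW W0 mul0r.
have AW : N * W = flip m A2.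
  apply: (indep_inj ct); rewrite rmorphM /=.
  have Dn' := indep_neq0 ct Dn; have Bn' := indep_neq0 ct FB.
  apply: (mulIf (invr_neq0 Bn')); rewrite -hE3 hE BW rmorphM /=.
  have Wn' := indep_neq0 ct Wn; by field; apply/andP.
pose n := (m + ebound N + ebound D + ebound W)%N.
have Nn : (ebound N <= n)%N by rewrite /n; lia.
have Dn' : (ebound D <= n)%N by rewrite /n; lia.
have Wn' : (ebound W <= n)%N by rewrite /n; lia.
have mn : (m <= n)%N by rewrite /n; lia.
(* Restricted to the curve, the flip of D is a nonzero constant times X^n. So this coefficient of
   the flip of W is, up to a nonzero constant, the value of B2 at the origin of the other chart. *)
have W0 : (flip n W)`_(n - m) != 0.
  suff : (inner 0 (flip n W))`_(n - m) != 0.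
    by apply: contra_neq => E; rewrite coef_map E /= /horner_eval horner0.
  have dE : inner 0 (flip n D) = (D`_0`_0)%:P * 'X^n.
    rewrite inner_flip //; case: (size D) (@nth_default _ 0 D 0) => [D0|l _].
      by move: D00; rewrite D0 // coef0 eqxx.
    rewrite big_ord_recl subn0 big1 ?addr0 // => j _.
    by rewrite Dj // mul0r.
  have E : flip n D * flip n W = 'X^(n + n - m) * B2.
    by apply: (flipM ct) => //; rewrite mulrC.
  have := congr1 (fun P => (inner 0 P)`_(n + n - m)) E.
  rewrite !rmorphM /= dE rmorphXn /= map_polyX -mulrA coefCM !coefXnM ltnn subnn.
  rewrite ltnNge (_ : (n <= n + n - m)%N) /=; last by lia.
  rewrite (_ : (n + n - m - n = n - m)%N); last by lia.
  move=> E0; have : D`_0`_0 * (inner 0 (flip n W))`_(n - m) != 0.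
    rewrite E0 coef_map /= /horner_eval horner_coef0.
    by move: B20; rewrite polyC0 !horner_coef0.
  by rewrite mulf_eq0 negb_or => /andP[].
have coneN := flip_bound ct Nn Wn' A2m mn W0 AW.
have coneD : forall i j, D`_j`_i != 0 -> (j <= i.*2)%N.
  by apply: (flip_bound ct Dn' Wn' B2m mn W0); rewrite mulrC.
exists (N`_0`_0 / D`_0`_0); rewrite hE; apply: (place_div hV) => //; exact: place_cone.
Qed.

End Normality.

(** * The projective plane *)

Lemma fracE (R : idomainType) (f : {fraction R}) :
  f = FracField.tofrac (\n_(repr f)) / FracField.tofrac (\d_(repr f)).
Proof.
have d0 : FracField.tofrac (\d_(repr f)) != 0 by rewrite tofrac_eq0 denom_ratioP.
apply: (mulIf d0); rewrite divfK // -{1}[f]reprK.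
rewrite -[_ * _]/(FracField.mul _ _) !piE; apply/eqmodP.
rewrite /= FracField.equivfE /FracField.mulf.
by rewrite !numden_Ratio ?mulf_neq0 ?oner_neq0 ?denom_ratioP // !mulr1 mulrC.
Qed.

Section Concrete.

Variable k : closedFieldType.
Local Notation K := {fraction {mpoly k[3]}}.
Local Notation "x %:F" := (@FracField.tofrac _ x).

Lemma cst_is_zmod_morphism : zmod_morphism (@cst k).
Proof. by move=> c d; rewrite /cst mpolyCB rmorphB. Qed.

Lemma cst_is_monoid_morphism : monoid_morphism (@cst k).
Proof. by split=> [|c d]; rewrite /cst ?mpolyC1 ?rmorph1 // mpolyCM rmorphM. Qed.

HB.instance Definition _ :=
  GRing.isZmodMorphism.Build k K (@cst k) cst_is_zmod_morphism.
HB.instance Definition _ :=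
  GRing.isMonoidMorphism.Build k K (@cst k) cst_is_monoid_morphism.

Lemma fracP (f : K) : exists N D : {mpoly k[3]}, D != 0 /\ f = N%:F / D%:F.
Proof. by exists \n_(repr f), \d_(repr f); rewrite -fracE denom_ratioP. Qed.

(** [pderiv] is defined on a chosen representative n / d; differentiating N d = n D shows that every
    other one gives the same result. *)
Lemma pderivE i (N D : {mpoly k[3]}) : D != 0 ->
  pderiv i (N%:F / D%:F) = (mderiv i N * D - N * mderiv i D)%:F / (D ^+ 2)%:F.
Proof.
move=> D0; rewrite /pderiv; set f := N%:F / D%:F.
have := fracE f; set n := \n_ _; have : \d_(repr f) != 0 := denom_ratioP _.
set d := \d_ _ => d0 fE; have ND : N * d = n * D.
  apply/eqP; rewrite -tofrac_eq !rmorphM /= -eqr_div ?tofrac_eq0 //.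
  by apply/eqP; rewrite -fE.
have ND' := congr1 (mderiv i) ND; rewrite !mderivM in ND'.
apply/eqP; rewrite eqr_div ?tofrac_eq0 ?expf_neq0 // -!rmorphM tofrac_eq; apply/eqP.
move: (mderiv i N) (mderiv i D) (mderiv i n) (mderiv i d) ND' => N' D' n' d' ND'.
transitivity (n' * D * d * D - (n * D) * d' * D); first by ring.
have E : n' * D = N' * d + N * d' - n * D' by rewrite ND' addrK.
rewrite -ND E; transitivity (d * D * (N' * d) - d * (n * D) * D'); first by ring.
by rewrite -ND; ring.
Qed.

Lemma pderiv_tofrac i (A : {mpoly k[3]}) : pderiv i A%:F = (mderiv i A)%:F.
Proof.
rewrite -[A%:F]divr1 -(rmorph1 (@FracField.tofrac {mpoly k[3]})).
rewrite pderivE ?oner_neq0 // expr1n mulr1 rmorph1 divr1 -mpolyC1 mderivC.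
by rewrite mulr0 subr0.
Qed.

Lemma pderiv_derivation i : derivation (@cst k) (pderiv i).
Proof.
split=> [c|f g|f g]; first by rewrite pderiv_tofrac mderivC rmorph0.
- have [[N [D [D0 ->]]] [N' [D' [D'0 ->]]]] := (fracP f, fracP g).
  rewrite addf_div ?tofrac_eq0 // -!rmorphM -rmorphD !pderivE ?mulf_neq0 //.
  rewrite addf_div ?tofrac_eq0 ?expf_neq0 // -!rmorphM -rmorphD.
  apply/eqP; rewrite eqr_div ?tofrac_eq0 ?mulf_neq0 ?expf_neq0 ?mulf_neq0 //.
  rewrite -!rmorphM tofrac_eq !mderivD !mderivM; apply/eqP.
  move: (mderiv i N) (mderiv i D) (mderiv i N') (mderiv i D') => *; ring.
- have [[N [D [D0 ->]]] [N' [D' [D'0 ->]]]] := (fracP f, fracP g).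
  rewrite mulf_div -!rmorphM !pderivE ?mulf_neq0 // !mulf_div -!rmorphM.
  rewrite addf_div ?tofrac_eq0 ?mulf_neq0 ?expf_neq0 // -!rmorphM -rmorphD.
  apply/eqP; rewrite eqr_div ?tofrac_eq0 ?mulf_neq0 ?expf_neq0 ?mulf_neq0 //.
  rewrite -!rmorphM tofrac_eq !mderivM; apply/eqP.
  move: (mderiv i N) (mderiv i D) (mderiv i N') (mderiv i D') => *; ring.
Qed.

Lemma jacE (u v : K) :
  jac u v = P2gen k 0 ^+ 2 * jacobian (pderiv 1) (pderiv 2%:R) u v.
Proof. by []. Qed.

Section Geval.

Variables (n : nat) (s : 'I_n -> K).

Lemma gevalD (A B : {mpoly k[n]}) : geval s (A + B) = geval s A + geval s B.
Proof. exact: (rmorphD (mmap (@cst k) s)). Qed.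

Lemma gevalM (A B : {mpoly k[n]}) : geval s (A * B) = geval s A * geval s B.
Proof. exact: (rmorphM (mmap (@cst k) s)). Qed.

Lemma gevalC c : geval s c%:MP = cst c.
Proof. exact: mmapC. Qed.

Lemma gevalX i : geval s 'X_i = s i.
Proof. by rewrite /geval mmapX mmap1U. Qed.

Lemma gevalZ c (A : {mpoly k[n]}) : geval s (c *: A) = cst c * geval s A.
Proof. exact: mmapZ. Qed.

Lemma place_geval V (P : 'rV[k]_n) (A : {mpoly k[n]}) : preplace (@cst k) V ->
  (forall i, V (s i) (P 0 i)) -> V (geval s A) A.@[P 0].
Proof.
move=> h Vs; elim/mpolyind: A => [|c m p _ _ IH].
  by rewrite meval0 /geval mmap0; apply: (place0 h).
rewrite gevalD gevalZ mevalD mevalZ; apply: (placeD h _ IH).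
apply: (placeM h (placeC h c)); rewrite /geval mmapX mevalX /mmap1.
elim/big_ind2: _ => [|f c1 g c2|i _]; first exact: (place1 h).
  exact: (placeM h).
exact: (placeX _ h).
Qed.

Lemma geval_homog (w : K) d (A : {mpoly k[n]}) : A \is d.-homog ->
  geval (fun i => w * s i) A = w ^+ d * geval s A.
Proof.
move=> /dhomogP hA; rewrite /geval /mmap mulr_sumr.
apply: eq_big_seq => m /hA mE; rewrite mulrCA; congr (_ * _).
rewrite /mmap1 -(mE : mdeg m = d) mdegE -prodrXr -big_split /=.
by apply: eq_bigr => i _; rewrite exprMn.
Qed.

(* [lv P f c]: f is regular at P, with value c, on the subvariety of projective
   space with generic point s. *)
Definition lv (P : 'rV[k]_n) (f : K) (c : k) : Prop := exists d (A B : {mpoly k[n]}),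
  [/\ A \is d.-homog, B \is d.-homog, B.@[P 0] != 0,
      f = geval s A / geval s B & c = A.@[P 0] / B.@[P 0]].

Lemma local_ringE (P : 'rV[k]_n) f : local_ring s P f <-> ring_of (lv P) f.
Proof.
split=> [[d [A [B [hA hB B0 fE]]]]|[c [d [A [B [hA hB B0 fE _]]]]]].
  by exists (A.@[P 0] / B.@[P 0]), d, A, B.
by exists d, A, B.
Qed.

(** The hypothesis expresses that P lies on the variety with generic point s: a form vanishing at s
    vanishes at P. *)
Lemma lv_place (P : 'rV[k]_n) : (forall d (B : {mpoly k[n]}), B \is d.-homog ->
  B.@[P 0] != 0 -> geval s B != 0) -> place (@cst k) (lv P).
Proof.
move=> nz; split; first split.
- move=> c; exists 0%N, c%:MP, 1; split.
  + by rewrite -[c]mulr1 mpolyCM mul_mpolyC; apply/rpredZ/dhomog1.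
  + exact: dhomog1.
  + by rewrite meval1 oner_neq0.
  + by rewrite -mpolyC1 !gevalC rmorph1 divr1.
  + by rewrite meval1 mevalC divr1.
- move=> f g c e [d [A [B [hA hB B0 -> ->]]]] [d' [A' [B' [hA' hB' B'0 -> ->]]]].
  have [gB gB'] := (nz _ _ hB B0, nz _ _ hB' B'0).
  exists (d + d')%N, (A * B' + A' * B), (B * B'); split.
  + by apply: rpredD; [|rewrite addnC]; apply: dhomogM.
  + exact: dhomogM.
  + by rewrite mevalM mulf_neq0.
  + by rewrite gevalD !gevalM (addf_div _ _ gB gB').
  + by rewrite mevalD !mevalM (addf_div _ _ B0 B'0).
- move=> f g c e [d [A [B [hA hB B0 -> ->]]]] [d' [A' [B' [hA' hB' B'0 -> ->]]]].
  exists (d + d')%N, (A * A'), (B * B'); split; try exact: dhomogM.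
  + by rewrite mevalM mulf_neq0.
  + by rewrite !gevalM mulf_div.
  + by rewrite !mevalM mulf_div.
- move=> f c [d [A [B [hA hB B0 -> ->]]]]; rewrite mulf_eq0 negb_or => /andP[A0 _].
  by exists d, B, A; rewrite !invf_div.
- case=> d [A [B [hA hB B0 /esym/eqP]]]; rewrite mulf_eq0 invr_eq0.
  rewrite (negPf (nz _ _ hB B0)) orbF => /eqP A0 /eqP.
  have [->|An] := eqVneq A.@[P 0] 0; first by rewrite mul0r oner_eq0.
  by have := nz _ _ hA An; rewrite A0 eqxx.
Qed.

End Geval.

Section Domination.

Variables (n : nat) (s : 'I_n -> K).

(** A quotient of two forms of the same degree does not change when the coordinates s are divided by
    w, after which they take the values P. *)
Lemma lv_sub V (P : 'rV[k]_n) (w : K) : preplace (@cst k) V -> w != 0 ->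
  (forall i, V (s i / w) (P 0 i)) -> dominates (lv s P) V.
Proof.
move=> h w0 Vs f c [d [A [B [hA hB B0 -> ->]]]].
have wd : w^-1 ^+ d != 0 by rewrite expf_neq0 ?invr_eq0.
have -> : geval s A / geval s B =
    geval (fun i => w^-1 * s i) A / geval (fun i => w^-1 * s i) B.
  by rewrite !(geval_homog _ _ hA, geval_homog _ _ hB) -mulf_div divff // mul1r.
have Vg A' : V (geval (fun i => w^-1 * s i) A') A'.@[P 0].
  by apply: (place_geval _ h) => i; rewrite mulrC.
exact: (place_div h (Vg A) (Vg B) B0).
Qed.

Lemma geval_neq0 V (P : 'rV[k]_n) (w : K) d (B : {mpoly k[n]}) :
  place (@cst k) V -> w != 0 -> (forall i, V (s i / w) (P 0 i)) ->
  B \is d.-homog -> B.@[P 0] != 0 -> geval s B != 0.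
Proof.
move=> hV w0 Vs hB B0.
have Vg : V (geval (fun i => w^-1 * s i) B) B.@[P 0].
  by apply: place_geval; [exact: hV.1 | move=> i; rewrite mulrC].
have := place_neq0 hV Vg B0; apply: contra_neq => E.
by rewrite (geval_homog _ _ hB) E mulr0.
Qed.

End Domination.

Lemma geval_P2gen (A : {mpoly k[3]}) : geval (@P2gen k) A = A%:F.
Proof.
elim/mpolyind: A => [|c m p _ _ IH]; first by rewrite /geval mmap0 rmorph0.
rewrite gevalD gevalZ IH rmorphD /= -mul_mpolyC rmorphM /=; congr (_ * _ + _).
rewrite /geval mmapX /mmap1 mpolyXE_id rmorph_prod /=.
by apply: eq_bigr => i _; rewrite rmorphXn.
Qed.

Lemma P2_place (P : 'rV[k]_3) : place (@cst k) (lv (@P2gen k) P).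
Proof.
apply: lv_place => d B _; apply: contra_neq => /eqP.
by rewrite geval_P2gen tofrac_eq0 => /eqP ->; rewrite meval0.
Qed.

Definition dot (l R : 'rV[k]_3) : k := \sum_i l 0 i * R 0 i.
Definition lin (l : 'rV[k]_3) : K := \sum_i cst (l 0 i) * P2gen k i.
Definition linp (l : 'rV[k]_3) : {mpoly k[3]} := \sum_i l 0 i *: 'X_i.

Lemma geval_linp l : geval (@P2gen k) (linp l) = lin l.
Proof.
rewrite /linp /geval raddf_sum /=; apply: eq_bigr => i _.
by rewrite -[LHS]/(geval _ _) gevalZ gevalX.
Qed.

Lemma linp_homog l : linp l \is 1.-homog.
Proof. by apply: rpred_sum => i _; apply: rpredZ; rewrite dhomogX /= mdeg1. Qed.

Lemma meval_linp l (R : 'rV[k]_3) : (linp l).@[R 0] = dot l R.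
Proof.
rewrite /linp /meval raddf_sum; apply: eq_bigr => i _.
by rewrite -[LHS]/((l 0 i *: 'X_i).@[R 0]) mevalZ mevalXU.
Qed.

Lemma lin_neq0 l R : dot l R != 0 -> lin l != 0.
Proof.
by rewrite -geval_linp geval_P2gen tofrac_eq0 -meval_linp; apply: contra_neq => ->; rewrite meval0.
Qed.

Lemma lv_lin l l0 R : dot l0 R != 0 ->
  lv (@P2gen k) R (lin l / lin l0) (dot l R / dot l0 R).
Proof.
by move=> h; exists 1%N, (linp l), (linp l0); split;
  rewrite ?linp_homog ?geval_linp ?meval_linp.
Qed.

End Concrete.

(** This computes the 2-form d(l1/l0) d(l2/l0) in terms of dx dy. The determinant of the
    coefficients is a constant, and X0^3 / l0^3 reflects that a canonical divisor of the plane is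
    minus three lines. *)
Lemma jac_frame_id (K : fieldType) (X0 X1 X2 l0 l1 l2 c00 c01 c02 c10 c11 c12 c20 c21 c22 : K) :
  l0 = c00 * X0 + c01 * X1 + c02 * X2 -> l1 = c10 * X0 + c11 * X1 + c12 * X2 ->
  l2 = c20 * X0 + c21 * X1 + c22 * X2 -> l0 != 0 ->
  X0 ^+ 2 * ((c11 - l1 / l0 * c01) / l0 * ((c22 - l2 / l0 * c02) / l0) -
    (c12 - l1 / l0 * c02) / l0 * ((c21 - l2 / l0 * c01) / l0)) =
  (c00 * (c11 * c22 - c12 * c21) - c01 * (c10 * c22 - c12 * c20) +
     c02 * (c10 * c21 - c11 * c20)) * (X0 ^+ 3 / l0 ^+ 3).
Proof.
move=> E0 E1 E2 n0.
apply: (mulIf (expf_neq0 4 n0)).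
transitivity (X0 ^+ 2 * ((c11 * l0 - l1 * c01) * (c22 * l0 - l2 * c02) -
   (c12 * l0 - l1 * c02) * (c21 * l0 - l2 * c01))); first by field.
transitivity ((c00 * (c11 * c22 - c12 * c21) - c01 * (c10 * c22 - c12 * c20) +
     c02 * (c10 * c21 - c11 * c20)) * X0 ^+ 3 * l0); last by field.
by rewrite E0 E1 E2; ring.
Qed.

Section Frames.

Variable k : closedFieldType.
Local Notation K := {fraction {mpoly k[3]}}.
Local Notation cst := (@cst k).
Local Notation X := (@P2gen k).
Implicit Types (l e R : 'rV[k]_3).

Lemma sum3 (V : nmodType) (f : 'I_3 -> V) : \sum_i f i = f 0 + f 1 + f 2%:R.
Proof.
rewrite !big_ord_recl big_ord0 addr0 addrA; congr (f _ + f _ + f _); exact: val_inj.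
Qed.

Lemma dotDl l l' R : dot (l + l') R = dot l R + dot l' R.
Proof. by rewrite /dot -big_split; apply: eq_bigr => i _; rewrite mxE mulrDl. Qed.
Lemma dotZl c l R : dot (c *: l) R = c * dot l R.
Proof. by rewrite /dot mulr_sumr; apply: eq_bigr => i _; rewrite mxE mulrA. Qed.
Lemma dotBl l l' R : dot (l - l') R = dot l R - dot l' R.
Proof. by rewrite -scaleN1r dotDl dotZl mulN1r. Qed.
Lemma dotDr l R R' : dot l (R + R') = dot l R + dot l R'.
Proof. by rewrite /dot -big_split; apply: eq_bigr => i _; rewrite mxE mulrDr. Qed.
Lemma dotZr c l R : dot l (c *: R) = c * dot l R.
Proof. by rewrite /dot mulr_sumr; apply: eq_bigr => i _; rewrite mxE mulrCA. Qed.

Lemma linD l l' : lin (l + l') = lin l + lin l'.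
Proof. by rewrite /lin -big_split; apply: eq_bigr => i _; rewrite mxE rmorphD mulrDl. Qed.
Lemma linZ c l : lin (c *: l) = cst c * lin l.
Proof. by rewrite /lin mulr_sumr; apply: eq_bigr => i _; rewrite mxE rmorphM mulrA. Qed.
Lemma linB l l' : lin (l - l') = lin l - lin l'.
Proof. by rewrite -scaleN1r linD linZ rmorphN rmorph1 mulN1r. Qed.

(** Dual bases of linear forms and of vectors; l1/l0 and l2/l0 are then parameters of the plane at
    e0. *)
Record frame (l0 l1 l2 e0 e1 e2 : 'rV[k]_3) : Prop := Frame {
  frameE : forall R, R = dot l0 R *: e0 + dot l1 R *: e1 + dot l2 R *: e2;
  frame00 : dot l0 e0 = 1; frame01 : dot l0 e1 = 0; frame02 : dot l0 e2 = 0;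
  frame10 : dot l1 e0 = 0; frame11 : dot l1 e1 = 1; frame12 : dot l1 e2 = 0;
  frame20 : dot l2 e0 = 0; frame21 : dot l2 e1 = 0; frame22 : dot l2 e2 = 1 }.

Lemma frame_swap12 l0 l1 l2 e0 e1 e2 :
  frame l0 l1 l2 e0 e1 e2 -> frame l0 l2 l1 e0 e2 e1.
Proof. by case=> h *; split=> // R; rewrite {1}[R]h addrAC. Qed.

Lemma frame_swap01 l0 l1 l2 e0 e1 e2 :
  frame l0 l1 l2 e0 e1 e2 -> frame l1 l0 l2 e1 e0 e2.
Proof. by case=> h *; split=> // R; rewrite {1}[R]h (addrC (_ *: e0)). Qed.

(** A translation of the affine chart l0 = 1: the parameters at the new base point are the old ones
    minus a and b. *)
Lemma frame_shift l0 l1 l2 e0 e1 e2 a b : frame l0 l1 l2 e0 e1 e2 ->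
  frame l0 (l1 - a *: l0) (l2 - b *: l0) (e0 + a *: e1 + b *: e2) e1 e2.
Proof.
case=> h h00 h01 h02 h10 h11 h12 h20 h21 h22.
split=> [R|||||||||]; rewrite ?(dotBl, dotZl, dotDr, dotZr) ?h00 ?h01 ?h02 ?h10
  ?h11 ?h12 ?h20 ?h21 ?h22; try ring.
by apply/rowP => i; rewrite {1}[R]h !mxE; ring.
Qed.

Lemma frame_neq0 l0 l1 l2 e0 e1 e2 : frame l0 l1 l2 e0 e1 e2 -> lin l0 != 0.
Proof. by move=> h; apply: (@lin_neq0 _ _ e0); rewrite (frame00 h) oner_neq0. Qed.

Lemma frame_coord l0 l1 l2 e0 e1 e2 i j : frame l0 l1 l2 e0 e1 e2 ->
  (i == j)%:R = l0 0 j * e0 0 i + l1 0 j * e1 0 i + l2 0 j * e2 0 i.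
Proof.
move=> h; have := congr1 (fun R : 'rV[k]_3 => R 0 i) (frameE h (delta_mx 0 j)).
have dd l : dot l (delta_mx 0 j) = l 0 j.
  rewrite /dot (bigD1 j) //= big1 ?addr0 => [|i' /negPf ij].
    by rewrite mxE !eqxx mulr1.
  by rewrite mxE eqxx ij mulr0.
by rewrite !dd !mxE eqxx.
Qed.

Lemma frame_gen l0 l1 l2 e0 e1 e2 i : frame l0 l1 l2 e0 e1 e2 ->
  X i = lin l0 * cst (e0 0 i) + lin l1 * cst (e1 0 i) + lin l2 * cst (e2 0 i).
Proof.
move=> h; transitivity (\sum_j cst ((i == j)%:R) * X j).
  rewrite (bigD1 i) //= eqxx rmorph1 mul1r big1 ?addr0 // => j /negPf ij.
  by rewrite eq_sym ij rmorph0 mul0r.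
rewrite /lin !mulr_suml -!big_split; apply: eq_bigr => j _ /=.
by rewrite (frame_coord _ _ h) !rmorphD !rmorphM /= !mulrDl; do ?congr (_ + _);
   rewrite mulrAC.
Qed.

Lemma lin_lv l l0 R : dot l0 R = 1 -> lv X R (lin l / lin l0) (dot l R).
Proof.
move=> h; have := @lv_lin k l l0 R; rewrite h divr1; apply; exact: oner_neq0.
Qed.

(** A relation takes the value 0 at every point e0 + u e1 + v e2, so every (u, v) is a zero of
    it. *)
Lemma frame_indep l0 l1 l2 e0 e1 e2 : frame l0 l1 l2 e0 e1 e2 ->
  indep cst (lin l1 / lin l0) (lin l2 / lin l0).
Proof.
move=> h A A0; apply: poly2_all_roots => u v.
pose R := e0 + u *: e1 + v *: e2.
have E0 : dot l0 R = 1.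
  by rewrite !dotDr !dotZr (frame00 h) (frame01 h) (frame02 h) !mulr0 !addr0.
have E1 : dot l1 R = u.
  by rewrite !dotDr !dotZr (frame10 h) (frame11 h) (frame12 h) mulr0 addr0 add0r mulr1.
have E2 : dot l2 R = v.
  by rewrite !dotDr !dotZr (frame20 h) (frame21 h) (frame22 h) mulr0 !add0r mulr1.
have hp := P2_place R; have := lin_lv l2 E0; have := lin_lv l1 E0.
rewrite E1 E2 => V1 V2; have := place_ev A hp.1 V1 V2; rewrite A0.
by move/(place_uniq hp)/(_ (place0 hp.1)).
Qed.

Lemma gen_chart l0 l1 l2 e0 e1 e2 V i : frame l0 l1 l2 e0 e1 e2 -> preplace cst V ->
  V (lin l1 / lin l0) 0 -> V (lin l2 / lin l0) 0 -> V (X i / lin l0) (e0 0 i).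
Proof.
move=> h hV V1 V2; have n0 := frame_neq0 h.
have -> : X i / lin l0 = cst (e0 0 i) + lin l1 / lin l0 * cst (e1 0 i) +
    lin l2 / lin l0 * cst (e2 0 i).
  by rewrite (frame_gen i h) !mulrDl mulrAC mulfV // mul1r; do ?congr (_ + _); rewrite mulrAC.
have := placeD hV (placeD hV (placeC hV (e0 0 i)) (placeM hV V1 (placeC hV (e1 0 i))))
  (placeM hV V2 (placeC hV (e2 0 i))).
by rewrite !mul0r !addr0.
Qed.

Lemma P2_sub l0 l1 l2 e0 e1 e2 V : frame l0 l1 l2 e0 e1 e2 -> preplace cst V ->
  V (lin l1 / lin l0) 0 -> V (lin l2 / lin l0) 0 -> dominates (lv X e0) V.
Proof.
move=> h hV V1 V2; apply: (lv_sub hV (frame_neq0 h)) => i; exact: gen_chart h hV V1 V2.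
Qed.

Lemma P2_chart l0 l1 l2 e0 e1 e2 : frame l0 l1 l2 e0 e1 e2 -> forall f c,
  lv X e0 f c <-> chart cst (lin l1 / lin l0) (lin l2 / lin l0) f c.
Proof.
move=> h f c; split.
  apply: (P2_sub h); first exact: (chart_place (frame_indep h)).1.
    exact: chart_l.
  exact: chart_r.
apply: chart_sub; first exact: (P2_place e0).1.
  by rewrite -(frame10 h); apply: lin_lv; apply: frame00 h.
by rewrite -(frame20 h); apply: lin_lv; apply: frame00 h.
Qed.

Lemma pderiv_lin i l : pderiv i (lin l) = cst (l 0 i).
Proof.
rewrite -geval_linp geval_P2gen pderiv_tofrac /linp /cst; congr (FracField.tofrac _).
rewrite raddf_sum /= (bigD1 i) //= big1 ?addr0 => [|j /negPf ji].
  rewrite mderivZ mderivX mnm1E eqxx mulr1n scale1r.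
  have -> : (U_(i) - U_(i))%MM = 0%MM :> 'X_{1..3} by apply/mnmP => j; rewrite mnmBE subnn mnm0E.
  by rewrite mpolyX0 alg_mpolyC.
by rewrite mderivZ mderivX mnm1E ji scale0r scaler0.
Qed.

Lemma det3_mul (l0 l1 l2 e0 e1 e2 : 'rV[k]_3) :
  let det (a b c : 'rV[k]_3) := a 0 0 * (b 0 1 * c 0 2%:R - b 0 2%:R * c 0 1) -
     a 0 1 * (b 0 0 * c 0 2%:R - b 0 2%:R * c 0 0) +
     a 0 2%:R * (b 0 0 * c 0 1 - b 0 1 * c 0 0) in
  frame l0 l1 l2 e0 e1 e2 -> det l0 l1 l2 != 0.
Proof.
move=> det h; have H i j := frame_coord i j h.
have : det l0 l1 l2 * det e0 e1 e2 = 1.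
  pose S i j := l0 0 j * e0 0 i + l1 0 j * e1 0 i + l2 0 j * e2 0 i.
  transitivity (S 0 0 * (S 1 1 * S 2%:R 2%:R - S 1 2%:R * S 2%:R 1) -
    S 0 1 * (S 1 0 * S 2%:R 2%:R - S 1 2%:R * S 2%:R 0) +
    S 0 2%:R * (S 1 0 * S 2%:R 1 - S 1 1 * S 2%:R 0)); first by rewrite /S /det; ring.
  by rewrite /S -!H /=; ring.
by apply: contra_eq_neq => ->; rewrite mul0r eq_sym oner_eq0.
Qed.

Lemma jac_frame l0 l1 l2 e0 e1 e2 : frame l0 l1 l2 e0 e1 e2 ->
  exists2 c, c != 0 & jac (lin l1 / lin l0) (lin l2 / lin l0) =
     cst c * (X 0 ^+ 3 / lin l0 ^+ 3).
Proof.
move=> h; have c0 := det3_mul h; have n0 := frame_neq0 h.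
eexists; first exact: c0.
rewrite jacE /jacobian !(der_div _ (pderiv_derivation _ _) n0) !pderiv_lin.
rewrite rmorphD !rmorphB !rmorphM /= !rmorphB /= !rmorphM.
by apply: jac_frame_id n0; rewrite /lin sum3.
Qed.

End Frames.

(** * The points of the surface *)

Section FieldIdentities.

Variable K : fieldType.
Implicit Types (a b x y z m G u : K).

Lemma inv_scale g c J : c * (g / J) = g / (c^-1 * J) :> K.
Proof. by rewrite invfM invrK mulrCA. Qed.

Lemma jac_nz s c X0 l m : s != 0 -> c != 0 -> X0 != 0 -> l != 0 -> m != 0 ->
  s * (c * (X0 ^+ 3 / l ^+ 3) / m) != 0 :> K.
Proof. by move=> *; rewrite !mulf_neq0 ?invr_eq0 ?expf_neq0. Qed.

Lemma w_nz g X0 l m : g != 0 -> X0 != 0 -> l != 0 -> m != 0 ->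
  g / X0 ^+ 3 * l ^+ 3 * m != 0 :> K.
Proof. by move=> *; rewrite !mulf_neq0 ?invr_eq0 ?expf_neq0. Qed.

Lemma canon_id g c X0 l0 m s : c != 0 -> X0 != 0 -> l0 != 0 -> m != 0 -> s != 0 ->
  g / X0 ^+ 3 * l0 ^+ 3 * m = s * c * (g / (s * (c * (X0 ^+ 3 / l0 ^+ 3) / m))) :> K.
Proof. by move=> *; field; rewrite ?mulf_neq0 ?expf_neq0; do ?(apply/andP; split). Qed.

Lemma valN_id G x y m u : G != 0 -> x != 0 -> m != 0 ->
  G * (x * y) * u / (G * x ^+ 3 * m) = (y / x) / m * (u / x).
Proof. by move=> *; field; do ?(apply/andP; split). Qed.

Lemma valZ_id G x z m u : G != 0 -> x != 0 -> m != 0 ->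
  G * z ^+ 2 * u / (G * x ^+ 3 * m) = (z / x) ^+ 2 / m * (u / x).
Proof. by move=> *; field; do ?(apply/andP; split). Qed.

Lemma valN_id' G x y l u : G != 0 -> l != 0 ->
  G * (x * y) * u / (G * l ^+ 3 * 1) = (x / l) * (y / l) * (u / l).
Proof. by move=> *; field; do ?(apply/andP; split). Qed.

Lemma valZ_id' G z l u : G != 0 -> l != 0 ->
  G * z ^+ 2 * u / (G * l ^+ 3 * 1) = (z / l) * (z / l) * (u / l).
Proof. by move=> *; field; do ?(apply/andP; split). Qed.

End FieldIdentities.

Section Surface.

Variable k : closedFieldType.
Local Notation K := {fraction {mpoly k[3]}}.
Local Notation cst := (@cst k).
Local Notation X := (@P2gen k).
Local Notation chart := (chart cst).
Local Notation indep := (indep cst).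
Local Notation subring := (K -> Prop).

Definition is_chart (O : subring) (a b : K) : Prop :=
  forall f, O f <-> ring_of (chart a b) f.

Lemma maxid_chart O a b f : indep a b -> is_chart O a b ->
  maxid O f <-> chart a b f 0.
Proof. by move=> ab; apply: maxid_of; apply: chart_place. Qed.

Definition params (a b u v : K) : Prop :=
  [/\ chart a b u 0, chart a b v 0 & forall f, chart a b f 0 -> exists x y,
    [/\ ring_of (chart a b) x, ring_of (chart a b) y & f = x * u + y * v]].

Lemma regular_paramsE O a b u v : indep a b -> is_chart O a b ->
  regular_params O u v <-> params a b u v.
Proof.
move=> ab Oab; split=> -[h1 h2 h3]; split; try by apply/(maxid_chart _ ab Oab).
- move=> f /(maxid_chart _ ab Oab)/h3[x [y [Ox Oy fE]]].
  by exists x, y; split=> //; apply/Oab.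
- move=> f /(maxid_chart _ ab Oab)/h3[x [y [Ox Oy fE]]].
  by exists x, y; split=> //; apply/Oab.
Qed.

Lemma params_chart a b : indep a b -> params a b a b.
Proof.
by move=> ab; split; [exact: chart_l | exact: chart_r | move=> f; exact: chart_maxid].
Qed.

Lemma near_nearset O a b u v (O' : subring) : indep a b -> is_chart O a b ->
  (forall f, O' f <-> exists p r : {poly K},
     [/\ forall i, O p`_i, forall i, O r`_i, ~ maxid O r`_0 & f = p.[v / u] / r.[v / u]])
  <-> (forall f, O' f <-> nearset (chart a b) (v / u) f).
Proof.
move=> ab Oab; split=> H f; split=> [/H|].
- move=> [p [r [Op Or r0 fE]]]; exists p, r; split=> //.
  + by move=> i; apply/Oab.
  + by move=> i; apply/Oab.
  + by move/(maxid_chart _ ab Oab).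
- move=> [p [r [Op Or r0 fE]]]; apply/H; exists p, r; split=> //.
  + by move=> i; apply/Oab.
  + by move=> i; apply/Oab.
  + by move/(maxid_chart _ ab Oab).
- move=> [p [r [Op Or r0 fE]]]; exists p, r; split=> //.
  + by move=> i; apply/Oab.
  + by move=> i; apply/Oab.
  + by move/(maxid_chart _ ab Oab).
- move=> [p [r [Op Or r0 fE]]]; apply/H; exists p, r; split=> //.
  + by move=> i; apply/Oab.
  + by move=> i; apply/Oab.
  + by move/(maxid_chart _ ab Oab).
Qed.

Lemma near_points O a b O' : indep a b -> is_chart O a b -> infinitely_near O O' ->
  (exists t, is_chart O' a (b / a - cst t)) \/ is_chart O' b (a / b).
Proof.
move=> ab Oab [u [v [/(regular_paramsE _ _ ab Oab)[Vu Vv gen]]]].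
move=> /(near_nearset _ _ _ ab Oab) H.
have [[t E]|E] := near_chart ab Vu Vv gen; [left; exists t|right].
  by move=> f; split=> [/H/E|/E/H].
by move=> f; split=> [/H/E|/E/H].
Qed.

Lemma near_point_r O a b t O' : indep a b -> is_chart O a b ->
  is_chart O' a (b / a - cst t) -> infinitely_near O O'.
Proof.
move=> ab Oab O'ab; exists a, (b - cst t * a); split.
  have ab' := indep_shear (t := t) ab; have [h1 h2 h3] := params_chart ab'.
  have E f c := @chart_shear _ _ cst a b t f c ab.
  apply/(regular_paramsE _ _ ab Oab); split; try by apply/E.
  move=> f /E/h3[x [y [[c Vx] [d Vy] fE]]]; exists x, y; split=> //.
    by exists c; apply/E.
  by exists d; apply/E.
apply/(near_nearset _ _ _ ab Oab) => f.
have E := @near_chart_r _ _ cst a b t f ab.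
by split=> [/O'ab/E|/E/O'ab].
Qed.

Lemma is_chart_swap O a b : indep a b -> is_chart O a b -> is_chart O b a.
Proof.
move=> ab Oab f; split=> [/Oab[c]|[c]] /(chart_swap _ _ ab).
  by move=> h; exists c.
by move=> h; apply/Oab; exists c.
Qed.

Lemma near_point_l O a b O' : indep a b -> is_chart O a b ->
  is_chart O' b (a / b) -> infinitely_near O O'.
Proof.
move=> ab Oab O'ab.
apply: (@near_point_r O b a 0 O' (indep_swap ab) (is_chart_swap ab Oab)).
by rewrite rmorph0 subr0.
Qed.

Lemma jac_params a b u v : indep a b -> params a b u v ->
  exists e c, [/\ chart a b e c, c != 0 & jac u v = e * jac a b].
Proof.
move=> ab [Vu Vv gen]; have [e [c [Ve c0 E]]] := jacobian_params ab Vu Vv gen.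
exists e, c; split=> //; rewrite !jacE mulrCA.
by rewrite E; [ | exact: pderiv_derivation | exact: pderiv_derivation].
Qed.

Lemma jac_div a b t : a != 0 -> jac a (b / a - cst t) = jac a b / a.
Proof.
move=> a0; rewrite !jacE -mulrA; congr (_ * _).
by apply: jacobian_div a0; exact: pderiv_derivation.
Qed.

Lemma jac_swap (a b : K) : jac b a = - jac a b.
Proof. by rewrite !jacE (jacobian_swap _ _ a b) mulrN. Qed.

(** The Jacobians of two pairs of parameters differ by a unit; conversely a constant factor is
    realized by rescaling the first parameter. *)
Lemma canon_chart g O a b : indep a b -> is_chart O a b -> jac a b != 0 ->
  (forall w, canonical_eq g O w -> exists e c,
     [/\ chart a b e c, c != 0 & w = e * (g / jac a b)]) /\
  (forall c, c != 0 -> canonical_eq g O (cst c * (g / jac a b))).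
Proof.
move=> ab Oab J0; split=> [w [u [v [/(regular_paramsE _ _ ab Oab) uv ->]]]|c c0].
  have [e [c [Ve c0 ->]]] := jac_params ab uv; exists e^-1, c^-1.
  have hp := chart_place ab; split.
  - exact: (placeV hp.1 Ve c0).
  - by rewrite invr_eq0.
  - by rewrite invfM mulrCA.
exists (cst c^-1 * a), b; split.
  have [h1 h2 h3] := params_chart ab; have hp := (chart_place ab).1.
  apply/(regular_paramsE _ _ ab Oab); split=> //.
    by have := placeM hp (placeC hp c^-1) h1; rewrite mulr0.
  move=> f /h3[x [y [[d Vx] Vy fE]]]; exists (cst c * x), y; split=> //.
    by exists (c * d); apply: (placeM hp (placeC hp c) Vx).
  by rewrite fE mulrAC mulrA -rmorphM mulfV // rmorph1 mul1r (mulrC a).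
have -> : jac (cst c^-1 * a) b = cst c^-1 * jac a b.
  by rewrite !jacE mulrCA (jacobian_scale _ _ _ (pderiv_derivation _ _) (pderiv_derivation _ _)).
by rewrite (fmorphV cst c) inv_scale.
Qed.

(* The image of the point O in P^2 x P^1 is (R, (tau : kappa)), and w is a local
   equation of the canonical divisor at O. *)
Record nice (g N Z : K) (O : subring) (V : K -> k -> Prop) (R : 'rV[k]_3)
    (tau kappa : k) (w : K) : Prop := Nice {
  nice_place : place cst V;
  nice_ring : forall f, O f <-> ring_of V f;
  nice_N : forall i, V (g / X 0 ^+ 3 * N * X i / w) (tau * R 0 i);
  nice_Z : forall i, V (g / X 0 ^+ 3 * Z ^+ 2 * X i / w) (kappa * R 0 i);
  nice_tk : tau != 0 \/ kappa != 0;
  nice_R : R != 0;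
  nice_w : w != 0;
  nice_canon : forall w', canonical_eq g O w' ->
    exists e c, [/\ V e c, c != 0 & w' = e * w];
  nice_exists : forall c, c != 0 -> canonical_eq g O (cst c * w) }.

Lemma X_neq0 (i : 'I_3) : X i != 0.
Proof.
rewrite /P2gen tofrac_eq0; apply: contra_neq (oner_neq0 k) => Xi0.
by have := congr1 (mcoeff U_(i)) Xi0; rewrite mcoeffX eqxx mcoeff0.
Qed.

Lemma frame_R (l0 l1 l2 e0 e1 e2 : 'rV[k]_3) : frame l0 l1 l2 e0 e1 e2 -> e0 != 0.
Proof.
move=> h; apply: contra_eq_neq (frame00 h) => e00; rewrite e00.
by rewrite -(scale0r (0 : 'rV[k]_3)) dotZr mul0r eq_sym oner_eq0.
Qed.

(** Relative to the pullback from the plane, the canonical divisor at O has the additional equation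
    m, a product of equations of exceptional curves. The constant s absorbs the sign caused by
    exchanging parameters. *)
Lemma nice_chart g N Z O l0 l1 l2 e0 e1 e2 p q m s tau kappa :
  frame l0 l1 l2 e0 e1 e2 -> g != 0 ->
  indep p q -> is_chart O p q -> m != 0 -> s != 0 ->
  jac p q = cst s * (jac (lin l1 / lin l0) (lin l2 / lin l0) / m) ->
  (tau != 0 \/ kappa != 0) ->
  let w := g / X 0 ^+ 3 * lin l0 ^+ 3 * m in
  (forall i, chart p q (g / X 0 ^+ 3 * N * X i / w) (tau * e0 0 i)) ->
  (forall i, chart p q (g / X 0 ^+ 3 * Z ^+ 2 * X i / w) (kappa * e0 0 i)) ->
  nice g N Z O (chart p q) e0 tau kappa w.
Proof.
move=> fr g0 pq Opq m0 s0 Jpq tk w VN VZ.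
have [c c0 JE] := jac_frame fr; have l0n := frame_neq0 fr.
have cc0 : cst c != 0 by rewrite fmorph_eq0.
have cs0 : cst s != 0 by rewrite fmorph_eq0.
have J0 : jac p q != 0.
  rewrite Jpq JE; exact: (jac_nz cs0 cc0 (X_neq0 0) l0n m0).
have wE : w = cst (s * c) * (g / jac p q).
  by rewrite Jpq JE rmorphM; apply: (canon_id _ cc0 (X_neq0 0) l0n m0 cs0).
have sc0 : s * c != 0 by rewrite mulf_neq0.
have [can1 can2] := canon_chart g pq Opq J0.
have hp := chart_place pq.
have w0 : w != 0 by exact: (w_nz g0 (X_neq0 0) l0n m0).
apply: (Nice hp Opq VN VZ tk (frame_R fr) w0).
- move=> w' /can1[e [d [Ve d0 ->]]]; exists (e * cst (s * c)^-1), (d * (s * c)^-1).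
  split.
  + exact: (placeM hp.1 Ve (placeC hp.1 _)).
  + by rewrite mulf_neq0 ?invr_eq0.
  + rewrite wE mulrA -(mulrA e) -rmorphM mulVf //.
    by rewrite rmorph1 mulr1.
- move=> d d0; rewrite wE mulrA -rmorphM; apply: can2; exact: mulf_neq0.
Qed.

End Surface.

Section PlaceComparison.

Variables (k K : fieldType) (cst : {rmorphism k -> K}).

(** The value of f is the only constant c for which f - c is not a unit, so it depends on the ring
    alone. *)
Lemma place_same_ring V V' f c : place cst V -> place cst V' ->
  (forall g, ring_of V g <-> ring_of V' g) -> V f c -> V' f c.
Proof.
move=> hV hV' E Vf; have [c' Vf'] : ring_of V' f by apply/E; exists c.
suff -> : c = c' by [].
have V1 := placeB hV.1 Vf (placeC hV.1 c); rewrite subrr in V1.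
have V2 := placeB hV'.1 Vf' (placeC hV'.1 c).
apply/eqP; rewrite eq_sym -subr_eq0; apply/negPn/negP => cc'.
have f0 := place_neq0 hV' V2 cc'.
have [d V3] : ring_of V (f - cst c)^-1.
  by apply/E; exists (c' - c)^-1; apply: (placeV hV'.1).
have := placeM hV.1 V1 V3; rewrite mulfV // mul0r => V4.
by have /eqP := place_uniq hV V4 (place1 hV.1); rewrite eq_sym oner_eq0.
Qed.

Lemma blow1_id (a b : K) : a != 0 -> a * (b / a) = b.
Proof. by move=> a0; rewrite mulrC divfK. Qed.

Lemma div_mul (u a b : K) : u / (a * b) = u / a / b.
Proof. by rewrite invfM mulrA. Qed.

Lemma sq_id (a b : K) : a != 0 -> b != 0 -> a ^+ 2 / (a * (b / a)) = a / (b / a).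
Proof. by move=> a0 b0; field; apply/andP. Qed.

End PlaceComparison.

Section Points.

Variable k : closedFieldType.
Local Notation K := {fraction {mpoly k[3]}}.
Local Notation cst := (@cst k).
Local Notation X := (@P2gen k).
Local Notation chart := (chart cst).
Local Notation indep := (indep cst).
Local Notation subring := (K -> Prop).

(** Values depend on the ring alone, so the ratios of coordinates regular at the place have the same
    values for R and for R'. *)
Lemma center_uniq V V' (R R' : 'rV[k]_3) : place cst V -> place cst V' ->
  (forall g, ring_of V g <-> ring_of V' g) ->
  dominates (lv X R) V -> dominates (lv X R') V' -> R != 0 -> R' != 0 -> proj_eq R R'.
Proof.
move=> hV hV' E dV dV' R0 R'0.
have coord (S : 'rV[k]_3) i j : S 0 i != 0 -> lv X S (X j / X i) (S 0 j / S 0 i).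
  move=> Si; exists 1%N, 'X_j, 'X_i; split; rewrite ?dhomogX /= ?mdeg1 //.
  - by rewrite mevalXU.
  - by rewrite !gevalX.
  - by rewrite !mevalXU.
have nz (S : 'rV[k]_3) : S != 0 -> exists i, S 0 i != 0 by move/rV0Pn.
have [[i Ri] [i' R'i']] := (nz R R0, nz R' R'0).
have V1 := dV _ _ (coord R i i' Ri); have V2 := dV' _ _ (coord R' i' i R'i').
have V1' := place_same_ring hV hV' E V1.
have V3 := placeM hV'.1 V1' V2.
have XX : X i' / X i * (X i / X i') = 1 by rewrite mulrA (divfK (X_neq0 k i)) (divff (X_neq0 k i')).
rewrite XX in V3; have e := place_uniq hV' V3 (place1 hV'.1).
have R'i : R' 0 i != 0.
  by apply: contra_eq_neq e => ->; rewrite mul0r mulr0 eq_sym oner_eq0.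
exists (R' 0 i / R 0 i); first by rewrite mulf_neq0 ?invr_eq0.
apply/rowP => j; rewrite mxE; have V4 := dV' _ _ (coord R' i j R'i).
have V5 := place_same_ring hV hV' E (dV _ _ (coord R i j Ri)).
by rewrite mulrAC -mulrA (place_uniq hV' V5 V4) mulrC divfK.
Qed.

Lemma proj_eq_sym (R R' : 'rV[k]_3) : proj_eq R R' -> proj_eq R' R.
Proof.
move=> [c c0 ->]; exists c^-1; first by rewrite invr_eq0.
by rewrite scalerA mulVf // scale1r.
Qed.

Lemma lv_scale c (R : 'rV[k]_3) f v : c != 0 -> lv X (c *: R) f v -> lv X R f v.
Proof.
move=> c0 [d [A [B [hA hB B0 -> ->]]]].
have E (A' : {mpoly k[3]}) : A' \is d.-homog -> A'.@[(c *: R) 0] = c ^+ d * A'.@[R 0].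
  move=> /dhomogP hA'; rewrite /meval /mmap mulr_sumr; apply: eq_big_seq => m /hA' mE.
  rewrite mulrCA; congr (_ * _); rewrite /mmap1 -(mE : mdeg m = d) mdegE -prodrXr.
  by rewrite -big_split; apply: eq_bigr => i _; rewrite mxE exprMn.
exists d, A, B; split=> //.
  by apply: contra_neq B0; rewrite E // => ->; rewrite mulr0.
by rewrite !E // -mulf_div divff ?mul1r // expf_neq0.
Qed.

Lemma lv_scaleE c (R : 'rV[k]_3) f v : c != 0 -> lv X (c *: R) f v <-> lv X R f v.
Proof.
move=> c0; split; first exact: lv_scale.
rewrite -{1}[R](scale1r R) -(mulVf c0) -scalerA; apply: lv_scale.
by rewrite invr_eq0.
Qed.

Section Side.

Variables (lx ly lz ex ey ez : 'rV[k]_3) (g : K).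
Hypothesis fr : frame lx lz ly ex ez ey.
Hypothesis g0 : g != 0.
Let x := lin lx.
Let y := lin ly.
Let z := lin lz.
Let a := z / x.
Let b := y / x.

Lemma side_indep : indep a b. Proof. exact: frame_indep fr. Qed.

Lemma side_x0 : x != 0. Proof. exact: frame_neq0 fr. Qed.

Lemma side_nice O p q m s tau kappa : indep p q -> is_chart O p q ->
  chart p q a 0 -> chart p q b 0 -> m != 0 -> s != 0 ->
  jac p q = cst s * (jac a b / m) ->
  chart p q (b / m) tau -> chart p q (a ^+ 2 / m) kappa -> (tau != 0 \/ kappa != 0) ->
  nice g (x * y) z O (chart p q) ex tau kappa (g / X 0 ^+ 3 * x ^+ 3 * m).
Proof.
move=> pq Opq Va Vb m0 s0 J Vt Vk tk; have hp := chart_place pq.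
have VX i : chart p q (X i / x) (ex 0 i) by exact: gen_chart fr hp.1 Va Vb.
have G0 : g / X 0 ^+ 3 != 0 := mulf_neq0 g0 (invr_neq0 (expf_neq0 3 (X_neq0 k 0))).
apply: (nice_chart fr g0 pq Opq m0 s0 J tk) => i.
  rewrite (valN_id _ _ G0 side_x0 m0); exact: (placeM hp.1 Vt (VX i)).
rewrite (valZ_id _ _ G0 side_x0 m0); exact: (placeM hp.1 Vk (VX i)).
Qed.

(** [kind2] and [kind3] are the points of the first exceptional curve: the direction y = t0 z, and
    that of the line z = 0. For t0 = 0 the former is the center of the second blow-up. [kind4] and
    [kind5] are the points of the second exceptional curve, [kind5] being the one on the strict
    transform of the first. *)
Definition kind2 O t0 := is_chart O a (b / a - cst t0).
Definition kind3 O := is_chart O b (a / b).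
Definition kind4 O t0 := is_chart O a (b / a / a - cst t0).
Definition kind5 O := is_chart O (b / a) (a / (b / a)).

Let ab := side_indep.
Let a0 := indep_l0 ab.
Let b0 := indep_r0 ab.

Lemma kind2_indep t0 : indep a (b / a - cst t0). Proof. exact: indep_blow. Qed.
Arguments kind2_indep : clear implicits.

Lemma kind3_indep : indep b (a / b). Proof. exact/indep_div/indep_swap. Qed.

Lemma kind4_indep t0 : indep a (b / a / a - cst t0).
Proof. by apply: indep_blow; apply: indep_div. Qed.
Arguments kind4_indep : clear implicits.

Lemma kind5_indep : indep (b / a) (a / (b / a)).
Proof. by apply/indep_div/indep_swap/indep_div. Qed.

Lemma kind2_val t0 : chart a (b / a - cst t0) (b / a) t0.
Proof.
have h := (chart_place (kind2_indep t0)).1.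
have := placeD h (chart_r cst a (b / a - cst t0)) (placeC h t0).
by rewrite subrK add0r.
Qed.

Lemma kind2_b t0 : chart a (b / a - cst t0) b 0.
Proof.
have h := (chart_place (kind2_indep t0)).1.
have := placeM h (chart_l cst a _) (kind2_val t0).
by rewrite (blow1_id _ a0) mul0r.
Qed.

(** All these points have the same projective value (t0 : 0) of (xy : z^2): the anticanonical map
    contracts their curve. *)
Lemma kind2_nice O t0 : t0 != 0 -> kind2 O t0 ->
  nice g (x * y) z O (chart a (b / a - cst t0)) ex t0 0 (g / X 0 ^+ 3 * x ^+ 3 * a).
Proof.
move=> t00 Ok; have pq := kind2_indep t0; 
apply: (side_nice pq Ok (chart_l _ _ _) (kind2_b t0) a0 (oner_neq0 _)).
- by rewrite (jac_div _ _ a0) rmorph1 mul1r.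
- exact: kind2_val.
- rewrite expr2 (mulfK a0); exact: chart_l.
- by left.
Qed.

Lemma kind3_a : chart b (a / b) a 0.
Proof.
have h := (chart_place kind3_indep).1.
have := placeM h (chart_l cst b (a / b)) (chart_r cst b (a / b)).
by rewrite (blow1_id _ b0) mul0r.
Qed.

Lemma kind3_nice O : kind3 O ->
  nice g (x * y) z O (chart b (a / b)) ex 1 0 (g / X 0 ^+ 3 * x ^+ 3 * b).
Proof.
move=> Ok; have pq := kind3_indep; have h := (chart_place pq).1.
have m10 : -1 != 0 :> k by rewrite oppr_eq0 oner_neq0.
apply: (side_nice pq Ok kind3_a (chart_l _ _ _) b0 m10).
- have := jac_div a 0 b0; rewrite rmorph0 subr0 => ->.
  by rewrite jac_swap rmorphN rmorph1 !mulN1r mulNr.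
- rewrite (divff b0); exact: (place1 h).
- rewrite expr2 -mulrA; have := placeM h kind3_a (chart_r cst b (a / b)).
  by rewrite mul0r.
- by left; exact: oner_neq0.
Qed.

Lemma kind4_val t0 : chart a (b / a / a - cst t0) (b / a / a) t0.
Proof.
have h := (chart_place (kind4_indep t0)).1.
have := placeD h (chart_r cst a (b / a / a - cst t0)) (placeC h t0).
by rewrite subrK add0r.
Qed.

Lemma kind4_t t0 : chart a (b / a / a - cst t0) (b / a) 0.
Proof.
have h := (chart_place (kind4_indep t0)).1.
have := placeM h (chart_l cst a _) (kind4_val t0).
by rewrite (blow1_id _ a0) mul0r.
Qed.

Lemma kind4_b t0 : chart a (b / a / a - cst t0) b 0.
Proof.
have h := (chart_place (kind4_indep t0)).1.
have := placeM h (chart_l cst a _) (kind4_t t0).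
by rewrite (blow1_id _ a0) mul0r.
Qed.

(** The second exceptional curve lies over a point of the first, so K_X contains it twice more than
    the pullback and m = a^2. Here (t0 : 1) varies, so this curve is not contracted. *)
Lemma kind4_nice O t0 : kind4 O t0 ->
  nice g (x * y) z O (chart a (b / a / a - cst t0)) ex t0 1
    (g / X 0 ^+ 3 * x ^+ 3 * (a * a)).
Proof.
move=> Ok; have pq := kind4_indep t0; have h := (chart_place pq).1.
have aa0 := mulf_neq0 a0 a0.
apply: (side_nice pq Ok (chart_l _ _ _) (kind4_b t0) aa0 (oner_neq0 _)).
- rewrite (jac_div _ _ a0); have := jac_div b 0 a0; rewrite rmorph0 subr0 => ->.
  by rewrite rmorph1 mul1r (div_mul _ a a).
- rewrite (div_mul _ a a); exact: kind4_val.
- rewrite expr2 (divff aa0); exact: (place1 h).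
- by right; exact: oner_neq0.
Qed.

Lemma kind5_a : chart (b / a) (a / (b / a)) a 0.
Proof.
have h := (chart_place kind5_indep).1.
have := placeM h (chart_l cst (b / a) (a / (b / a))) (chart_r cst (b / a) _).
by rewrite (blow1_id _ (mulf_neq0 b0 (invr_neq0 a0))) mul0r.
Qed.

Lemma kind5_b : chart (b / a) (a / (b / a)) b 0.
Proof.
have h := (chart_place kind5_indep).1.
have := placeM h kind5_a (chart_l cst (b / a) (a / (b / a))).
by rewrite (blow1_id _ a0) mul0r.
Qed.

(** Put t = b/a and c = a/t, the equations of the second and of the first exceptional curve at their
    common point. Then m = c t^2, with the multiplicities 2 and 1. *)
Lemma kind5_nice O : kind5 O ->
  nice g (x * y) z O (chart (b / a) (a / (b / a))) ex 1 0
    (g / X 0 ^+ 3 * x ^+ 3 * (a * (b / a))).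
Proof.
move=> Ok; have pq := kind5_indep; have h := (chart_place pq).1.
have m10 : -1 != 0 :> k by rewrite oppr_eq0 oner_neq0.
have t0 : b / a != 0 := mulf_neq0 b0 (invr_neq0 a0).
apply: (side_nice pq Ok kind5_a kind5_b (mulf_neq0 a0 t0) m10).
- have := jac_div a 0 t0; rewrite rmorph0 subr0 => ->.
  rewrite jac_swap; have := jac_div b 0 a0; rewrite rmorph0 subr0 => ->.
  by rewrite rmorphN rmorph1 !mulN1r mulNr (div_mul _ a (b / a)).
- rewrite (blow1_id _ a0) (divff b0); exact: (place1 h).
- rewrite (sq_id a0 b0); exact: chart_r.
- by left; exact: oner_neq0.
Qed.

End Side.

Arguments kind2_indep {lx ly lz ex ey ez} fr t0.
Arguments kind4_indep {lx ly lz ex ey ez} fr t0.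

End Points.

Arguments kind2_indep {k lx ly lz ex ey ez} fr t0.
Arguments kind4_indep {k lx ly lz ex ey ez} fr t0.

Section SurfacePoints.

Variable k : closedFieldType.
Local Notation K := {fraction {mpoly k[3]}}.
Local Notation cst := (@cst k).
Local Notation X := (@P2gen k).
Local Notation chart := (chart cst).
Local Notation subring := (K -> Prop).

Lemma blowup_ext (S S' : surface k) (Z Z' : subring -> Prop) O :
  (forall O, S O <-> S' O) -> (forall O, Z O <-> Z' O) ->
  blowup S Z O <-> blowup S' Z' O.
Proof.
move=> SS ZZ; split=> -[[/SS h1 h2]|[O0 [/SS h1 /ZZ h2 h3]]].
- by left; split=> // /ZZ.
- by right; exists O0.
- by left; split=> // /ZZ.
- by right; exists O0.
Qed.

Lemma two_points_swap (O1 O3 O : subring) : two_points O1 O3 O <-> two_points O3 O1 O.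
Proof. by split=> -[h|h]; [right|left|right|left]. Qed.

(** The two sides play the same role; statements over p3 follow from those over p1 through this
    exchange. *)
Lemma blowup_swap (O1 O3 O2 O4 O : subring) :
  blowup (blowup (@P2 k) (two_points O1 O3)) (two_points O2 O4) O <->
  blowup (blowup (@P2 k) (two_points O3 O1)) (two_points O4 O2) O.
Proof.
apply: blowup_ext => O'; last exact: two_points_swap.
by apply: blowup_ext => // O''; exact: two_points_swap.
Qed.

Lemma is_chart_same (O O' : subring) a b : same_ring O O' ->
  is_chart O' a b -> is_chart O a b.
Proof. by move=> OO' Oab f; split=> [/OO'/Oab|/Oab/OO']. Qed.

Lemma same_chart (O O' : subring) a b : is_chart O a b ->
  is_chart O' a b -> same_ring O O'.
Proof. by move=> Oab O'ab f; split=> [/Oab/O'ab|/O'ab/Oab]. Qed.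

Section Sides.

Variables (lx ly lz ex ey ez : 'rV[k]_3) (O1 O3 O2 O4 : subring).
Hypothesis fr : frame lx lz ly ex ez ey.
Hypotheses (O1E : forall f, O1 f <-> ring_of (lv X ex) f)
           (O2E : kind2 lx ly lz O2 0).

Definition side (lx ly lz : 'rV[k]_3) (O : subring) : Prop :=
  [\/ exists2 t0, t0 != 0 & kind2 lx ly lz O t0, kind3 lx ly lz O,
      exists t0, kind4 lx ly lz O t0 | kind5 lx ly lz O].

Definition surf : surface k :=
  blowup (blowup (@P2 k) (two_points O1 O3)) (two_points O2 O4).

Lemma base_chart : is_chart O1 (lin lz / lin lx) (lin ly / lin lx).
Proof.
move=> f; split=> [/O1E[c]|[c]] /(P2_chart fr); first by exists c.
by move=> h; apply/O1E; exists c.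
Qed.

Lemma ex_ey : ~ proj_eq ex ey.
Proof.
move=> [c c0 E]; move: (frame02 fr); rewrite E dotZr (frame00 fr) mulr1.
by move/eqP; rewrite (negPf c0).
Qed.

Definition lies_over (R : 'rV[k]_3) (O : subring) : Prop :=
  exists V, [/\ place cst V, forall f, O f <-> ring_of V f & dominates (lv X R) V].

Lemma lies_over_uniq R R' (O O' : subring) : same_ring O O' -> R != 0 -> R' != 0 ->
  lies_over R O -> lies_over R' O' -> proj_eq R R'.
Proof.
move=> OO' R0 R'0 [V [hV OV dV]] [V' [hV' OV' dV']].
apply: (center_uniq hV hV' _ dV dV' R0 R'0) => f.
by split=> [/OV/OO'/OV'|/OV'/OO'/OV].
Qed.

Lemma chart_over p q O : indep cst p q -> is_chart O p q ->
  chart p q (lin lz / lin lx) 0 -> chart p q (lin ly / lin lx) 0 -> lies_over ex O.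
Proof.
move=> pq Opq Va Vb; exists (chart p q); split=> //; first exact: chart_place.
exact: P2_sub fr (chart_place pq).1 Va Vb.
Qed.

Lemma side_over O : side lx ly lz O -> lies_over ex O.
Proof.
case=> [[t0 _ Ok]|Ok|[t0 Ok]|Ok].
- exact: (chart_over (kind2_indep fr t0) Ok (chart_l _ _ _) (kind2_b fr t0)).
- exact: (chart_over (kind3_indep fr) Ok (kind3_a fr) (chart_l _ _ _)).
- exact: (chart_over (kind4_indep fr t0) Ok (chart_l _ _ _) (kind4_b fr t0)).
- exact: (chart_over (kind5_indep fr) Ok (kind5_a fr) (kind5_b fr)).
Qed.

Lemma O2_over : lies_over ex O2.
Proof. exact: (chart_over (kind2_indep fr 0) O2E (chart_l _ _ _) (kind2_b fr 0)). Qed.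

Lemma P2_over R (O : subring) : (forall f, O f <-> ring_of (lv X R) f) -> lies_over R O.
Proof. by move=> OR; exists (lv X R); split=> //; apply: P2_place. Qed.

Lemma ex_neq0 : ex != 0. Proof. exact: frame_R fr. Qed.

Lemma O2_chart : is_chart O2 (lin lz / lin lx) (lin ly / lin lx / (lin lz / lin lx)).
Proof. by have := O2E; rewrite /kind2 rmorph0 subr0. Qed.

Lemma same_P2 R (O : subring) :
  same_ring O (P2ring R) <-> (forall f, O f <-> ring_of (lv X R) f).
Proof.
by split=> H f; split=> [/H/local_ringE|/local_ringE/H].
Qed.

Lemma O2_surf : blowup (@P2 k) (two_points O1 O3) O2.
Proof.
right; exists O1; split.
- by exists ex; [exact: ex_neq0 | apply/same_P2].
- by left.
- exact: near_point_r (side_indep fr) base_chart O2E.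
Qed.

Lemma side_point O0 O : same_ring O0 O1 -> infinitely_near O0 O -> ~ same_ring O O2 ->
  side lx ly lz O.
Proof.
move=> OO1 nr nO2.
have [[t Ot]|Ok] := near_points (side_indep fr) (is_chart_same OO1 base_chart) nr.
  constructor 1; exists t => //; apply: contra_notN nO2 => /eqP t0.
  by apply: (same_chart (a := lin lz / lin lx)) O2E; rewrite -t0.
by constructor 2.
Qed.

Lemma side_point2 O0 O : same_ring O0 O2 -> infinitely_near O0 O -> side lx ly lz O.
Proof.
move=> OO2 nr.
have [[t Ot]|Ok] := near_points (indep_div (side_indep fr)) (is_chart_same OO2 O2_chart) nr.
  by constructor 3; exists t.
by constructor 4.
Qed.

(** The function y/z tells the directions apart: it has the value t0, or its inverse vanishes,
    whereas it vanishes at O2. *)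
Lemma side_neq_O2 O : (exists2 t0, t0 != 0 & kind2 lx ly lz O t0) \/ kind3 lx ly lz O ->
  ~ same_ring O O2.
Proof.
have hV2 := chart_place (indep_div (side_indep fr)).
move=> [[t0 t0n Ok]|Ok] OO2.
  have hV := chart_place (kind2_indep fr t0).
  have E f : ring_of (chart (lin lz / lin lx)
      (lin ly / lin lx / (lin lz / lin lx) - cst t0)) f <->
    ring_of (chart (lin lz / lin lx) (lin ly / lin lx / (lin lz / lin lx))) f.
    by split=> [/Ok/OO2/O2_chart|/O2_chart/OO2/Ok].
  have V1 := place_same_ring hV hV2 E (kind2_val fr t0).
  by move/eqP: t0n; apply; apply: place_uniq hV2 V1 (chart_r _ _ _).
have hV := chart_place (kind3_indep fr).
have E f : ring_of (chart (lin ly / lin lx) (lin lz / lin lx / (lin ly / lin lx))) f <->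
    ring_of (chart (lin lz / lin lx) (lin ly / lin lx / (lin lz / lin lx))) f.
  by split=> [/Ok/OO2/O2_chart|/O2_chart/OO2/Ok].
have V1 := place_same_ring hV hV2 E (chart_r _ _ _).
have V2 := placeM hV2.1 V1 (chart_r cst (lin lz / lin lx) _).
have a0 := indep_l0 (side_indep fr); have b0 := indep_r0 (side_indep fr).
move: V2; rewrite mulr0 mulrA (divfK b0) (divff a0) => V2.
by have /eqP := place_uniq hV2 V2 (place1 hV2.1); rewrite eq_sym oner_eq0.
Qed.

End Sides.

Section Cases.

Variables (lx ly lz ex ey ez : 'rV[k]_3) (O1 O3 O2 O4 : subring).
Hypothesis fr : frame lx lz ly ex ez ey.
Hypotheses (O1E : forall f, O1 f <-> ring_of (lv X ex) f)
           (O3E : forall f, O3 f <-> ring_of (lv X ey) f)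
           (O2E : kind2 lx ly lz O2 0) (O4E : kind2 ly lx lz O4 0).

Lemma fr_swap : frame ly lz lx ey ez ex.
Proof. by apply/frame_swap12/frame_swap01/frame_swap12. Qed.

Lemma surf_cases O : surf O1 O3 O2 O4 O ->
  [\/ exists R, [/\ R != 0, ~ proj_eq ex R, ~ proj_eq ey R &
                  forall f, O f <-> ring_of (lv X R) f],
      side lx ly lz O | side ly lx lz O].
Proof.
have key R S (Q : subring) : (forall f, Q f <-> ring_of (lv X R) f) -> proj_eq R S ->
    forall f, Q f <-> ring_of (lv X S) f.
  move=> QR [c c0 SE] f; rewrite SE; split=> [/QR[v Vf]|[v Vf]].
    by exists v; apply/(lv_scaleE R f v c0).
  by apply/QR; exists v; apply/(lv_scaleE R f v c0).
move=> [[[[[R R0 /same_P2 OR] nZ]|[O0 [_ [OO1|OO3] nr]]] nZ2]|[O0 [_ [OO2|OO4] nr]]].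
- constructor 1; exists R; split=> // pR; apply: nZ; [left|right].
    by have := key _ _ _ O1E pR => E f; split=> [/OR/E|/E/OR].
  by have := key _ _ _ O3E pR => E f; split=> [/OR/E|/E/OR].
- constructor 2; apply: (side_point fr O1E O2E OO1 nr) => h.
  by apply: nZ2; left.
- constructor 3; apply: (side_point fr_swap O3E O4E OO3 nr) => h.
  by apply: nZ2; right.
- by constructor 2; apply: (side_point2 fr O2E OO2 nr).
- by constructor 3; apply: (side_point2 fr_swap O4E OO4 nr).
Qed.

Lemma surf_P2 R O : R != 0 -> ~ proj_eq ex R -> ~ proj_eq ey R ->
  (forall f, O f <-> ring_of (lv X R) f) -> surf O1 O3 O2 O4 O.
Proof.
move=> R0 nx ny OR; have ov := P2_over OR.
have ex0 := ex_neq0 fr; have ey0 := ex_neq0 fr_swap.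
left; split.
  left; split; first by exists R => //; apply/same_P2.
  move=> [E|E].
    by apply: nx; apply/proj_eq_sym/(lies_over_uniq E R0 ex0 ov)/P2_over.
  by apply: ny; apply/proj_eq_sym/(lies_over_uniq E R0 ey0 ov)/P2_over.
move=> [E|E].
  by apply: nx; apply/proj_eq_sym/(lies_over_uniq E R0 ex0 ov)/(O2_over fr O2E).
by apply: ny; apply/proj_eq_sym/(lies_over_uniq E R0 ey0 ov)/(O2_over fr_swap O4E).
Qed.

Lemma surf_side O : side lx ly lz O -> surf O1 O3 O2 O4 O.
Proof.
move=> sO; have ov := side_over fr sO.
have ex0 := ex_neq0 fr; have ey0 := ex_neq0 fr_swap.
have nO4 : ~ same_ring O O4.
  move=> E; apply: (ex_ey fr).
  exact: (lies_over_uniq E ex0 ey0 ov (O2_over fr_swap O4E)).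
have first : (exists2 t0, t0 != 0 & kind2 lx ly lz O t0) \/ kind3 lx ly lz O ->
    surf O1 O3 O2 O4 O.
  move=> h; left; split; last first.
    by move=> [E|//]; apply: (side_neq_O2 fr O2E h E).
  right; exists O1; split.
  - by exists ex => //; apply/same_P2.
  - by left.
  - case: h => [[t0 _ Ok]|Ok].
      exact: near_point_r (side_indep fr) (base_chart fr O1E) Ok.
    exact: near_point_l (side_indep fr) (base_chart fr O1E) Ok.
have second : (exists t0, kind4 lx ly lz O t0) \/ kind5 lx ly lz O ->
    surf O1 O3 O2 O4 O.
  move=> h; right; exists O2; split.
  - exact: (O2_surf O3 fr O1E O2E).
  - by left.
  - have pq := indep_div (side_indep fr).
    case: h => [[t0 Ok]|Ok].
      exact: near_point_r pq (O2_chart O2E) Ok.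
    exact: near_point_l pq (O2_chart O2E) Ok.
case: sO => h; [apply: first|apply: first|apply: second|apply: second];
  by [left|right].
Qed.

End Cases.

Lemma surf_side' (lx ly lz ex ey ez : 'rV[k]_3) (O1 O3 O2 O4 : subring) O :
  frame lx lz ly ex ez ey ->
  (forall f, O3 f <-> ring_of (lv X ey) f) ->
  kind2 lx ly lz O2 0 -> kind2 ly lx lz O4 0 ->
  side ly lx lz O -> surf O1 O3 O2 O4 O.
Proof.
move=> fr h3 h2 h4 sO; apply/blowup_swap.
exact: (surf_side O1 (fr_swap fr) h3 h4 h2 sO).
Qed.

End SurfacePoints.

(** * Anticanonical sections *)

Section CubicIdentities.

Variable K : fieldType.
Implicit Types (G x y z f h : K).

Lemma h_z G f z : f / (G * z ^+ 3 * 1) = f / (G * z ^+ 3).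
Proof. by rewrite mulr1. Qed.

Lemma h_line G f x z : G != 0 -> x != 0 -> z != 0 ->
  f / (G * x ^+ 3 * 1) = (z / x) ^+ 3 * (f / (G * z ^+ 3)).
Proof. by move=> *; field; do ?(apply/andP; split). Qed.

Lemma h_side G f x z : G != 0 -> x != 0 -> z != 0 ->
  f / (G * x ^+ 3 * (z / x * (z / x))) = z / x * (f / (G * z ^+ 3)).
Proof. by move=> *; field; do ?(apply/andP; split). Qed.

Lemma inv_quot x z : (x / z)^-1 = z / x.
Proof. by rewrite invfM invrK mulrC. Qed.

Lemma quot_quot x y z : x != 0 -> z != 0 -> y / x / (z / x) = y / z.
Proof. by move=> *; field; apply/andP. Qed.

Lemma side_quot x y z : x != 0 -> z != 0 -> y / x / (z / x) / (z / x) * (z / x) = y / z.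
Proof. by move=> *; field; apply/andP. Qed.

Lemma cubic_id G x y z f h c00 c10 c01 c11 c21 c12 : G != 0 -> z != 0 ->
  h = f / (G * z ^+ 3) ->
  h = c00 + c10 * (x / z) + (c01 + c11 * (x / z) + c21 * (x / z) ^+ 2) * (y / z) +
      c12 * (x / z) * (y / z) ^+ 2 ->
  f = G * (x * y * (c21 * x + c12 * y + c11 * z) + z ^+ 2 * (c10 * x + c01 * y + c00 * z)).
Proof.
move=> G0 z0 hE; rewrite hE => E.
have -> : f = f / (G * z ^+ 3) * (G * z ^+ 3) by field; apply/andP.
by rewrite E; field.
Qed.

Lemma h_rational f g X0 z : g != 0 -> X0 != 0 -> z != 0 ->
  f / (g / X0 ^+ 3 * z ^+ 3) = f * g^-1 * (X0 / z) * (X0 / z) * (X0 / z).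
Proof. by move=> *; field; do ?(apply/andP; split). Qed.

Lemma sec_id G N Z u v w : G * (N * u + Z * v) / w = G * N * u / w + G * Z * v / w.
Proof. by rewrite mulrDr mulrDl !mulrA. Qed.

Lemma scal_id P c u w : P * (c * u) / w = c * (P * u / w) :> K.
Proof. by ring. Qed.

Lemma mulf_eq0_r u v : u != 0 -> u * v = 0 -> v = 0 :> K.
Proof. by move=> u0 /eqP; rewrite mulf_eq0 (negPf u0) => /eqP. Qed.

Lemma ratio_id u v w : w != 0 -> (w * u) / (w * v) = u / v :> K.
Proof. by move=> w0; rewrite -mulf_div divff // mul1r. Qed.

End CubicIdentities.

Section RationalFunctions.

Variables (k : closedFieldType) (K : fieldType) (cst : {rmorphism k -> K}).
Variables (a b : K).
Hypothesis ab : indep cst a b.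

Lemma rationalM f g : rational cst a b f -> rational cst a b g ->
  rational cst a b (f * g).
Proof.
move=> [A [B [B0 ->]]] [A' [B' [B'0 ->]]]; exists (A * A'), (B * B').
by rewrite mulf_neq0 // mulf_div !rmorphM.
Qed.

Lemma rationalV f : rational cst a b f -> rational cst a b f^-1.
Proof.
move=> [A [B [B0 ->]]]; have [->|A0] := eqVneq A 0.
  exists 0, 1; rewrite oner_neq0; split=> //.
  by rewrite rmorph0 !mul0r invr0.
by exists B, A; rewrite invf_div.
Qed.

Lemma rational_ev A : rational cst a b (ev cst a b A).
Proof. by exists A, 1; rewrite oner_neq0 rmorph1 divr1. Qed.

Lemma chartat_0 f : ring_of (chart cst a b) f -> ring_of (chartat cst 0 0 b a) f.
Proof. by move=> [c /(chart_swap _ _ ab) h]; exists c. Qed.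

End RationalFunctions.

Section PolyTruncation.

Variable k : nzRingType.

Lemma poly_lt3 (p : {poly k}) : (forall i, (2 < i)%N -> p`_i = 0) ->
  p = (p`_0)%:P + (p`_1)%:P * 'X + (p`_2)%:P * 'X^2.
Proof.
move=> h; apply/polyP => i; rewrite !coefD coefC !coefCM coefX coefXn.
by case: i => [|[|[|i]]] /=; rewrite ?mulr0 ?mulr1 ?addr0 ?add0r //; apply: h.
Qed.

End PolyTruncation.

Section Sections.

Variable k : closedFieldType.
Local Notation K := {fraction {mpoly k[3]}}.
Local Notation cst := (@cst k).
Local Notation X := (@P2gen k).
Local Notation chart := (chart cst).
Local Notation subring := (K -> Prop).

Definition sec (g N Z : K) (l1 l2 : 'rV[k]_3) : K :=
  g / X 0 ^+ 3 * (N * lin l1 + Z ^+ 2 * lin l2).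

Lemma nice_sec g N Z O V R tau kappa w l1 l2 : nice g N Z O V R tau kappa w ->
  V (sec g N Z l1 l2 / w) (tau * dot l1 R + kappa * dot l2 R).
Proof.
move=> [hV _ VN VZ _ _ _ _ _]; have hp := hV.1; rewrite /sec sec_id.
have aux M t (l : 'rV[k]_3) :
    (forall i, V (g / X 0 ^+ 3 * M * X i / w) (t * R 0 i)) ->
    V (g / X 0 ^+ 3 * M * lin l / w) (t * dot l R).
  move=> VM; have -> : g / X 0 ^+ 3 * M * lin l / w =
      \sum_i g / X 0 ^+ 3 * M * (cst (l 0 i) * X i) / w.
    by rewrite /lin mulr_sumr mulr_suml.
  have -> : t * dot l R = \sum_i t * (l 0 i * R 0 i) by rewrite /dot mulr_sumr.
  apply: (place_sum _ hp) => i.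
  have -> : g / X 0 ^+ 3 * M * (cst (l 0 i) * X i) / w =
      cst (l 0 i) * (g / X 0 ^+ 3 * M * X i / w).
    exact: scal_id.
  rewrite [t * _]mulrCA; exact: (placeM hp (placeC hp _) (VM i)).
exact: (placeD hp (aux _ _ _ VN) (aux _ _ _ VZ)).
Qed.

Lemma nice_eq (g N Z : K) O (V V' : K -> k -> Prop) R tau kappa w : (forall f c, V' f c <-> V f c) ->
  nice g N Z O V R tau kappa w -> nice g N Z O V' R tau kappa w.
Proof.
move=> VV [h1 h2 h3 h4 h5 h6 h7 h8 h9].
apply: (Nice (place_eq VV h1) _ _ _ h5 h6 h7 _ h9).
- move=> f; split=> [/h2[c Vf]|[c /VV Vf]]; last by apply/h2; exists c.
  by exists c; apply/VV.
- by move=> i; apply/VV/h3.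
- by move=> i; apply/VV/h4.
- by move=> w' /h8[e [c [Ve c0 ->]]]; exists e, c; split=> //; apply/VV.
Qed.

Lemma nice_sym (g x y Z : K) O V R tau kappa w : nice g (y * x) Z O V R tau kappa w ->
  nice g (x * y) Z O V R tau kappa w.
Proof. by rewrite (mulrC y x). Qed.

Lemma nice_frame g (lx ly lz l0 l1 l2 e0 e1 e2 : 'rV[k]_3) O :
  frame l0 l1 l2 e0 e1 e2 -> g != 0 -> (forall f, O f <-> ring_of (lv X e0) f) ->
  (dot lx e0 * dot ly e0 != 0 \/ dot lz e0 * dot lz e0 != 0) ->
  nice g (lin lx * lin ly) (lin lz) O (lv X e0) e0 (dot lx e0 * dot ly e0)
    (dot lz e0 * dot lz e0) (g / X 0 ^+ 3 * lin l0 ^+ 3 * 1).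
Proof.
move=> fr g0 OE tk; have ab := frame_indep fr; have E := P2_chart fr.
apply: (nice_eq E).
have Oab : is_chart O (lin l1 / lin l0) (lin l2 / lin l0).
  move=> f; split=> [/OE[c]|[c]] /E; first by exists c.
  by move=> h; apply/OE; exists c.
have V l : chart (lin l1 / lin l0) (lin l2 / lin l0) (lin l / lin l0) (dot l e0).
  by apply/E; exact: lin_lv (frame00 fr).
have hp := (chart_place ab).1.
have VX i := gen_chart i fr hp (chart_l _ _ _) (chart_r _ _ _).
have G0 : g / X 0 ^+ 3 != 0 := mulf_neq0 g0 (invr_neq0 (expf_neq0 3 (X_neq0 k 0))).
have l00 := frame_neq0 fr.
apply: (nice_chart fr g0 ab Oab (oner_neq0 _) (oner_neq0 _) _ tk).
- by rewrite rmorph1 mul1r divr1.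
- move=> i; rewrite (valN_id' _ _ _ G0 l00).
  exact: (placeM hp (placeM hp (V lx) (V ly)) (VX i)).
- move=> i; rewrite (valZ_id' _ _ G0 l00).
  exact: (placeM hp (placeM hp (V lz) (V lz)) (VX i)).
Qed.

Section Fix.

Variables (lx ly lz ex ey ez : 'rV[k]_3) (O1 O3 O2 O4 : subring) (g : K).
Hypothesis fr : frame lx lz ly ex ez ey.
Hypotheses (O1E : forall f, O1 f <-> ring_of (lv X ex) f)
           (O3E : forall f, O3 f <-> ring_of (lv X ey) f)
           (O2E : kind2 lx ly lz O2 0) (O4E : kind2 ly lx lz O4 0).
Hypothesis g0 : g != 0.
Let x := lin lx.
Let y := lin ly.
Let z := lin lz.

Lemma fr_z : frame lz lx ly ez ex ey.
Proof. exact: frame_swap01 fr. Qed.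

Lemma fr_x : frame lx ly lz ex ey ez.
Proof. exact: frame_swap12 fr. Qed.

Lemma nice_side O : side lx ly lz O -> exists V tau kappa w,
  nice g (x * y) z O V ex tau kappa w.
Proof.
case=> [[t0 t00 Ok]|Ok|[t0 Ok]|Ok]; do 4!eexists.
- exact: (kind2_nice fr g0 t00 Ok).
- exact: (kind3_nice fr g0 Ok).
- exact: (kind4_nice fr g0 Ok).
- exact: (kind5_nice fr g0 Ok).
Qed.

(** Away from ex and ey either z is nonzero, or z = 0 and both x and y are nonzero. So (xy : z^2) is
    defined there, and a frame whose base point is proportional to R is available. *)
Lemma nice_P2 R O : R != 0 -> ~ proj_eq ex R -> ~ proj_eq ey R ->
  (forall f, O f <-> ring_of (lv X R) f) -> exists c w, c != 0 /\
    nice g (x * y) z O (lv X R) (c *: R) (dot lx (c *: R) * dot ly (c *: R))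
      (dot lz (c *: R) * dot lz (c *: R)) w.
Proof.
move=> R0 nx ny OE.
have OE' c : c != 0 -> forall f, O f <-> ring_of (lv X (c *: R)) f.
  move=> c0 f; split=> [/OE[v Vf]|[v Vf]].
    by exists v; apply/lv_scaleE.
  by apply/OE; exists v; apply/(lv_scaleE R f v c0).
have RE := frameE fr_z R.
have fin c l0 l1 l2 e1 e2 : c != 0 -> frame l0 l1 l2 (c *: R) e1 e2 ->
    (dot lx (c *: R) * dot ly (c *: R) != 0 \/ dot lz (c *: R) * dot lz (c *: R) != 0) ->
    exists c w, c != 0 /\
    nice g (x * y) z O (lv X R) (c *: R) (dot lx (c *: R) * dot ly (c *: R))
      (dot lz (c *: R) * dot lz (c *: R)) w.
  move=> c0 f0 tk; have := nice_frame f0 g0 (OE' _ c0) tk.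
  move=> /(nice_eq (V' := lv X R)) h; do 2!eexists; split; first exact: c0.
  by apply: h => f v; symmetry; apply: lv_scaleE.
have [zR|zR] := eqVneq (dot lz R) 0; last first.
  have := frame_shift (dot lx R / dot lz R) (dot ly R / dot lz R) fr_z.
  have -> : ez + (dot lx R / dot lz R) *: ex + (dot ly R / dot lz R) *: ey =
      (dot lz R)^-1 *: R.
    rewrite [X in _ = _ *: X]RE !scalerDr !scalerA mulVf // scale1r.
    by rewrite !(mulrC (dot lz R)^-1).
  move=> f0; apply: (fin (dot lz R)^-1 _ _ _ _ _ _ f0); first by rewrite invr_eq0.
  by right; rewrite dotZr mulVf // mulr1 oner_neq0.
rewrite zR scale0r add0r in RE.
have xR : dot lx R != 0.
  apply/negP => /eqP xR; apply: ny; exists (dot ly R).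
    by apply: contra_neq R0 => yR; rewrite RE xR yR !scale0r addr0.
  by rewrite {1}RE xR scale0r add0r.
have yR : dot ly R != 0.
  apply/negP => /eqP yR; apply: nx; exists (dot lx R) => //.
  by rewrite {1}RE yR scale0r addr0.
have := frame_shift (dot ly R / dot lx R) 0 fr_x.
have -> : ex + (dot ly R / dot lx R) *: ey + 0 *: ez = (dot lx R)^-1 *: R.
  rewrite [X in _ = _ *: X]RE scale0r addr0 scalerDr !scalerA mulVf // scale1r.
  by rewrite (mulrC (dot lx R)^-1).
move=> f0; apply: (fin (dot lx R)^-1 _ _ _ _ _ _ f0); first by rewrite invr_eq0.
by left; rewrite !dotZr !mulf_neq0 ?invr_eq0.
Qed.

Lemma ratio_rational d (A B : {mpoly k[3]}) : A \is d.-homog -> B \is d.-homog ->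
  geval X B != 0 -> rational cst (x / z) (y / z) (geval X A / geval X B).
Proof.
move=> hA hB B0; have z0 : z != 0 := frame_neq0 fr_z.
have E (A' : {mpoly k[3]}) : exists A'', geval (fun i => z^-1 * X i) A' = ev cst (x / z) (y / z) A''.
  elim/mpolyind: A' => [|c m p _ _ [p' IH]].
    by exists 0; rewrite /geval mmap0 rmorph0.
  have [q qE] : exists q, geval (fun i => z^-1 * X i) 'X_[m] = ev cst (x / z) (y / z) q.
    rewrite /geval mmapX /mmap1; elim/big_ind: _ => [|u v [u' ->] [v' ->]|i _].
    - by exists 1; rewrite rmorph1.
    - by exists (u' * v'); rewrite rmorphM.
    - exists (((ez 0 i)%:P%:P + 'X%:P * (ex 0 i)%:P%:P + 'X * (ey 0 i)%:P%:P) ^+ m i).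
      rewrite rmorphXn /= !rmorphD !rmorphM /= !evC !ev1C ev1X evX; congr (_ ^+ _).
      rewrite (frame_gen i fr_z) -/x -/y -/z !mulrDr !mulrA mulVf // mul1r.
      by rewrite !(mulrC z^-1).
  exists (c%:P%:P * q + p'); rewrite gevalD gevalZ qE IH rmorphD rmorphM /=.
  by rewrite evC ev1C.
have [[A' AE] [B' BE]] := (E A, E B).
have zd : z^-1 ^+ d != 0 := expf_neq0 d (invr_neq0 z0).
exists A', B'; split.
  apply: contra_neq B0 => B'0; move: BE; rewrite B'0 rmorph0 (geval_homog _ _ hB).
  exact: mulf_eq0_r zd.
by rewrite -AE -BE (geval_homog _ _ hA) (geval_homog _ _ hB) (ratio_id _ _ zd).
Qed.

End Fix.

End Sections.

Section Classification.

Variable k : closedFieldType.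
Local Notation K := {fraction {mpoly k[3]}}.
Local Notation cst := (@cst k).
Local Notation X := (@P2gen k).
Local Notation chart := (chart cst).
Local Notation subring := (K -> Prop).

Lemma shift_quot (L : fieldType) (x z c : L) : z != 0 -> (x - c * z) / z = x / z - c.
Proof. by move=> z0; rewrite mulrBl mulfK. Qed.

(** The three inequalities leave the six lattice points (0,0), (1,0), (0,1), (1,1), (2,1), (1,2) of
    a pentagon; this is the origin of the dimension 6. *)
Lemma pentagon_ev (L : fieldType) (i : {rmorphism k -> L}) (a b : L) (A : {poly {poly k}}) :
  (forall i j, A`_j`_i != 0 -> [/\ (i + j <= 3)%N, (i <= j.+1)%N & (j <= i.+1)%N]) ->
  ev i a b A = i A`_0`_0 + i A`_0`_1 * a +
    (i A`_1`_0 + i A`_1`_1 * a + i A`_1`_2 * a ^+ 2) * b + i A`_2`_1 * a * b ^+ 2.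
Proof.
move=> h; have nul i' j : ~~ [&& (i' + j <= 3)%N, (i' <= j.+1)%N & (j <= i'.+1)%N] -> A`_j`_i' = 0.
  by move=> n; apply/eqP/negPn/negP => /h[h1 h2 h3]; move: n; rewrite h1 h2 h3.
have A0 : A`_0 = (A`_0`_0)%:P + (A`_0`_1)%:P * 'X.
  apply/polyP => j; rewrite coefD coefC coefCM coefX.
  by case: j => [|[|j]] /=; rewrite ?mulr0 ?mulr1 ?addr0 ?add0r //; apply: nul; lia.
have A1 : A`_1 = (A`_1`_0)%:P + (A`_1`_1)%:P * 'X + (A`_1`_2)%:P * 'X^2.
  by apply: poly_lt3 => j j2; apply: nul; lia.
have A2 : A`_2 = (A`_2`_1)%:P * 'X.
  apply/polyP => j; rewrite coefCM coefX.
  by case: j => [|[|j]] /=; rewrite ?mulr0 ?mulr1 //; apply: nul; lia.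
have AE : A = (A`_0)%:P + (A`_1)%:P * 'X + (A`_2)%:P * 'X^2.
  by apply: poly_lt3 => j j2; apply/polyP => i'; rewrite coef0; apply: nul; lia.
rewrite {1}AE {1}A0 {1}A1 {1}A2.
rewrite !(rmorphD, rmorphM) /= ?rmorphXn /= ?evC ?evX.
by rewrite ?(rmorphD, rmorphM) /= ?rmorphXn /= ?evC ?evX ?ev1C ?ev1X; ring.
Qed.

Variables (lx ly lz ex ey ez : 'rV[k]_3) (O1 O3 O2 O4 : subring) (g f : K).
Hypothesis fr : frame lx lz ly ex ez ey.
Hypotheses (O1E : forall f, O1 f <-> ring_of (lv X ex) f)
           (O3E : forall f, O3 f <-> ring_of (lv X ey) f)
           (O2E : kind2 lx ly lz O2 0) (O4E : kind2 ly lx lz O4 0).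
Hypothesis g0 : g != 0.
Let x := lin lx.
Let y := lin ly.
Let z := lin lz.
Hypotheses (frat : rational cst (x / z) (y / z) f) (grat : rational cst (x / z) (y / z) g).
Hypothesis freg : forall O w, surf O1 O3 O2 O4 O -> canonical_eq g O w -> O (f / w).

Let G := g / X 0 ^+ 3.
Let h := f / (G * z ^+ 3).

Lemma nice_reg O V R tau kappa w : surf O1 O3 O2 O4 O ->
  nice g (x * y) z O V R tau kappa w -> ring_of V (f / w).
Proof.
move=> sO [hV OV _ _ _ _ _ _ ex1]; apply/OV.
by have := freg sO (ex1 1 (oner_neq0 _)); rewrite rmorph1 mul1r.
Qed.

Let z0 : z != 0. Proof. exact: frame_neq0 (fr_z fr). Qed.
Let x0 : x != 0. Proof. exact: frame_neq0 fr. Qed.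
Let y0 : y != 0. Proof. exact: frame_neq0 (fr_swap fr). Qed.
Let G0 : G != 0. Proof. exact: mulf_neq0 g0 (invr_neq0 (expf_neq0 3 (X_neq0 k 0))). Qed.

Lemma frame_reg l0 l1 l2 e0 e1 e2 : frame l0 l1 l2 e0 e1 e2 ->
  ~ proj_eq ex e0 -> ~ proj_eq ey e0 ->
  (dot lx e0 * dot ly e0 != 0 \/ dot lz e0 * dot lz e0 != 0) ->
  ring_of (chart (lin l1 / lin l0) (lin l2 / lin l0)) (f / (G * lin l0 ^+ 3 * 1)).
Proof.
move=> f0 nx ny tk; pose O := ring_of (lv X e0).
have OE f' : O f' <-> ring_of (lv X e0) f' by [].
have sO : surf O1 O3 O2 O4 O by exact: (surf_P2 fr O1E O3E O2E O4E (frame_R f0) nx ny OE).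
have [c Vc] := nice_reg sO (nice_frame f0 g0 OE tk).
by exists c; apply/(P2_chart f0).
Qed.

Lemma not_proj (l R S : 'rV[k]_3) : dot l R = 0 -> dot l S != 0 -> ~ proj_eq R S.
Proof. by move=> lR lS [c _ E]; move: lS; rewrite E dotZr lR mulr0 eqxx. Qed.

(** Off the line z = 0, G z^3 is a local equation of K_X, so the dehomogenized section h is regular
    on the whole affine plane. *)
Lemma h_plane a b : ring_of (chart (x / z - cst a) (y / z - cst b)) h.
Proof.
have f0 := frame_shift a b (fr_z fr).
have dz : dot lz (ez + a *: ex + b *: ey) = 1 := frame00 f0.
have n10 := oner_neq0 k.
have := frame_reg f0 _ _ _; rewrite !linB !linZ.
rewrite (shift_quot _ _ z0) (shift_quot _ _ z0) (h_z G f z); apply.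
- by apply: (not_proj (l := lz)); rewrite ?dz ?(frame10 fr).
- by apply: (not_proj (l := lz)); rewrite ?dz ?(frame12 fr).
- by right; rewrite dz mulr1.
Qed.

(** The test point ex + ey lies on the line z = 0 away from p1 and p3; there y/x = 1, and x^3
    replaces z^3 in the local equation. *)
Lemma h_line_reg : ring_of (chartat cst 1 0 (y / x) (z / x)) ((z / x) ^+ 3 * h).
Proof.
have f0 := frame_shift 1 0 (fr_x fr); set R := ex + _ + _ in f0.
have n10 := oner_neq0 k.
have dx : dot lx R = 1 := frame00 f0.
have dy : dot ly R = 1.
  by rewrite !dotDr !dotZr (frame20 fr) (frame22 fr) (frame21 fr) mulr0 mulr1 addr0 add0r.
have := frame_reg f0 _ _ _; rewrite !linB !linZ.
rewrite (shift_quot _ _ x0) (shift_quot _ _ x0) (h_line f G0 x0 z0) => hreg.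
have [||| c Vc] := hreg _ _ _.
- by apply: (not_proj (l := ly)); rewrite ?dy ?(frame20 fr).
- by apply: (not_proj (l := lx)); rewrite ?dx ?(frame02 fr).
- by left; rewrite dx dy mulr1.
by exists c; apply: (chart_transl (indep_swap (side_indep fr)) Vc).
Qed.

End Classification.

Section Classification2.

Variable k : closedFieldType.
Local Notation K := {fraction {mpoly k[3]}}.
Local Notation cst := (@cst k).
Local Notation X := (@P2gen k).
Local Notation chart := (chart cst).
Local Notation subring := (K -> Prop).

(** The origin of the chart [kind4] is the point of the second exceptional curve at which
    [slope_bound] will be applied. *)
Lemma h_side_reg (lx ly lz ex ey ez : 'rV[k]_3) (surf0 : surface k) (g f : K) :
  frame lx lz ly ex ez ey -> g != 0 ->
  (forall O, kind4 lx ly lz O 0 -> surf0 O) ->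
  (forall O w, surf0 O -> canonical_eq g O w -> O (f / w)) ->
  let a := lin lz / lin lx in let b := lin ly / lin lx in
  ring_of (chartat cst 0 0 (b / a / a) a) (a * (f / (g / X 0 ^+ 3 * lin lz ^+ 3))).
Proof.
move=> fr g0 sub freg a b; pose O := ring_of (chart a (b / a / a - cst 0)).
have Ok : kind4 lx ly lz O 0 by [].
have [hV OV _ _ _ _ _ _ ex1] := kind4_nice fr g0 Ok.
have := freg _ _ (sub _ Ok) (ex1 1 (oner_neq0 _)); rewrite rmorph1 mul1r => Of.
have G0 : g / X 0 ^+ 3 != 0 := mulf_neq0 g0 (invr_neq0 (expf_neq0 3 (X_neq0 k 0))).
have x0 : lin lx != 0 := frame_neq0 fr.
have z0 : lin lz != 0 := frame_neq0 (fr_z fr).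
move: Of; rewrite (h_side _ G0 x0 z0) /O rmorph0 subr0.
apply: chartat_0; exact: indep_div (indep_div (side_indep fr)).
Qed.

(** Regularity on the affine plane makes h a polynomial. The line z = 0 and the two second
    exceptional curves give one inequality each on its exponents; the one over p3 is read after
    exchanging the two variables. *)
Lemma section_cubic (lx ly lz ex ey ez : 'rV[k]_3) (O1 O3 O2 O4 : subring) (g f : K) :
  frame lx lz ly ex ez ey ->
  (forall f, O1 f <-> ring_of (lv X ex) f) -> (forall f, O3 f <-> ring_of (lv X ey) f) ->
  kind2 lx ly lz O2 0 -> kind2 ly lx lz O4 0 -> g != 0 ->
  rational cst (lin lx / lin lz) (lin ly / lin lz) f ->
  rational cst (lin lx / lin lz) (lin ly / lin lz) g ->
  (forall O w, surf O1 O3 O2 O4 O -> canonical_eq g O w -> O (f / w)) ->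
  exists l1 l2, f = sec g (lin lx * lin ly) (lin lz) l1 l2.
Proof.
move=> fr O1E O3E O2E O4E g0 frat grat freg.
set x := lin lx in frat grat *; set y := lin ly in frat grat *.
set z := lin lz in frat grat *; pose G := g / X 0 ^+ 3.
have x0 : x != 0 := frame_neq0 fr.
have y0 : y != 0 := frame_neq0 (fr_swap fr).
have z0 : z != 0 := frame_neq0 (fr_z fr).
have G0 : G != 0 := mulf_neq0 g0 (invr_neq0 (expf_neq0 3 (X_neq0 k 0))).
pose h := f / (G * z ^+ 3).
have al : indep cst (x / z) (y / z) := frame_indep (fr_z fr).
have rX : rational cst (x / z) (y / z) (X 0 / z).
  have h1 : ('X_0 : {mpoly k[3]}) \is 1.-homog by rewrite dhomogX /= mdeg1.
  have h2 : geval X (linp lz) != 0 by rewrite geval_linp; exact: z0.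
  by have := ratio_rational fr h1 (linp_homog lz) h2; rewrite gevalX geval_linp.
have hrat : rational cst (x / z) (y / z) h.
  rewrite /h /G (h_rational f g0 (X_neq0 k 0) z0).
  exact: (rationalM (rationalM (rationalM (rationalM frat (rationalV grat)) rX) rX) rX).
have [A hA] := regular_polynomial al hrat (h_plane fr O1E O3E O2E O4E g0 freg).
have a0 : indep cst (z / x) (y / x) := side_indep fr.
have a0' : indep cst (z / y) (x / y) := side_indep (fr_swap fr).
have H1 : forall i j, A`_j`_i != 0 -> (i + j <= 3)%N.
  have := h_line_reg fr O1E O3E O2E O4E g0 freg.
  rewrite -/x -/y -/z -/G -/h hA -(inv_quot z x) -(quot_quot y x0 z0).
  exact: (degree_bound (indep_swap a0)).
have H2 : forall i j, A`_j`_i != 0 -> (i <= j.+1)%N.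
  have sub O : kind4 lx ly lz O 0 -> surf O1 O3 O2 O4 O.
    by move=> Ok; apply: (surf_side O3 fr O1E O2E O4E); constructor 3; exists 0.
  have := h_side_reg fr g0 sub freg; rewrite /= -/x -/y -/z -/G -/h hA.
  rewrite -(inv_quot z x) -(side_quot y x0 z0).
  exact: (slope_bound (indep_swap (indep_div (indep_div a0)))).
have H3 : forall i j, A`_j`_i != 0 -> (j <= i.+1)%N.
  have sub O : kind4 ly lx lz O 0 -> surf O1 O3 O2 O4 O.
    by move=> Ok; apply: (surf_side' O1 fr O3E O2E O4E); constructor 3; exists 0.
  have := h_side_reg (fr_swap fr) g0 sub freg; rewrite /= -/x -/y -/z -/G -/h hA.
  rewrite -(ev_swap cst (x / z) (y / z)) -(inv_quot z y) -(side_quot x y0 z0).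
  move=> /(slope_bound (indep_swap (indep_div (indep_div a0')))) H i j.
  by rewrite -coef_swapXY => /H.
have hE := pentagon_ev cst (x / z) (y / z) (fun i j Aij => And3 (H1 i j Aij) (H2 i j Aij) (H3 i j Aij)).
rewrite -hA in hE.
exists (A`_1`_2 *: lx + A`_2`_1 *: ly + A`_1`_1 *: lz),
       (A`_0`_1 *: lx + A`_1`_0 *: ly + A`_0`_0 *: lz).
rewrite /sec !linD !linZ; exact: (cubic_id G0 z0 (erefl h) hE).
Qed.

End Classification2.

(** * The Frobenius *)

Lemma map_homog (R S : fieldType) (f : {rmorphism R -> S}) n d (A : {mpoly R[n]}) :
  A \is d.-homog -> map_mpoly f A \is d.-homog.
Proof.
move=> /dhomogP h; apply/dhomogP => m; rewrite (perm_mem (msupp_map_mpoly _ _)).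
  exact: h.
exact: fmorph_inj.
Qed.

Section Frobenius.

Variables (F : finFieldType) (k : closedFieldType) (iota : {rmorphism F -> k}).
Local Notation K := {fraction {mpoly k[3]}}.
Local Notation cst := (@cst k).
Local Notation X := (@P2gen k).
Local Notation q := #|F|.
Local Notation "x %:F" := (@FracField.tofrac _ x).

(* The argument iota only serves to know the characteristic of k. *)
Definition frobk of {rmorphism F -> k} := fun c : k => c ^+ q.

Lemma frobk_is_zmod_morphism : zmod_morphism (frobk iota).
Proof.
have [p p_pr pF] := finPcharP F.
have pk : p \in [pchar k] by rewrite (fmorph_pchar iota).
have qE : q = (p ^ logn p q)%N by exact: card_pprimeChar pF.
have qn : [pchar k].-nat q.
  by rewrite qE pnatX; apply/orP; left; rewrite (eq_pnat _ (pcharf_eq pk)) pnat_id.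
by move=> c d; apply/eqP; rewrite /frobk eq_sym subr_eq -exprDn_pchar // subrK.
Qed.

Lemma frobk_is_monoid_morphism : monoid_morphism (frobk iota).
Proof. by split=> [|c d]; rewrite /frobk ?expr1n ?exprMn. Qed.

HB.instance Definition _ :=
  GRing.isZmodMorphism.Build k k (frobk iota) frobk_is_zmod_morphism.
HB.instance Definition _ :=
  GRing.isMonoidMorphism.Build k k (frobk iota) frobk_is_monoid_morphism.

(** X^q - X is already the product of the factors X - a over F, so it has no further root in k. *)
Lemma frobk_fixed c : c ^+ q = c -> exists a, c = iota a.
Proof.
move=> cq; have := congr1 (fun p => (map_poly iota p).[c]) (finField_genPoly F).
rewrite rmorphB rmorphXn /= map_polyX hornerD hornerN hornerXn hornerX cq subrr.
rewrite rmorph_prod horner_prod => /esym/eqP/prodf_eq0[a _].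
rewrite rmorphB /= map_polyX map_polyC hornerXsubC subr_eq0 => /eqP ->.
by exists a.
Qed.

Lemma frobk_iota a : iota a ^+ q = iota a.
Proof. by rewrite -rmorphXn expf_card. Qed.

Definition frobm n : {mpoly k[n]} -> {mpoly k[n]} := map_mpoly (frobk iota).

Lemma frobm_coef n (A : {mpoly k[n]}) m : (frobm A)@_m = A@_m ^+ q.
Proof. exact: mcoeff_map_mpoly. Qed.

Lemma frobm_inj n : injective (@frobm n).
Proof.
move=> A B AB; apply/mpolyP => m; apply: (fmorph_inj (frobk iota)).
by have := congr1 (mcoeff m) AB; rewrite !frobm_coef.
Qed.

Lemma frobm0 n (A : {mpoly k[n]}) : (frobm A == 0) = (A == 0).
Proof. by rewrite -[RHS](inj_eq (@frobm_inj n)) /frobm rmorph0. Qed.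

Lemma frobmD n (A B : {mpoly k[n]}) : frobm (A + B) = frobm A + frobm B.
Proof. exact: (rmorphD (map_mpoly (frobk iota))). Qed.

Lemma frobmN n (A : {mpoly k[n]}) : frobm (- A) = - frobm A.
Proof. exact: (rmorphN (map_mpoly (frobk iota))). Qed.

Lemma frobmM n (A B : {mpoly k[n]}) : frobm (A * B) = frobm A * frobm B.
Proof. exact: (rmorphM (map_mpoly (frobk iota))). Qed.

Lemma frobm1 n : frobm 1 = 1 :> {mpoly k[n]}.
Proof. exact: (rmorph1 (map_mpoly (frobk iota))). Qed.

Lemma frobm_meval n (A : {mpoly k[n]}) (R : 'rV[k]_n) :
  (frobm A).@[(frob_pt F R) 0] = A.@[R 0] ^+ q.
Proof.
rewrite -[RHS]/(frobk iota _); elim/mpolyind: A => [|c m p _ _ IH].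
  by rewrite /frobm rmorph0 !meval0 rmorph0.
rewrite /frobm !rmorphD /= -!/(frobm _) IH; congr (_ + _).
rewrite /frobm map_mpolyZ map_mpolyX !mevalZ !mevalX rmorphM rmorph_prod /=.
by congr (_ * _); apply: eq_bigr => i _; rewrite mxE rmorphXn.
Qed.

Lemma frobm_map n (A : {mpoly F[n]}) : frobm (map_mpoly iota A) = map_mpoly iota A.
Proof. by apply/mpolyP => m; rewrite frobm_coef mcoeff_map_mpoly frobk_iota. Qed.

Local Notation phi := (@frob_fun F k).

Lemma frob_funE (N D : {mpoly k[3]}) : D != 0 ->
  phi (N%:F / D%:F) = (frobm N)%:F / (frobm D)%:F.
Proof.
move=> D0; rewrite /frob_fun; set f := N%:F / D%:F.
have := fracE f; set n := \n_ _; have : \d_(repr f) != 0 := denom_ratioP _.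
set d := \d_ _ => d0 fE; have ND : N * d = n * D.
  apply/eqP; rewrite -tofrac_eq !rmorphM /= -eqr_div ?tofrac_eq0 //.
  by apply/eqP; rewrite -fE.
rewrite -!/(frobm _); apply/eqP; rewrite eqr_div ?tofrac_eq0 ?frobm0 //.
rewrite -!rmorphM tofrac_eq; apply/eqP.
have := congr1 (map_mpoly (frobk iota)) ND; rewrite !rmorphM => E; exact: esym E.
Qed.

Lemma frob_fun_tofrac (A : {mpoly k[3]}) : phi A%:F = (frobm A)%:F.
Proof.
rewrite -[A%:F]divr1 -(rmorph1 (@FracField.tofrac {mpoly k[3]})).
by rewrite frob_funE ?oner_neq0 // frobm1 rmorph1 divr1.
Qed.

Lemma frob_fun_is_zmod_morphism : zmod_morphism phi.
Proof.
move=> f g; have [[N [D [D0 ->]]] [N' [D' [D'0 ->]]]] := (fracP f, fracP g).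
rewrite -mulNr -tofracN addf_div ?tofrac_eq0 // -!tofracM -tofracD.
rewrite !frob_funE ?mulf_neq0 // -[in RHS]mulNr -[in RHS]tofracN.
rewrite addf_div ?tofrac_eq0 ?frobm0 // -!tofracM -tofracD.
by rewrite frobmD !frobmM frobmN.
Qed.

Lemma frob_fun_is_monoid_morphism : monoid_morphism phi.
Proof.
split=> [|f g].
  by rewrite -(rmorph1 (@FracField.tofrac {mpoly k[3]})) frob_fun_tofrac frobm1.
have [[N [D [D0 ->]]] [N' [D' [D'0 ->]]]] := (fracP f, fracP g).
by rewrite mulf_div -!tofracM !frob_funE ?mulf_neq0 // mulf_div -!tofracM !frobmM.
Qed.

(* As for frobk, iota records that frob_fun is additive. *)
Definition frobK of {rmorphism F -> k} := phi.

HB.instance Definition _ :=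
  GRing.isZmodMorphism.Build K K (frobK iota) frob_fun_is_zmod_morphism.
HB.instance Definition _ :=
  GRing.isMonoidMorphism.Build K K (frobK iota) frob_fun_is_monoid_morphism.

Local Notation Phi := (frobK iota).

Lemma frobK_cst c : Phi (cst c) = cst (c ^+ q).
Proof. by rewrite /frobK frob_fun_tofrac /frobm map_mpolyC. Qed.

Lemma frobK_X i : Phi (X i) = X i.
Proof. by rewrite /frobK frob_fun_tofrac /frobm map_mpolyX. Qed.

Lemma frobK_lin (l : 'rV[k]_3) : Phi (lin l) = lin (frob_pt F l).
Proof.
rewrite /lin rmorph_sum; apply: eq_bigr => i _.
by rewrite rmorphM /= frobK_X frobK_cst mxE.
Qed.

Lemma frobK_fixed f : function_field iota X f -> Phi f = f.
Proof.
move=> [d [A [B [_ _ B0 ->]]]]; rewrite !geval_P2gen in B0 *.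
by rewrite rmorphM fmorphV /= /frobK !frob_fun_tofrac !frobm_map.
Qed.

Lemma frobK_lv R f c : lv X R f c -> lv X (frob_pt F R) (Phi f) (c ^+ q).
Proof.
move=> [d [A [B [hA hB B0 -> ->]]]]; exists d, (frobm A), (frobm B); split.
- exact: map_homog.
- exact: map_homog.
- by rewrite frobm_meval expf_neq0.
- by rewrite !geval_P2gen rmorphM fmorphV /= /frobK !frob_fun_tofrac.
- by rewrite !frobm_meval expr_div_n.
Qed.

Lemma frob_fixed_mpoly n (A : {mpoly k[n]}) : frobm A = A ->
  exists A0 : {mpoly F[n]}, A = map_mpoly iota A0.
Proof.
elim/mpolyind: A => [|c m p mp c0 IH] h; first by exists 0; rewrite rmorph0.
have hc m' : (c *: 'X_[m] + p)@_m' ^+ q = (c *: 'X_[m] + p)@_m'.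
  by rewrite -frobm_coef h.
have [a cE] : exists a, c = iota a.
  apply: frobk_fixed; have := hc m.
  by rewrite mcoeffD mcoeffZ mcoeffX eqxx mulr1 (memN_msupp_eq0 mp) addr0.
have [|A0 pE] := IH.
  apply/mpolyP => m'; rewrite frobm_coef; have := hc m'.
  rewrite mcoeffD mcoeffZ mcoeffX; have [<-|mm'] := eqVneq m m'.
    by rewrite (memN_msupp_eq0 mp) expr0n gtn_eqF //; apply: leq_trans (finNzRing_gt1 F).
  by rewrite mulr0 add0r.
exists (a *: 'X_[m] + A0).
by rewrite rmorphD /= map_mpolyZ map_mpolyX -cE -pE.
Qed.

Lemma frob_fixed_point n (R : 'rV[k]_n) : frob_pt F R = R ->
  exists R0 : 'rV[F]_n, R = map_mx iota R0.
Proof.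
move=> h; have fx i : exists a, R 0 i == iota a.
  have [|a ->] := @frobk_fixed (R 0 i); last by exists a.
  by have := congr1 (fun R' : 'rV_n => R' 0 i) h; rewrite mxE.
exists (\row_i xchoose (fx i)); apply/rowP => i; rewrite !mxE.
exact/eqP/(xchooseP (fx i)).
Qed.

Lemma frob_dot (l R : 'rV[k]_3) : dot (frob_pt F l) (frob_pt F R) = dot l R ^+ q.
Proof.
rewrite -[RHS]/(frobk iota _) /dot rmorph_sum; apply: eq_bigr => i _.
by rewrite !mxE rmorphM.
Qed.

Lemma frob_ptZ n c (R : 'rV[k]_n) : frob_pt F (c *: R) = (c ^+ q) *: frob_pt F R.
Proof. by apply/rowP => i; rewrite !mxE exprMn. Qed.

Lemma frob_ptD n (R S : 'rV[k]_n) : frob_pt F (R + S) = frob_pt F R + frob_pt F S.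
Proof. by apply/rowP => i; rewrite !mxE -[LHS]/(frobk iota _) rmorphD. Qed.

Lemma frob_map_mx n (R : 'rV[F]_n) : frob_pt F (map_mx iota R) = map_mx iota R.
Proof. by apply/rowP => i; rewrite !mxE frobk_iota. Qed.

End Frobenius.

(** * Zeros of cubics over a finite field *)

Section Counting.

Variable F : finFieldType.
Local Notation q := #|F|.

Lemma q_gt1 : (1 < q)%N. Proof. exact: finNzRing_gt1. Qed.

Lemma card_roots (p : {poly F}) n : p != 0 -> (size p <= n.+1)%N ->
  (#|[set x | root p x]| <= n)%N.
Proof.
move=> p0 sz; rewrite cardE -ltnS; apply: leq_trans sz.
apply: max_poly_roots => //; last exact: enum_uniq.
by apply/allP => x; rewrite mem_enum inE.
Qed.

Lemma card_quadratic (A B C : F) : A != 0 ->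
  (#|[set b | (A * b ^+ 2 + B * b + C == 0)%R]| <= 2)%N.
Proof.
move=> A0; have := @card_roots (Poly [:: C; B; A]) 2 _ (size_Poly _).
have -> : [set x | root (Poly [:: C; B; A]) x] = [set b | A * b ^+ 2 + B * b + C == 0].
  apply/setP => b; rewrite !inE /root horner_Poly /=; congr (_ == _); ring.
apply; apply: contra_neq A0 => P0.
by have := congr1 (fun p : {poly F} => p`_2) P0; rewrite coef_Poly coef0.
Qed.

Lemma card_linear (B C : F) : (B != 0) || (C != 0) ->
  (#|[set b | (B * b + C == 0)%R]| <= 1)%N.
Proof.
move=> BC; apply/card_le1_eqP => b b'; rewrite !inE => /eqP E /eqP E'.
have [B0|B0] := eqVneq B 0.
  by move: BC E; rewrite B0 eqxx mul0r add0r /= => /eqP.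
by apply: (mulfI B0); apply: (addIr C); rewrite E.
Qed.

Lemma card_fibers (S : {set F * F}) n (P : pred F) :
  (forall u, P u -> #|[set b | (u, b) \in S]| <= n)%N ->
  (forall u b, (u, b) \in S -> P u) -> (#|S| <= n * #|P|)%N.
Proof.
move=> Sn SP; have -> : #|S| = (\sum_u #|[set b | (u, b) \in S]|)%N.
  rewrite -sum1_card (eq_bigl (fun e => (e.1, e.2) \in S)) => [|[u b] //].
  rewrite -(pair_big_dep xpredT (fun u b => (u, b) \in S) (fun _ _ => 1%N)) /=.
  by apply: eq_bigr => u _; rewrite -sum1_card; apply: eq_bigl => b; rewrite inE.
rewrite mulnC -sum_nat_const big_mkcond [X in (_ <= X)%N]big_mkcond /=.
apply: leq_sum => u _; case: (boolP (u \in P)) => [/Sn //|nP].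
rewrite leqn0 cards_eq0; apply/eqP/setP => b; rewrite !inE.
by apply/negbTE; apply: contraNN nP => /SP.
Qed.

Section Conic.

Variables n1 n2 n3 : F.
Definition qform (a b : F) := n1 * a ^+ 2 + n2 * (a * b) + n3 * b ^+ 2.
Hypothesis anis : forall a b, qform a b = 0 -> a = 0 /\ b = 0.

Lemma qform_r1 m : qform m 1 != 0.
Proof. by apply/eqP => /anis[_ /eqP]; rewrite oner_eq0. Qed.

Lemma qform_10 : qform 1 0 != 0.
Proof. by apply/eqP => /anis[/eqP]; rewrite oner_eq0. Qed.

(* Project a conic without rational line from one of its points, sending that
   point to its tangent direction. *)
Lemma card_conic r s t u : r != 0 ->
  (#|[set e : (F * F)%type | (r * qform e.1 e.2 + s * e.1 + t * e.2 + u == 0)%R]| <= q.+1)%N.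
Proof.
move=> r0; set S := [set _ | _]; have [->|[[a0 b0] e0S]] := set_0Vmem S.
  by rewrite cards0.
have E0 : r * qform a0 b0 + s * a0 + t * b0 + u = 0 by move: e0S; rewrite inE => /eqP.
(* [P] and [Q] are the partial derivatives at (a0, b0). They annihilate the tangent direction, so by
   [line] and anisotropy a second point on the tangent is impossible. *)
pose P := r * (n1 * a0 *+ 2 + n2 * b0) + s.
pose Q := r * (n2 * a0 + n3 * b0 *+ 2) + t.
have line da db v : (a0 + v * da, b0 + v * db) \in S -> v != 0 ->
    r * v * qform da db = - (P * da + Q * db).
  rewrite inE /= => /eqP E v0; apply/eqP; rewrite -addr_eq0; apply/eqP.
  apply: (mulfI v0); rewrite mulr0 -[RHS](subrr 0) -{1}E -{1}E0 /P /Q /qform.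
  by ring.
pose tang : option F := if P == 0 then None else Some (- Q / P).
pose f (e : F * F) : option F := if e == (a0, b0) then tang else
  if e.2 == b0 then None else Some ((e.1 - a0) / (e.2 - b0)).
pose dir (o : option F) : F * F := if o is Some m then (m, 1) else (1, 0).
have dirN o : qform (dir o).1 (dir o).2 != 0.
  by case: o => [m|]; [apply: qform_r1 | apply: qform_10].
have dirP e : e \in S -> e != (a0, b0) -> exists v,
    [/\ v != 0, e = (a0 + v * (dir (f e)).1, b0 + v * (dir (f e)).2) &
     r * v * qform (dir (f e)).1 (dir (f e)).2 = - (P * (dir (f e)).1 + Q * (dir (f e)).2)].
  case: e => a b eS en; suff [v [v0 eE]] : exists v, v != 0 /\
      (a, b) = (a0 + v * (dir (f (a, b))).1, b0 + v * (dir (f (a, b))).2).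
    by exists v; split=> //; apply: line => //; rewrite -eE.
  rewrite /f (negPf en) /=; have [bb|bb] := eqVneq b b0.
    exists (a - a0); rewrite subr_eq0 bb /=; split.
      by apply: contra_neq en => ->; rewrite bb.
    by rewrite mulr1 mulr0 addr0 addrC subrK.
  have b0' : b - b0 != 0 by rewrite subr_eq0.
  exists (b - b0); split=> //=; rewrite mulr1 mulrC divfK //.
  by congr (_, _); ring.
have tangP : P * (dir tang).1 + Q * (dir tang).2 = 0.
  rewrite /tang; have [->|P0] := eqVneq P 0; rewrite /= ?mul0r ?mulr0 ?addr0 //.
  by field.
have ftang e : e \in S -> e != (a0, b0) -> f e != tang.
  move=> eS /(dirP _ eS)[v [v0 _ E]]; apply: contra_eq_neq E => ->.
  by rewrite tangP oppr0 !mulf_neq0 //.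
rewrite -card_option -(card_in_imset (f := f)) ?max_card // => e e' eS e'S fe.
have [E|en] := eqVneq e (a0, b0); have [E'|en'] := eqVneq e' (a0, b0).
- by rewrite E E'.
- by have := ftang _ e'S en'; rewrite -fe E /f eqxx eqxx.
- by have := ftang _ eS en; rewrite fe E' /f eqxx eqxx.
have [v [v0 eE E1]] := dirP _ eS en; have [v' [v'0 eE' E2]] := dirP _ e'S en'.
rewrite fe in eE E1; have nz := dirN (f e').
have vv : v = v' by apply: (mulfI r0); apply: (mulIf nz); rewrite E1 E2.
by rewrite eE [RHS]eE' vv.
Qed.

Definition cubic (l m : F * F * F) (a b c : F) : F :=
  qform a b * (l.1.1 * a + l.1.2 * b + l.2 * c) +
  c ^+ 2 * (m.1.1 * a + m.1.2 * b + m.2 * c).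

Definition affzero l m : {set F * F} := [set e : F * F | cubic l m e.1 e.2 1 == 0].

(** Cut the plane by the lines u = v, where u is the linear form l at c = 1. For v nonzero the cubic
    is quadratic in b with leading coefficient v n(-l2/l1, 1), nonzero by anisotropy: at most two
    zeros. On u = 0 only the form m remains, with at most one zero unless it is a multiple of u. In
    that case the cubic is u times a conic and has at most q + (q + 1) zeros. *)
Lemma card_affine_lt (l m : F * F * F) : l.1.1 != 0 ->
  (#|affzero l m| <= q.*2.+1)%N.
Proof.
case: l m => [[l1 l2] l3] [[m1 m2] m3] /= l10.
set S := affzero _ _; pose u (e : F * F) := l1 * e.1 + l2 * e.2 + l3.
pose S0 := [set e in S | u e == 0]; pose S1 := [set e in S | u e != 0].
have SE : (#|S| = #|S0| + #|S1|)%N.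
  by rewrite -(cardsID [set e | u e == 0] S); congr (_ + _)%N;
     apply: eq_card => e; rewrite !inE // andbC.
pose h (e : F * F) := (u e, e.2).
have h_inj : injective h.
  move=> [a b] [a' b'] [ue /= be]; rewrite /u /= be in ue *.
  by congr (_, _); apply: (mulfI l10); move: ue => /addIr/addIr.
pose g v b := (v - l2 * b - l3) / l1.
have gu v b : u (g v b, b) = v by rewrite /u /g /=; field.
have gh e v b : h e = (v, b) -> e = (g v b, b).
  by case: e => a b' [<- /= <-]; rewrite /g /u /=; congr (_, _); field.
have qg v b : cubic (l1, l2, l3) (m1, m2, m3) (g v b) b 1 =
    qform (g v b) b * v + (m1 * g v b + m2 * b + m3).
  by rewrite /cubic /= expr1n mul1r !mulr1; have := gu v b; rewrite /u /= => ->.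
have S0E : #|S0| = #|[set b | (m2 - m1 * l2 / l1) * b + (m3 - m1 * l3 / l1) == 0]|.
  rewrite -(card_imset _ h_inj) -(card_imset _ (f := fun b : F => (0 : F, b))).
    apply: eq_card => -[v b]; apply/imsetP/imsetP => [[e eS0 E]|[b' bS [-> ->]]].
      have vE : v = 0 by move: eS0 E; rewrite inE => /andP[_ /eqP ue] [-> _].
      have eE := gh _ _ _ (esym E); exists b; last by rewrite vE.
      move: eS0; rewrite !inE eE /= qg vE mulr0 add0r => /andP[/eqP h0 _].
      by apply/eqP; rewrite -[RHS]h0 /g; field.
    exists (g 0 b', b'); last by rewrite /h gu.
    rewrite !inE gu eqxx andbT /= qg mulr0 add0r; move: bS; rewrite inE => /eqP h0.
    by apply/eqP; rewrite -[RHS]h0 /g; field.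
  by move=> b b' [].
have S1E : (#|S1| <= 2 * q.-1)%N.
  rewrite -(card_imset _ h_inj) -(cardC1 (0 : F)).
  apply: card_fibers => [v v0|v b /imsetP[e]]; last first.
    by rewrite inE => /andP[_ ue] [-> _].
  pose A := v * qform (- l2 / l1) 1.
  have A0 : A != 0 by rewrite mulf_neq0 // qform_r1.
  pose d := (v - l3) / l1.
  pose B := v * (n1 * d * (- l2 / l1) *+ 2 + n2 * d) + m1 * (- l2 / l1) + m2.
  pose C := v * (n1 * d ^+ 2) + m1 * d + m3.
  apply: leq_trans (card_quadratic B C A0); apply: subset_leq_card.
  apply/subsetP => b; rewrite !inE => /imsetP[e eS1 E].
  have eE := gh _ _ _ (esym E); move: eS1; rewrite !inE eE /= qg => /andP[/eqP h0 _].
  by apply/eqP; rewrite -[RHS]h0 /A /B /C /d /g /qform; field.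
have [BC|] := boolP ((m2 - m1 * l2 / l1 != 0) || (m3 - m1 * l3 / l1 != 0)).
  by rewrite SE S0E; apply: leq_trans (leq_add (card_linear BC) S1E) _; rewrite add1n ltnS -mul2n leq_mul2l leq_pred orbT.
rewrite negb_or !negbK => /andP[/eqP m2E /eqP m3E].

have S1T : (#|S1| <= q.+1)%N.
  apply: leq_trans (card_conic 0 0 (m1 / l1) (oner_neq0 F)); apply: subset_leq_card.
  apply/subsetP => -[a b]; rewrite !inE /= => /andP[/eqP E ue].
  apply/eqP; apply: (mulIf ue); rewrite [RHS]mul0r -[RHS]E /cubic /u /=.
  have -> : m2 = m1 * l2 / l1 by apply/eqP; rewrite -subr_eq0; apply/eqP.
  have -> : m3 = m1 * l3 / l1 by apply/eqP; rewrite -subr_eq0; apply/eqP.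
  by field.
have S0q : (#|S0| <= q)%N by rewrite S0E max_card.
by rewrite SE; apply: leq_trans (leq_add S0q S1T) _; rewrite addnS addnn.
Qed.

(** At c = 1 the cubic is a conic with quadratic part l3 n, handled by [card_conic]; if l3 = 0, an
    affine line or a nonzero constant is left. *)
Lemma card_affine_0 (l m : F * F * F) : l.1 = (0, 0) -> (l, m) != (0, 0, 0, (0, 0, 0)) ->
  (#|affzero l m| <= q.+1)%N.
Proof.
case: l m => [[l1 l2] l3] [[m1 m2] m3] /= [-> ->] lm.
have SE : affzero (0, 0, l3) (m1, m2, m3) =
    [set e : F * F | l3 * qform e.1 e.2 + m1 * e.1 + m2 * e.2 + m3 == 0].
  by apply/setP => e; rewrite !inE /cubic /=; congr (_ == _); ring.
rewrite SE; have [l30|l30] := eqVneq l3 0; last exact: card_conic.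
set S := [set _ | _]; rewrite l30 in lm.
have [m20|m20] := eqVneq m2 0; last first.
  rewrite leqW // -[X in (_ <= X)%N]mul1n; apply: (card_fibers (P := predT)) => // a _.
  have := @card_linear m2 (m1 * a + m3); rewrite m20 => /(_ isT); apply: leq_trans.
  apply: subset_leq_card; apply/subsetP => b; rewrite !inE /= l30 => /eqP <-.
  by apply/eqP; ring.
have [m10|m10] := eqVneq m1 0.
  have -> : S = set0; last by rewrite cards0.
  apply/setP => e; rewrite !inE l30 m10 m20 !mul0r !add0r; apply/negbTE.
  by apply: contraNneq lm => ->; rewrite m10 m20.
rewrite leqW //; pose w (e : F * F) := e.2.
rewrite -(card_in_imset (f := w)) ?max_card // => -[a b] [a' b'].
rewrite !inE /= l30 m20 => /eqP E /eqP E' /= bb; rewrite bb in E *.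
by congr (_, _); apply: (mulfI m10); apply: (addIr m3); move: E E'; rewrite !mul0r !add0r !addr0 => -> ->.
Qed.

End Conic.

Lemma qform_swap n1 n2 n3 a b : qform n3 n2 n1 b a = qform n1 n2 n3 a b.
Proof. by rewrite /qform; ring. Qed.

Section Cone.

Variables n1 n2 n3 : F.
Hypothesis anis : forall a b, qform n1 n2 n3 a b = 0 -> a = 0 /\ b = 0.

Lemma card_affine (l m : F * F * F) : l.1 != (0, 0) ->
  (#|affzero n1 n2 n3 l m| <= q.*2.+1)%N.
Proof.
move=> l0; have [l10|l10] := eqVneq l.1.1 0; last exact: card_affine_lt.
have l20 : l.1.2 != 0 by apply: contra_neq l0 => l20; rewrite [l.1]surjective_pairing l10 l20.
have anis' a b : qform n3 n2 n1 a b = 0 -> a = 0 /\ b = 0.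
  by rewrite qform_swap => /anis[].
have := card_affine_lt anis' (l := (l.1.2, l.1.1, l.2)) (m.1.2, m.1.1, m.2) l20.
apply: leq_trans; rewrite -(card_imset _ (f := fun e : F * F => (e.2, e.1))); last first.
  by move=> [a b] [a' b'] [-> ->].
apply: subset_leq_card; apply/subsetP => _ /imsetP[[a b] + ->].
rewrite !inE /cubic /= qform_swap => /eqP <-; apply/eqP.
by congr (_ * _ + _ * _); ring.
Qed.

(** Nonzero vectors are counted instead of projective points; every point accounts for q - 1 of
    them. *)
Definition cone l m : {set F * F * F} :=
  [set e : F * F * F | (e != (0, 0, 0)) && (cubic n1 n2 n3 l m e.1.1 e.1.2 e.2 == 0)].

(** If l is a multiple of c, the q + 1 points with c = 0 are all zeros and at most q + 1 others come
    from a conic. Otherwise, as n has no zero, a zero with c = 0 must be a zero of l, which leaves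
    one point besides the 2 q + 1 affine ones. *)
Lemma card_cone (l m : F * F * F) : (l, m) != (0, 0, 0, (0, 0, 0)) ->
  (#|cone l m| <= (q.*2.+2) * q.-1)%N.
Proof.
move=> lm; pose C0 := [set e in cone l m | e.2 == 0].
pose C1 := [set e in cone l m | e.2 != 0].
have CE : (#|cone l m| = #|C0| + #|C1|)%N.
  by rewrite -(cardsID [set e : F * F * F | e.2 == 0] (cone l m)); congr (_ + _)%N;
     apply: eq_card => e; rewrite !inE // andbC.
have C1E : (#|C1| <= #|affzero n1 n2 n3 l m| * q.-1)%N.
  rewrite -(cardC1 (0 : F)) -cardX.
  pose f (e : F * F * F) := ((e.1.1 / e.2, e.1.2 / e.2), e.2).
  rewrite -(card_in_imset (f := f)) => [|[[a b] c] [[a' b'] c']]; last first.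
    rewrite !inE /= => /andP[_ c0] _ [/= + + cc]; rewrite -cc.
    by move=> /(mulIf (invr_neq0 c0)) -> /(mulIf (invr_neq0 c0)) ->.
  apply: subset_leq_card; apply/subsetP => _ /imsetP[[[a b] c] + ->].
  rewrite !inE /= => /andP[/andP[_ /eqP E] c0]; rewrite c0 andbT.
  apply/eqP; apply: (mulfI (expf_neq0 3 c0)); rewrite mulr0 -E /cubic /qform.
  by field.
have [l0|l0] := eqVneq l.1 (0, 0).
  have C0E : (#|C0| <= q * q - 1)%N.
    have -> : (q * q - 1 = #|predC1 ((0%R, 0%R) : (F * F)%type)|)%N by rewrite cardC1 card_prod subn1.
    rewrite -(card_in_imset (f := fun e : F * F * F => e.1)) => [|[[a b] c] [[a' b'] c']]; last first.
      by rewrite !inE /= => /andP[_ /eqP->] /andP[_ /eqP->] [-> ->].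
    apply: subset_leq_card; apply/subsetP => _ /imsetP[[[a b] c] + ->].
    rewrite !inE /= => /andP[/andP[n0 _] /eqP c0]; rewrite c0 in n0.
    by apply: contra_neq n0 => -[-> ->].
  have := card_affine_0 anis l0 lm; rewrite CE => A.
  have : (#|C1| <= q.+1 * q.-1)%N by apply: leq_trans C1E _; rewrite leq_mul2r A orbT.
  by move: C0E; nia.
have C0E : (#|C0| <= q.-1)%N.
  rewrite -(cardC1 (0 : F)).
  pose f (e : F * F * F) := if l.1.1 == 0 then e.1.1 else e.1.2.
  have C0P e : e \in C0 -> [/\ e.2 = 0, e.1 != (0, 0) & l.1.1 * e.1.1 + l.1.2 * e.1.2 = 0].
    case: e => [[a b] c]; rewrite !inE /= => /andP[/andP[n0 /eqP E] /eqP c0].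
    rewrite c0 in n0 E *; have n0' : (a, b) != (0, 0) by apply: contra_neq n0 => -[-> ->].
    split=> //; move: E; rewrite /cubic expr0n /= mul0r addr0 mulr0 addr0 => /eqP.
    rewrite mulf_eq0 => /orP[/eqP/anis[a0 b0]|/eqP //].
    by rewrite a0 b0 eqxx in n0'.
  have l1l2 : l.1.1 = 0 -> l.1.2 != 0.
    by move=> l10; apply: contra_neq l0 => l20; rewrite [l.1]surjective_pairing l10 l20.
  rewrite -(card_in_imset (f := f)) => [|[[a b] c] [[a' b'] c'] /C0P[/= -> _ E] /C0P[/= -> _ E']]; last first.
    rewrite /f /=; have [l10|l10] := eqVneq l.1.1 0 => ee; rewrite ee in E *.
      congr (_, _, _); apply: (mulfI (l1l2 l10)); move: E E'.
      by rewrite l10 !mul0r !add0r => -> ->.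
    by congr (_, _, _); apply: (mulfI l10); apply: (addIr (l.1.2 * b')); rewrite E E'.
  apply: subset_leq_card; apply/subsetP => _ /imsetP[[[a b] c] /C0P[/= _ n0 E] ->].
  rewrite !inE /f /=; have [l10|l10] := eqVneq l.1.1 0; apply: contra_neq n0 => z0; rewrite z0 in E *.
    move: E; rewrite mulr0 add0r => /eqP; rewrite mulf_eq0 (negPf (l1l2 l10)) => /eqP ->.
    by [].
  by move: E; rewrite mulr0 addr0 => /eqP; rewrite mulf_eq0 (negPf l10) => /eqP ->.
have A := card_affine m l0; rewrite CE.
have : (#|C1| <= q.*2.+1 * q.-1)%N by apply: leq_trans C1E _; rewrite leq_mul2r A orbT.
by move: C0E; nia.
Qed.

(* The cubic c (n(a, b) - b c), a line and a disjoint conic. *)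
Lemma card_cone_max :
  (q.*2.+2 * q.-1 <= #|cone (0%R, 0%R, 1%R) (0%R, (-1)%R, 0%R)|)%N.
Proof.
set C := cone _ _.
pose C0 := [set e in C | e.2 == 0]; pose C1 := [set e in C | e.2 != 0].
have CE : (#|C| = #|C0| + #|C1|)%N.
  by rewrite -(cardsID [set e : F * F * F | e.2 == 0] C); congr (_ + _)%N;
     apply: eq_card => e; rewrite !inE // andbC.
have C0E : (q * q - 1 <= #|C0|)%N.
  have -> : (q * q - 1 = #|predC1 ((0%R, 0%R) : (F * F)%type)|)%N by rewrite cardC1 card_prod subn1.
  rewrite -(card_imset _ (f := fun e : F * F => (e, 0 : F))); last by move=> e e' [].
  apply: subset_leq_card; apply/subsetP => _ /imsetP[[a b] + ->].
  rewrite !inE /= /cubic /= => n0; rewrite eqxx andbT; apply/andP; split.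
    by apply: contra_neq n0 => -[-> ->].
  by apply/eqP; ring.
have C1E : (q.+1 * q.-1 <= #|C1|)%N.
  rewrite -(cardC1 (0 : F)) -card_option -cardX.
  (* For c nonzero the conic n(a, b) = b c is parametrized by x = a/b, which gives b = c / n(x, 1);
     [None] stands for the point a = b = 0. *)
  pose f (e : option F * F) : F * F * F := if e.1 is Some x then
    (x * (e.2 / qform n1 n2 n3 x 1), e.2 / qform n1 n2 n3 x 1, e.2) else (0, 0, e.2).
  have nz x := qform_r1 anis x.
  rewrite -(card_in_imset (f := f)) => [|[[x|] c] [[x'|] c']]; rewrite ?inE /=.
  - apply: subset_leq_card; apply/subsetP => _ /imsetP[[o c] + ->].
    rewrite !inE /= => c0; have -> : (f (o, c)).2 = c by case: o.
    rewrite c0 andbT; apply/andP; split.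
      by apply: contra_neq c0 => /(congr1 snd); case: o.
    case: o => [x|]; rewrite /f /cubic /=; apply/eqP; last by rewrite /qform; ring.
    have := nz x; rewrite /qform => nx; field.
    by move: nx; rewrite expr1n !mulr1.
  - move=> c0 _ [E1 E2 cc]; rewrite -E2 in E1.
    have n0 : c / qform n1 n2 n3 x 1 != 0 by rewrite mulf_neq0 // invr_eq0.
    by rewrite (mulIf n0 E1) cc.
  - by move=> c0 _ [_ /eqP]; rewrite mulf_eq0 invr_eq0 (negPf c0) (negPf (nz x)).
  - by move=> _ c0 [_ /eqP + _]; rewrite eq_sym mulf_eq0 invr_eq0 (negPf c0) (negPf (nz x')).
  - by move=> _ _ [->].
by rewrite CE; move: C0E C1E; nia.
Qed.

End Cone.

End Counting.

(** * The anticanonical model *)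

Section ModelIdentities.

Variable K : fieldType.
Implicit Types (a b x y z G u v : K).

Lemma cancel_id G u v : G != 0 -> (G * u) / (G * v) = u / v.
Proof. by move=> G0; rewrite -mulf_div divff // mul1r. Qed.

Lemma cancel_id' G n z u : G != 0 -> u != 0 -> (G * n * u) / (G * z * u) = n / z.
Proof. by move=> G0 u0; rewrite -(mulrA G n) -(mulrA G z) cancel_id // -mulf_div divff // mulr1. Qed.

Lemma NZ_side x y z : x != 0 -> z != 0 -> (x * y) / z ^+ 2 = y / x / (z / x) / (z / x).
Proof. by move=> *; field; apply/andP. Qed.

Lemma ZN_side x y z : x != 0 -> y != 0 -> z != 0 ->
  z ^+ 2 / (x * y) = z / x / (y / x / (z / x)).
Proof. by move=> *; field; do ?(apply/andP; split). Qed.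

Lemma ct_id a b : a != 0 -> b != 0 -> a / (b / a) * (b / a) = a.
Proof. by move=> *; field; apply/andP. Qed.

Lemma ct2_id a b : a != 0 -> b != 0 -> a / (b / a) * (b / a) ^+ 2 = b.
Proof. by move=> *; field; apply/andP. Qed.

Lemma cancel_idr a b u : u != 0 -> (a * u) / (b * u) = a / b.
Proof. by move=> u0; rewrite -mulf_div divff // mulr1. Qed.

End ModelIdentities.

Section RationalClosure.

Variables (k : closedFieldType) (K : fieldType) (cst : {rmorphism k -> K}).

(** A relation that ignores values: applying [place_ev] to it shows that polynomials in rational
    functions are rational. *)
Lemma rational_preplace a b : indep cst a b ->
  preplace cst (fun f _ => rational cst a b f).
Proof.
move=> ab; split.
- by move=> c; rewrite -(ev1C cst a) -(evC cst a b); apply: rational_ev.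
- move=> f g _ _ [A [B [B0 ->]]] [A' [B' [B'0 ->]]].
  exists (A * B' + A' * B), (B * B'); rewrite mulf_neq0 //; split=> //.
  by rewrite addf_div ?indep_neq0 // !(rmorphD, rmorphM).
- by move=> f g _ _; apply: rationalM.
- by move=> f _ hf _; apply: rationalV.
Qed.

Lemma rational_l (a b : K) : rational cst a b a.
Proof. by have := rational_ev cst a b 'X%:P; rewrite evC ev1X. Qed.

Lemma rational_r (a b : K) : rational cst a b b.
Proof. by have := rational_ev cst a b 'X; rewrite evX. Qed.

Lemma rational_trans a b c d f : indep cst a b -> rational cst c d f ->
  rational cst a b c -> rational cst a b d -> rational cst a b f.
Proof.
move=> ab [A [B [_ ->]]] rc rd; have h := rational_preplace ab.
have E P := @place_ev k K cst _ c d 0 0 P h rc rd.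
exact: rationalM (E A) (rationalV (E B)).
Qed.

End RationalClosure.

Section Model.

Variable k : closedFieldType.
Local Notation K := {fraction {mpoly k[3]}}.
Local Notation cst := (@cst k).
Local Notation X := (@P2gen k).
Local Notation chart := (chart cst).
Local Notation subring := (K -> Prop).

Lemma local_valueE (O : subring) V f c : place cst V ->
  (forall f, O f <-> ring_of V f) -> local_value O f c <-> V f c.
Proof.
move=> hV OV; have h := hV.1; split=> [[_ /(maxid_of _ hV OV) V0]|Vf].
  by have := placeD h V0 (placeC h c); rewrite subrK add0r.
split; first by apply/OV; exists c.
apply/(maxid_of _ hV OV).
by have := placeB h Vf (placeC h c); rewrite subrr.
Qed.

Section Linear.

Variables (n : nat) (s : 'I_n -> K).

Definition comb (c : 'I_n -> k) : K := \sum_j cst (c j) * s j.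

Lemma lv_comb (P : 'rV[k]_n) c d : \sum_j d j * P 0 j != 0 ->
  lv s P (comb c / comb d) ((\sum_j c j * P 0 j) / (\sum_j d j * P 0 j)).
Proof.
pose p (c : 'I_n -> k) : {mpoly k[n]} := \sum_j c j *: 'X_j.
have ph c' : p c' \is 1.-homog.
  by apply: rpred_sum => i _; apply: rpredZ; rewrite dhomogX /= mdeg1.
have pe c' : (p c').@[P 0] = \sum_j c' j * P 0 j.
  rewrite /p /meval raddf_sum; apply: eq_bigr => i _.
  by rewrite -[LHS]/((c' i *: 'X_i).@[P 0]) mevalZ mevalXU.
have pg c' : geval s (p c') = comb c'.
  rewrite /p /geval raddf_sum /=; apply: eq_bigr => i _.
  by rewrite -[LHS]/(geval _ _) gevalZ gevalX.
by move=> d0; exists 1%N, (p c), (p d); rewrite !ph !pg !pe.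
Qed.

Lemma place_comb V (P : 'rV[k]_n) w c : preplace cst V ->
  (forall i, V (s i / w) (P 0 i)) -> V (comb c / w) (\sum_j c j * P 0 j).
Proof.
move=> h Vs; have -> : comb c / w = \sum_j cst (c j) * (s j / w).
  by rewrite /comb mulr_suml; apply: eq_bigr => j _; rewrite -mulrA.
by apply: (place_sum _ h) => j; exact: (placeM h (placeC h _) (Vs j)).
Qed.

End Linear.

Variables (lx ly lz ex ey ez : 'rV[k]_3) (O1 O3 O2 O4 : subring) (g : K).
Hypothesis fr : frame lx lz ly ex ez ey.
Hypotheses (O1E : forall f, O1 f <-> ring_of (lv X ex) f)
           (O3E : forall f, O3 f <-> ring_of (lv X ey) f)
           (O2E : kind2 lx ly lz O2 0) (O4E : kind2 ly lx lz O4 0).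
Hypothesis g0 : g != 0.
Let N := lin lx * lin ly.
Let Z := lin lz.
Let G := g / X 0 ^+ 3.

Variables (n : nat) (s : 'I_n -> K) (al be : 'I_n -> 'rV[k]_3).
Hypothesis sE : forall i, s i = sec g N Z (al i) (be i).
Hypothesis spanN : forall i, exists c, G * N * X i = comb s c.
Hypothesis spanZ : forall i, exists c, G * Z ^+ 2 * X i = comb s c.

Definition image (R : 'rV[k]_3) (tau kappa : k) : 'rV[k]_n :=
  \row_i (tau * dot (al i) R + kappa * dot (be i) R).

Section NicePoint.

Variables (O : subring) (V : K -> k -> Prop) (R : 'rV[k]_3) (tau kappa : k) (w : K).
Hypothesis nO : nice g N Z O V R tau kappa w.

Lemma nice_image i : V (s i / w) (image R tau kappa 0 i).
Proof. by rewrite mxE sE; exact: nice_sec nO. Qed.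

Lemma nice_comb_val c u v : u = comb s c -> V (u / w) v ->
  \sum_j c j * image R tau kappa 0 j = v.
Proof.
move=> -> Vu; have hV := nice_place nO.
exact: place_uniq hV (place_comb c hV.1 nice_image) Vu.
Qed.

(** All G N X_i and G Z^2 X_i are combinations of the s_i, so their values tau R_i and kappa R_i
    would vanish with the image. This is the base point freeness of -K_X. *)
Lemma image_neq0 : image R tau kappa != 0.
Proof.
apply/negP => /eqP im0; have /rV0Pn[i Ri] := nice_R nO.
have z c : \sum_j c j * image R tau kappa 0 j = 0.
  by rewrite big1 // => j _; rewrite im0 mxE mulr0.
have [[c cE] [d dE]] := (spanN i, spanZ i).
have tR := nice_comb_val cE (nice_N nO i); have kR := nice_comb_val dE (nice_Z nO i).
rewrite z in tR; rewrite z in kR; case: (nice_tk nO) => [t0|k0].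
  by move/esym/eqP: tR; rewrite mulf_eq0 (negPf t0) (negPf Ri).
by move/esym/eqP: kR; rewrite mulf_eq0 (negPf k0) (negPf Ri).
Qed.

(** Changing the local equation of K_X by a unit divides all coordinates by the value of that unit;
    constants show that every nonzero factor occurs. *)
Lemma anticanonical_mapE P : anticanonical_map g s O P <->
  exists2 c, c != 0 & P = c *: image R tau kappa.
Proof.
have hV := nice_place nO; have OV := nice_ring nO.
split=> [[P0 [w' can sP]]|[c c0 ->]].
  have [e [c [Ve c0 w'E]]] := nice_canon nO can.
  exists c^-1; first by rewrite invr_eq0.
  apply/rowP => i; rewrite mxE.
  have /(local_valueE _ _ hV OV) V1 := sP i.
  apply: (place_uniq hV V1); rewrite w'E mulrC.
  have -> : (e * w)^-1 * s i = e^-1 * (s i / w) by rewrite invfM -mulrA [w^-1 * _]mulrC.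
  exact: (placeM hV.1 (placeV hV.1 Ve c0) (nice_image i)).
split; first by rewrite scaler_eq0 negb_or c0 image_neq0.
exists (cst c^-1 * w); first by apply: (nice_exists nO); rewrite invr_eq0.
move=> i; apply/(local_valueE _ _ hV OV); rewrite mxE.
have -> : s i / (cst c^-1 * w) = cst c * (s i / w).
  by rewrite fmorphV -inv_scale.
exact: (placeM hV.1 (placeC hV.1 c) (nice_image i)).
Qed.

Lemma im_val c0 P i : P = c0 *: image R tau kappa -> V (s i / (cst c0^-1 * w)) (P 0 i).
Proof.
move=> ->; have hV := nice_place nO; rewrite mxE fmorphV -inv_scale.
exact: (placeM hV.1 (placeC hV.1 c0) (nice_image i)).
Qed.

Lemma model_sub c P : c != 0 -> P = c *: image R tau kappa -> dominates (lv s P) V.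
Proof.
move=> c0 PE; have hV := nice_place nO.
apply: (lv_sub hV.1 (w := cst c^-1 * w)) => [|i]; last exact: im_val.
by apply: mulf_neq0 (nice_w nO); rewrite fmorph_eq0 invr_eq0.
Qed.

Lemma model_place c P : c != 0 -> P = c *: image R tau kappa -> place cst (lv s P).
Proof.
move=> c0 PE; apply: lv_place => d B hB B0; have hV := nice_place nO.
apply: (geval_neq0 (w := cst c^-1 * w) hV _ _ hB B0) => [|i]; last exact: im_val.
by apply: mulf_neq0 (nice_w nO); rewrite fmorph_eq0 invr_eq0.
Qed.

Lemma model_ratio c0 P u v cu cv : c0 != 0 -> P = c0 *: image R tau kappa ->
  (exists c, u = comb s c) -> (exists c, v = comb s c) ->
  V (u / w) cu -> V (v / w) cv -> cv != 0 -> lv s P (u / v) (cu / cv).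
Proof.
move=> c00 PE [c uE] [d vE] Vu Vv cv0.
have cE := nice_comb_val uE Vu; have dE := nice_comb_val vE Vv.
have scl c' : \sum_j c' j * P 0 j = c0 * \sum_j c' j * image R tau kappa 0 j.
  by rewrite mulr_sumr; apply: eq_bigr => j _; rewrite PE mxE mulrCA.
have := @lv_comb n s P c d; rewrite !scl cE dE -uE -vE -mulf_div divff // mul1r.
by apply; rewrite mulf_neq0.
Qed.

Let G0 : G != 0. Proof. exact: mulf_neq0 g0 (invr_neq0 (expf_neq0 3 (X_neq0 k 0))). Qed.
Let x0 : lin lx != 0. Proof. exact: frame_neq0 fr. Qed.
Let y0 : lin ly != 0. Proof. exact: frame_neq0 (fr_swap fr). Qed.
Let z0 : Z != 0. Proof. exact: frame_neq0 (fr_z fr). Qed.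

(** X_i / X_j is a quotient of the sections G N X_i and G N X_j, and also of those with Z^2. For
    suitable j one of the two denominators is nonzero at the point, so the projection to the plane
    is defined on the model. *)
Lemma model_P2 c P : c != 0 -> P = c *: image R tau kappa -> dominates (lv X R) (lv s P).
Proof.
move=> c0 PE f v; have hT := model_place c0 PE.
have /rV0Pn[j Rj] := nice_R nO; have Rj' : (R 0 j)^-1 != 0 by rewrite invr_eq0.
move=> /(lv_scaleE R f v Rj'); apply: (lv_sub hT.1 (X_neq0 k j)) => i.
rewrite mxE [(R 0 j)^-1 * _]mulrC; have N0 : N != 0 := mulf_neq0 x0 y0.
case: (nice_tk nO) => t0.
  have := model_ratio c0 PE (spanN i) (spanN j) (nice_N nO i) (nice_N nO j).
  rewrite (cancel_id _ _ (mulf_neq0 G0 N0)) (cancel_id _ _ t0); apply.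
  exact: mulf_neq0.
have := model_ratio c0 PE (spanZ i) (spanZ j) (nice_Z nO i) (nice_Z nO j).
rewrite (cancel_id _ _ (mulf_neq0 G0 (expf_neq0 2 z0))) (cancel_id _ _ t0); apply.
exact: mulf_neq0.
Qed.

Lemma model_NZ c P : c != 0 -> P = c *: image R tau kappa -> kappa != 0 ->
  lv s P (N / Z ^+ 2) (tau / kappa).
Proof.
move=> c0 PE k0; have /rV0Pn[j Rj] := nice_R nO.
have := model_ratio c0 PE (spanN j) (spanZ j) (nice_N nO j) (nice_Z nO j).
rewrite (cancel_id' _ _ G0 (X_neq0 k j)) (cancel_idr _ _ Rj); apply.
exact: mulf_neq0.
Qed.

Lemma model_ZN c P : c != 0 -> P = c *: image R tau kappa -> tau != 0 ->
  lv s P (Z ^+ 2 / N) (kappa / tau).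
Proof.
move=> c0 PE k0; have /rV0Pn[j Rj] := nice_R nO.
have := model_ratio c0 PE (spanZ j) (spanN j) (nice_Z nO j) (nice_N nO j).
rewrite (cancel_id' _ _ G0 (X_neq0 k j)) (cancel_idr _ _ Rj); apply.
exact: mulf_neq0.
Qed.

End NicePoint.

End Model.

Section ModelNormal.

Variable k : closedFieldType.
Local Notation K := {fraction {mpoly k[3]}}.
Local Notation cst := (@cst k).
Local Notation X := (@P2gen k).
Local Notation chart := (chart cst).
Local Notation subring := (K -> Prop).

Section OneSide.

Variables (lx ly lz ex ey ez : 'rV[k]_3) (surf0 : surface k) (g : K).
Hypothesis fr : frame lx lz ly ex ez ey.
Hypothesis g0 : g != 0.
Hypothesis sub : forall O, side lx ly lz O -> surf0 O.
Let N := lin lx * lin ly.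
Let Z := lin lz.
Let G := g / X 0 ^+ 3.
Let a := lin lz / lin lx.
Let b := lin ly / lin lx.

Variables (n : nat) (s : 'I_n -> K) (al be : 'I_n -> 'rV[k]_3).
Hypothesis sE : forall i, s i = sec g N Z (al i) (be i).
Hypothesis spanN : forall i, exists c, G * N * X i = comb s c.
Hypothesis spanZ : forall i, exists c, G * Z ^+ 2 * X i = comb s c.

Variables (P : 'rV[k]_n) (h : K).
Hypothesis hrat : rational cst (lin lx / lin lz) (lin ly / lin lz) h.
Hypothesis hreg : forall O, surf0 O -> anticanonical_map g s O P -> O h.

Let x0 : lin lx != 0. Proof. exact: frame_neq0 fr. Qed.
Let y0 : lin ly != 0. Proof. exact: frame_neq0 (fr_swap fr). Qed.
Let z0 : lin lz != 0. Proof. exact: frame_neq0 (fr_z fr). Qed.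
Let ab : indep cst a b. Proof. exact: side_indep fr. Qed.
Let a0 : a != 0. Proof. exact: indep_l0 ab. Qed.
Let b0 : b != 0. Proof. exact: indep_r0 ab. Qed.

Lemma image_scale R t : image al be R t 0 = t *: image al be R 1 0.
Proof. by apply/rowP => i; rewrite !mxE !mul0r !addr0 mul1r. Qed.

(* The whole curve E1 - E2 is contracted to one point of the model. *)
Lemma map_E1 O V t w c : nice g N Z O V ex t 0 w -> t != 0 -> c != 0 ->
  P = c *: image al be ex 1 0 -> anticanonical_map g s O P.
Proof.
move=> nO t0 c0 PE; apply/(anticanonical_mapE sE spanN spanZ nO).
exists (c / t); first by rewrite mulf_neq0 ?invr_eq0.
by rewrite image_scale scalerA divfK.
Qed.

(** With t = b/a and c = a/t one has ct = a and ct^2 = b. The contracted curve is c = 0: its points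
    are of [kind2] for t nonzero, of [kind5] for t = 0 and of [kind3] for t infinite. So h is
    regular along the curve, and [normal_A1] applies once c, ct and ct^2 vanish at the point of the
    model. *)
Lemma E1_regular c : c != 0 -> P = c *: image al be ex 1 0 -> local_ring s P h.
Proof.
move=> c0 PE.
pose O3 := ring_of (chart b (a / b)).
have k3 : kind3 lx ly lz O3 by [].
have nO3 := kind3_nice fr g0 k3; have hT := model_place sE nO3 c0 PE.
have TP2 := model_P2 fr g0 sE spanN spanZ nO3 c0 PE.
have Ta : lv s P a 0.
  by apply: TP2; rewrite -(frame10 fr); exact: lin_lv (frame00 fr).
have Tb : lv s P b 0.
  by apply: TP2; rewrite -(frame20 fr); exact: lin_lv (frame00 fr).
(* This function is z^2/(xy), a quotient of sections, with value kappa/tau = 0. *)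
have Tc : lv s P (a / (b / a)) 0.
  have := model_ZN g0 sE spanN spanZ nO3 c0 PE (oner_neq0 k).
  by rewrite mul0r /N /Z (ZN_side x0 y0 z0).
have reg O V t w : side lx ly lz O -> t != 0 -> nice g N Z O V ex t 0 w -> ring_of V h.
  move=> sO t0 nO; apply/(nice_ring nO); apply: hreg; first exact: sub.
  exact: map_E1 nO t0 c0 PE.
have ct : indep cst (a / (b / a)) (b / a) := indep_swap (kind5_indep fr).
have Ea : a / (b / a) * (b / a) = a := ct_id a0 b0.
have Eb : a / (b / a) * (b / a) ^+ 2 = b := ct2_id a0 b0.
have Et : (b / a)^-1 = a / b := inv_quot b a.
have ta : rational cst (a / (b / a)) (b / a) a.
  by have := rationalM (rational_l cst (a / (b / a)) (b / a)) (rational_r _ _ _); rewrite Ea.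
have tt : rational cst (a / (b / a)) (b / a) (b / a) := rational_r _ _ _.
have hrat' : rational cst (a / (b / a)) (b / a) h.
  apply: (rational_trans ct hrat).
    by rewrite -(inv_quot (lin lz) (lin lx)); exact: rationalV ta.
  by rewrite -(quot_quot (lin ly) x0 z0).
apply/local_ringE; apply: (normal_A1 ct hrat' _ _ hT.1 Tc).
- move=> t0; have [->|t0n] := eqVneq t0 0.
    rewrite rmorph0 subr0; pose O5 := ring_of (chart (b / a) (a / (b / a))).
    have k5 : kind5 lx ly lz O5 by [].
    have sO : side lx ly lz O5 by constructor 4.
    have [v Vh] := reg _ _ _ _ sO (oner_neq0 k) (kind5_nice fr g0 k5).
    by exists v; apply/(chart_swap _ _ ct).
  pose O2 := ring_of (chart a (b / a - cst t0)).
  have k2 : kind2 lx ly lz O2 t0 by [].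
  have sO : side lx ly lz O2 by constructor 1; exists t0.
  have [v Vh] := reg _ _ _ _ sO t0n (kind2_nice fr g0 t0n k2).
  have ct' : indep cst (a / (b / a)) (b / a - cst t0).
    by rewrite -(ev1C cst (a / (b / a)) t0); exact: indep_shift.
  have hp := (chart_place ct').1; exists v.
  apply: (chart_sub hp _ (chart_r _ _ _) Vh).
  have Vt : chart (a / (b / a)) (b / a - cst t0) (b / a) t0.
    by have := placeD hp (chart_r cst (a / (b / a)) (b / a - cst t0)) (placeC hp t0); rewrite subrK add0r.
  by have := placeM hp (chart_l cst (a / (b / a)) _) Vt; rewrite Ea mul0r.
- rewrite Eb Et; have sO : side lx ly lz O3 by constructor 2.
  exact: reg _ _ _ _ sO (oner_neq0 k) nO3.
- by rewrite Ea.
- by rewrite Eb.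
Qed.

Lemma side_regular O : side lx ly lz O -> anticanonical_map g s O P -> local_ring s P h.
Proof.
move=> sO mO; have sO' := sub sO; have Oh := hreg sO' mO.
case: sO => [[t t0 Ok]|Ok|[t Ok]|Ok].
- have nO := kind2_nice fr g0 t0 Ok.
  have [c c0 PE] := proj1 (anticanonical_mapE sE spanN spanZ nO P) mO.
  apply: (E1_regular (c := c * t)); first exact: mulf_neq0.
  by rewrite PE image_scale scalerA.
- have nO := kind3_nice fr g0 Ok.
  have [c c0 PE] := proj1 (anticanonical_mapE sE spanN spanZ nO P) mO.
  exact: E1_regular c0 PE.
- have nO := kind4_nice fr g0 Ok.
  have [c c0 PE] := proj1 (anticanonical_mapE sE spanN spanZ nO P) mO.
  have hT := model_place sE nO c0 PE.
  have TP2 := model_P2 fr g0 sE spanN spanZ nO c0 PE.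
  have Ta : lv s P a 0.
    by apply: TP2; rewrite -(frame10 fr); exact: lin_lv (frame00 fr).
  (* Here (tau : kappa) = (t : 1), so the parameter xy/z^2 - t of X is a function on the model, like
     a; hence every function regular at O is regular at P. *)
  have Tt : lv s P (b / a / a - cst t) 0.
    have := model_NZ g0 sE spanN spanZ nO c0 PE (oner_neq0 k).
    rewrite divr1 /N /Z (NZ_side _ x0 z0) => Tt.
    by have := placeB hT.1 Tt (placeC hT.1 t); rewrite subrr.
  have [v Vh] := proj1 (Ok h) Oh.
  by apply/local_ringE; exists v; apply: (chart_sub hT.1 Ta Tt Vh).
- have nO := kind5_nice fr g0 Ok.
  have [c c0 PE] := proj1 (anticanonical_mapE sE spanN spanZ nO P) mO.
  exact: E1_regular c0 PE.
Qed.

End OneSide.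

Lemma model_regular (lx ly lz ex ey ez : 'rV[k]_3) (O1 O3 O2 O4 : subring) (g : K)
    n (s : 'I_n -> K) (al be : 'I_n -> 'rV[k]_3) P h O :
  let N := lin lx * lin ly in let Z := lin lz in let G := g / X 0 ^+ 3 in
  frame lx lz ly ex ez ey ->
  (forall f, O1 f <-> ring_of (lv X ex) f) -> (forall f, O3 f <-> ring_of (lv X ey) f) ->
  kind2 lx ly lz O2 0 -> kind2 ly lx lz O4 0 -> g != 0 ->
  (forall i, s i = sec g N Z (al i) (be i)) ->
  (forall i, exists c, G * N * X i = comb s c) ->
  (forall i, exists c, G * Z ^+ 2 * X i = comb s c) ->
  rational cst (lin lx / lin lz) (lin ly / lin lz) h ->
  (forall O, surf O1 O3 O2 O4 O -> anticanonical_map g s O P -> O h) ->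
  surf O1 O3 O2 O4 O -> anticanonical_map g s O P -> local_ring s P h.
Proof.
move=> N Z G fr O1E O3E O2E O4E g0 sE spN spZ hrat hreg sO mO.
have [[R [R0 nx ny OR]]|sO'|sO'] := surf_cases fr O1E O3E O2E O4E sO.
- have [c' [w [c'0 nO]]] := nice_P2 fr g0 R0 nx ny OR.
  have [c c0 PE] := proj1 (anticanonical_mapE sE spN spZ nO P) mO.
  have [v Vh] := proj1 (OR h) (hreg _ sO mO).
  apply/local_ringE; exists v; apply: (model_P2 fr g0 sE spN spZ nO c0 PE).
  exact/lv_scaleE.
- apply: (side_regular fr g0 _ sE spN spZ hrat hreg sO' mO).
  by move=> O'; exact: (surf_side O3 fr O1E O2E O4E).
- have NE : lin lx * lin ly = lin ly * lin lx by exact: mulrC.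
  move: sE spN; rewrite /N NE => sE spN.
  apply: (side_regular (fr_swap fr) g0 _ sE spN spZ _ hreg sO' mO).
    by move=> O'; exact: (surf_side' O1 fr O3E O2E O4E).
  have al' : indep cst (lin ly / lin lz) (lin lx / lin lz) := indep_swap (frame_indep (fr_z fr)).
  exact: (rational_trans al' hrat (rational_r _ _ _) (rational_l _ _ _)).
Qed.

End ModelNormal.

(** * Coordinates and descent to F *)

Section Coordinates.

Variables (F : finFieldType) (k : closedFieldType) (iota : {rmorphism F -> k}).
Local Notation K := {fraction {mpoly k[3]}}.
Local Notation cst := (@cst k).
Local Notation X := (@P2gen k).
Local Notation chart := (chart cst).
Local Notation subring := (K -> Prop).
Local Notation q := #|F|.

Definition cross (P Q : 'rV[k]_3) : 'rV[k]_3 := \row_i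
  (if i == 0 then P 0 1 * Q 0 2%:R - P 0 2%:R * Q 0 1 else
   if i == 1 then P 0 2%:R * Q 0 0 - P 0 0 * Q 0 2%:R else
   P 0 0 * Q 0 1 - P 0 1 * Q 0 0).

Lemma I3P (P : 'I_3 -> Prop) : P 0 -> P 1 -> P 2%:R -> forall i, P i.
Proof.
move=> P0 P1 P2 [[|[|[|//]]] lt].
- by have -> : Ordinal lt = 0 by exact: val_inj.
- by have -> : Ordinal lt = 1 by exact: val_inj.
- by have -> : Ordinal lt = 2%:R by exact: val_inj.
Qed.

Lemma dot3 (l R : 'rV[k]_3) : dot l R = l 0 0 * R 0 0 + l 0 1 * R 0 1 + l 0 2%:R * R 0 2%:R.
Proof. exact: sum3. Qed.

(** Cramer's rule, with d the determinant of the three vectors. *)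
Lemma cross_frame (e0 e1 e2 : 'rV[k]_3) : let d := dot (cross e0 e1) e2 in d != 0 ->
  frame (d^-1 *: cross e1 e2) (d^-1 *: cross e2 e0) (d^-1 *: cross e0 e1) e0 e1 e2.
Proof.
move=> d; have dE : d = dot (cross e0 e1) e2 by [].
rewrite !dot3 !mxE /= in dE; move: dE; clearbody d => dE d0.
have [D0 D1 D2] : [/\ d = e0 0 0 * (e1 0 1 * e2 0 2%:R - e1 0 2%:R * e2 0 1) +
   e0 0 1 * (e1 0 2%:R * e2 0 0 - e1 0 0 * e2 0 2%:R) + e0 0 2%:R * (e1 0 0 * e2 0 1 - e1 0 1 * e2 0 0),
   True & True] by split=> //; rewrite dE; ring.
have fin (u v : k) : u = d * v -> d^-1 * u = v by move=> ->; rewrite mulKf.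
split=> [R|||||||||]; rewrite ?dotZl ?dot3 ?mxE /=; try (apply: fin; rewrite ?D0; ring).
apply/rowP; apply: I3P; rewrite !mxE /= -!mulrA -!mulrDr;
  apply/esym; apply: fin; rewrite D0; ring.
Qed.

Lemma frame_dual (l0 l1 l2 e0 e1 e2 l : 'rV[k]_3) : frame l0 l1 l2 e0 e1 e2 ->
  l = dot l e0 *: l0 + dot l e1 *: l1 + dot l e2 *: l2.
Proof.
move=> f0; apply/rowP => j; rewrite !mxE; have E a := frame_coord a j f0.
transitivity (\sum_a l 0 a * (a == j)%:R).
  rewrite (bigD1 j) //= eqxx mulr1 big1 ?addr0 // => a /negPf aj.
  by rewrite aj mulr0.
by rewrite !dot3 sum3 !E; ring.
Qed.

Lemma cross_neq0 (P Q : 'rV[k]_3) : P != 0 -> Q != 0 -> ~ proj_eq P Q -> cross P Q != 0.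
Proof.
move=> /rV0Pn[i Pi] Q0 nPQ; apply/negP => /eqP c0.
have c j : cross P Q 0 j = 0 by rewrite c0 mxE.
have := c 0; have := c 1; have := c 2%:R; rewrite !mxE /=.
move=> /eqP; rewrite subr_eq0 => /eqP E2 /eqP; rewrite subr_eq0 => /eqP E1.
move=> /eqP; rewrite subr_eq0 => /eqP E0; apply: nPQ.
have E : forall a b, P 0 a * Q 0 b = P 0 b * Q 0 a.
  by apply: I3P; apply: I3P => //; rewrite ?E0 ?E1 ?E2.
have QE : Q = (Q 0 i / P 0 i) *: P.
  by apply/rowP => j; rewrite mxE; apply: (mulIf Pi); rewrite mulrAC divfK // mulrC E mulrC.
exists (Q 0 i / P 0 i) => //.
by apply: contra_neq Q0 => z; rewrite QE z scale0r.
Qed.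

Lemma frob_cross (P Q : 'rV[k]_3) : frob_pt F (cross P Q) = cross (frob_pt F P) (frob_pt F Q).
Proof.
apply/rowP; apply: I3P; rewrite !mxE /= -[LHS]/(frobk iota _) rmorphB !rmorphM //.
Qed.

(** Dividing by a nonzero coordinate makes that coordinate 1; proportional vectors with a common
    coordinate 1 are equal. *)
Lemma normalize (P : 'rV[k]_3) m : P != 0 -> frob_pt F P = m *: P ->
  exists c i, [/\ c != 0, (c *: P) 0 i = 1 & frob_pt F (c *: P) = c *: P].
Proof.
move=> /rV0Pn[i Pi] fP; exists (P 0 i)^-1, i; split.
- by rewrite invr_eq0.
- by rewrite mxE mulVf.
- rewrite frob_ptZ fP scalerA exprVn; congr (_ *: _).
  have := congr1 (fun R : 'rV_3 => R 0 i) fP; rewrite !mxE => ->.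
  have m0 : m != 0.
    apply/negP => /eqP m0; have := congr1 (fun R : 'rV_3 => R 0 i) fP.
    by rewrite !mxE m0 mul0r => /eqP; rewrite expf_eq0 (negPf Pi) andbF.
  by field; apply/andP.
Qed.

Lemma maxid_frob (O O' : subring) f : frob_ring F O O' -> maxid O f ->
  maxid O' (frobK iota f).
Proof.
move=> OO' [Of f0]; split; first exact/OO'.
case: f0 => [->|nO]; first by left; rewrite rmorph0.
by right; rewrite -fmorphV => /OO'.
Qed.

Variables (P1 P3 : 'rV[k]_3) (O2 O4 : subring).
Hypotheses (P1_neq0 : P1 != 0) (P3_neq0 : P3 != 0).
Hypothesis P1_rat : forall i, P1 0 i ^+ (q ^ 2) = P1 0 i.
Hypothesis P13_dist : ~ proj_eq P1 P3.
Hypothesis P13_conj : proj_eq P3 (frob_pt F P1) /\ proj_eq P1 (frob_pt F P3).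
Hypotheses (O2_near : infinitely_near (P2ring P1) O2)
           (O4_near : infinitely_near (P2ring P3) O4).
Hypothesis O24_conj : frob_ring F O2 O4 /\ frob_ring F O4 O2.
Hypothesis O2_line : ~ curve_passes_through (line_ring P1 P3) O2.

Lemma frob2 (l R : 'rV[k]_3) :
  dot (frob_pt F (frob_pt F l)) (frob_pt F (frob_pt F R)) = dot l R ^+ q ^+ q.
Proof. by rewrite !(frob_dot iota). Qed.

(** If p2 were the direction l2 = 0 of the line, a function A/B of O2 would be regular at P1 + u P3
    for every nonzero u with B(u, 0) nonzero. Such u exist, so the line would pass through p2. *)
Lemma not_line (l0 l1 l2 e2 : 'rV[k]_3) : frame l0 l1 l2 P1 P3 e2 ->
  ~ is_chart O2 (lin l1 / lin l0) (lin l2 / lin l0 / (lin l1 / lin l0)).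
Proof.
move=> f0 Och; apply: O2_line => f /Och[c [A [B [B0 -> _]]]].
have Bp0 : B`_0 * 'X != 0.
  rewrite mulf_eq0 negb_or polyX_eq0 andbT; apply: contra_neq B0 => B00.
  by rewrite polyC0 (horner_coef0 B) B00 horner0.
have [u] := closed_nonrootP _ Bp0; rewrite /root hornerMX mulf_eq0 negb_or => /andP[Bu u0].
pose R := 1 *: P1 + u *: P3; exists 1, u; rewrite -/R.
have R0 : dot l0 R = 1 by rewrite dotDr !dotZr (frame00 f0) (frame01 f0) mulr0 addr0 mulr1.
have R1 : dot l1 R = u by rewrite dotDr !dotZr (frame10 f0) (frame11 f0) mulr0 add0r mulr1.
have R2 : dot l2 R = 0 by rewrite dotDr !dotZr (frame20 f0) (frame21 f0) !mulr0 addr0.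
have hp := (P2_place R).1; have V1 := lin_lv l1 R0; have V2 := lin_lv l2 R0.
rewrite R1 in V1; rewrite R2 in V2; have V3 := place_div hp V2 V1 u0.
rewrite mul0r in V3; have VA := place_ev A hp V1 V3; have VB := place_ev B hp V1 V3.
apply/local_ringE; exists (A.[0, u] / B.[0, u]); apply: (place_div hp VA VB).
by rewrite polyC0 (horner_coef0 B).
Qed.

Lemma P2_is_chart (l0 l1 l2 e0 e1 e2 P : 'rV[k]_3) c : frame l0 l1 l2 e0 e1 e2 ->
  c != 0 -> P = c *: e0 -> is_chart (P2ring P) (lin l1 / lin l0) (lin l2 / lin l0).
Proof.
move=> f0 c0 -> f; split=> [/local_ringE[v /lv_scaleE Vf]|[v /(P2_chart f0) Vf]].
  by exists v; apply/(P2_chart f0); exact: Vf.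
by apply/local_ringE; exists v; apply/lv_scaleE.
Qed.

Lemma direction (l0 l1 lz e2 : 'rV[k]_3) : frame l0 l1 lz P1 P3 e2 ->
  exists t, maxid O2 (lin (l1 - t *: lz) / lin lz).
Proof.
move=> f0; have f0' := frame_swap12 f0; have ab := frame_indep f0'.
have l00 := frame_neq0 f0; have lz0 : lin lz != 0 := frame_neq0 (frame_swap01 f0').
have Och := P2_is_chart f0' (oner_neq0 _) (esym (scale1r _)).
have [[t Ot]|Ot] := near_points ab Och O2_near; last by case: (not_line f0 Ot).
exists t; have ct := indep_blow (t := t) ab; apply/(maxid_chart _ ct Ot).
rewrite linB linZ (shift_quot _ _ lz0) -(quot_quot _ l00 lz0); exact: chart_r.
Qed.

(** The function y/z has the value t at the direction t, and its inverse vanishes at the remaining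
    one; its vanishing singles out the direction 0. *)
Lemma kind2_of (lx ly lz ex ey ez P : 'rV[k]_3) c O : frame lx lz ly ex ez ey ->
  c != 0 -> P = c *: ex -> infinitely_near (P2ring P) O -> maxid O (lin ly / lin lz) ->
  kind2 lx ly lz O 0.
Proof.
move=> f0 c0 PE nr mx; have ab := frame_indep f0; have Och := P2_is_chart f0 c0 PE.
have x0 := frame_neq0 f0; have z0 := frame_neq0 (fr_z f0).
have Eb := quot_quot (lin ly) x0 z0.
have [[t Ot]|Ot] := near_points ab Och nr.
  have ct := indep_blow (t := t) ab; move/(maxid_chart _ ct Ot): mx => V0.
  have V1 := kind2_val f0 t; rewrite -Eb in V0.
  by rewrite /kind2 (place_uniq (chart_place ct) V0 V1).
have ct := kind3_indep f0; move/(maxid_chart _ ct Ot): mx => V0.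
have h := chart_place ct; have := placeM h.1 V0 (chart_r cst (lin ly / lin lx) _).
rewrite -Eb mulr0 mulrA (divfK (indep_l0 ab)) (divff (indep_r0 ab)) => V1.
have /eqP := place_uniq h V1 (place1 h.1); rewrite eq_sym oner_eq0 => e; discriminate e.
Qed.

(** The form ly of the tangent line at P1 with direction p2 is unique up to a scalar, and its second
    conjugate is again such a form. With one coordinate normalized to 1 the two are equal, so ly and
    its conjugate lx are exchanged by the Frobenius. *)
Lemma coordinates : exists lx ly lz ex ey ez c1 c3, [/\ frame lx lz ly ex ez ey,
  [/\ frob_pt F lz = lz, frob_pt F ly = lx & frob_pt F lx = ly],
  [/\ c1 != 0, P1 = c1 *: ex, c3 != 0 & P3 = c3 *: ey] &
  kind2 lx ly lz O2 0 /\ kind2 ly lx lz O4 0].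
Proof.
have [[d3 d30 P3E] [d1 d10 P1E]] := P13_conj.
have w0 := cross_neq0 P1_neq0 P3_neq0 P13_dist; set w := cross P1 P3 in w0.
(* The Frobenius exchanges P1 and P3 up to scalars, and the cross product is antisymmetric. *)
have fw : frob_pt F w = (- (d3 * d1)) *: w.
  rewrite frob_cross P3E P1E /w; apply/rowP; apply: I3P; rewrite !mxE /=; ring.
have [c [i [c0 wi fz]]] := normalize w0 fw; set lz := c *: w in wi fz.
pose e2 : 'rV[k]_3 := delta_mx 0 i.
have de2 l : dot l e2 = l 0 i.
  rewrite /dot (bigD1 i) //= big1 ?addr0 => [|j /negPf ij].
    by rewrite mxE !eqxx mulr1.
  by rewrite mxE eqxx ij mulr0.
have wi' : dot w e2 = c^-1.
  have cw : c * w 0 i = 1 by move: wi; rewrite [lz 0 i]mxE.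
  by rewrite de2 -[LHS](mulKf c0) cw mulr1.
have := @cross_frame P1 P3 e2; rewrite /= -/w wi' invrK invr_eq0 => /(_ c0).
rewrite -/lz; set l0 := _ *: cross P3 e2; set l1 := _ *: cross e2 P1 => f0.
clearbody lz l0 l1.
have lz0 : lin lz != 0 := frame_neq0 (frame_swap01 (frame_swap12 f0)).
have [t mx0] := direction f0; set ly0 := l1 - t *: lz in mx0.
have y1 : dot ly0 P1 = 0 by rewrite dotBl dotZl (frame10 f0) (frame20 f0) mulr0 subr0.
have y3 : dot ly0 P3 = 1 by rewrite dotBl dotZl (frame11 f0) (frame21 f0) mulr0 subr0.
have expand l : l = dot l P1 *: l0 + dot l P3 *: l1 + dot l e2 *: lz.
  exact: frame_dual f0.

have tangent l : dot l P1 = 0 -> maxid O2 (lin l / lin lz) -> l = dot l P3 *: ly0.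
  have f0' := frame_swap12 f0; have ab := frame_indep f0'.
  have Och := P2_is_chart f0' (oner_neq0 _) (esym (scale1r _)).
  have [[t' Ot]|Ot] := near_points ab Och O2_near; last by case: (not_line f0 Ot).
  have ct := indep_blow (t := t') ab; have h := chart_place ct => l1E mx.
  have lE : l = dot l P3 *: ly0 + (dot l e2 + dot l P3 * t) *: lz.
    rewrite {1}[l]expand l1E scale0r add0r /ly0; apply/rowP => j; rewrite !mxE.
    by ring.
  move: mx; rewrite {1}lE linD !linZ mulrDl (mulfK lz0) -mulrA => mx.
  move/(maxid_chart _ ct Ot): mx => V0; move/(maxid_chart _ ct Ot): mx0 => V1.
  have V2 := placeM h.1 (placeC h.1 (dot l P3)) V1.
  have V3 := placeD h.1 V2 (placeC h.1 (dot l e2 + dot l P3 * t)).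
  have := place_uniq h V0 V3; rewrite mulr0 add0r => z.
  by rewrite {1}lE -z scale0r addr0.
have ly00 : ly0 != 0.
  by apply: contra_eq_neq y3 => ->; rewrite /dot big1 => [|j _]; rewrite ?mxE ?mul0r // eq_sym oner_neq0.
have /rV0Pn[j ly0j] := ly00; pose ly := (ly0 0 j)^-1 *: ly0.
have b0 : (ly0 0 j)^-1 != 0 by rewrite invr_eq0.
have mxy : maxid O2 (lin ly / lin lz).
  have f0' := frame_swap12 f0; have ab := frame_indep f0'.
  have Och := P2_is_chart f0' (oner_neq0 _) (esym (scale1r _)).
  have [[t' Ot]|Ot] := near_points ab Och O2_near; last by case: (not_line f0 Ot).
  have ct := indep_blow (t := t') ab; have h := chart_place ct.
  move/(maxid_chart _ ct Ot): mx0 => V1; apply/(maxid_chart _ ct Ot).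
  have V2 := placeM h.1 (placeC h.1 (ly0 0 j)^-1) V1; rewrite mulr0 in V2.
  by rewrite linZ -mulrA.
pose lx := frob_pt F ly.
have fzK : frobK iota (lin lz) = lin lz by rewrite frobK_lin fz.
have frz l : frobK iota (lin l / lin lz) = lin (frob_pt F l) / lin lz.
  by rewrite rmorphM fmorphV /= fzK frobK_lin.
have mxx : maxid O4 (lin lx / lin lz).
  by rewrite -frz; apply: maxid_frob O24_conj.1 mxy.
have mxyy : maxid O2 (lin (frob_pt F lx) / lin lz).
  by rewrite -frz; apply: maxid_frob O24_conj.2 mxx.
have P1ff : frob_pt F (frob_pt F P1) = P1.
  by apply/rowP => a; rewrite !mxE -exprM mulnn P1_rat.
have qn0 : (q == 0)%N = false by apply/eqP => q0; have := q_gt1 F; rewrite q0.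
have yP1 : dot ly P1 = 0 by rewrite dotZl y1 mulr0.
have fxE : frob_pt F lx = ly.
  have := tangent _ _ mxyy; rewrite -{1}P1ff frob2 yP1 expr0n qn0 expr0n qn0 => /(_ erefl).
  set b := dot _ P3 => E.
  have lyj : ly 0 j = 1 by rewrite [LHS]mxE mulVf.
  have lxj : frob_pt F lx 0 j = 1 by rewrite [LHS]mxE [lx 0 j]mxE lyj !expr1n.
  have bE : b * ly0 0 j = 1 by rewrite -lxj E [RHS]mxE.
  by rewrite E /ly; congr (_ *: _); apply: (mulIf ly0j); rewrite bE mulVf.
have yP3 : dot ly P3 != 0 by rewrite dotZl y3 mulr1.
have P3E' : P3 = d3^-1 *: frob_pt F P1 by rewrite P3E scalerA mulVf // scale1r.
have P1E' : P1 = d1^-1 *: frob_pt F P3 by rewrite P1E scalerA mulVf // scale1r.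
have xP3 : dot lx P3 = 0.
  by rewrite P3E' dotZr (frob_dot iota) yP1 expr0n qn0 mulr0.
have xP1 : dot lx P1 != 0.
  by rewrite P1E' dotZr (frob_dot iota) mulf_neq0 ?invr_eq0 ?expf_neq0.
pose ex := (dot lx P1)^-1 *: P1; pose ey := (dot ly P3)^-1 *: P3.
(* e2 is corrected so that lx and ly vanish; the value 1 of lz is kept, as lz vanishes at ex and
   ey. *)
pose ez := e2 - dot lx e2 *: ex - dot ly e2 *: ey.
have dotBr (l R R' : 'rV[k]_3) : dot l (R - R') = dot l R - dot l R'.
  by rewrite -scaleN1r dotDr dotZr mulN1r.
have xy : dot lx ey = 0 by rewrite dotZr xP3 mulr0.
have yx : dot ly ex = 0 by rewrite dotZr yP1 mulr0.
have xx : dot lx ex = 1 by rewrite dotZr mulVf.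
have yy : dot ly ey = 1 by rewrite dotZr mulVf.
have zx : dot lz ex = 0 by rewrite dotZr (frame20 f0) mulr0.
have zy : dot lz ey = 0 by rewrite dotZr (frame21 f0) mulr0.
have fr : frame lx lz ly ex ez ey.
  have ezE l : dot l ez = dot l e2 - dot lx e2 * dot l ex - dot ly e2 * dot l ey.
    by rewrite dotBr (dotBr l e2) (@dotZr _ _ l ex) (@dotZr _ _ l ey).
  split=> //; rewrite ?ezE ?xy ?yx ?xx ?yy ?zx ?zy ?(frame22 f0); try ring.
  move=> R; have RE := frameE f0 R.
  have dx : dot lx R = dot l0 R * dot lx P1 + dot lz R * dot lx e2.
    by rewrite {1}RE !dotDr !dotZr xP3 mulr0 addr0.
  have dy : dot ly R = dot l1 R * dot ly P3 + dot lz R * dot ly e2.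
    by rewrite {1}RE !dotDr !dotZr yP1 mulr0 add0r.
  apply/rowP => a; rewrite {1}RE dx dy !mxE; field.
  by apply/andP.
have E1 : P1 = dot lx P1 *: ex by rewrite scalerA mulfV // scale1r.
have E3 : P3 = dot ly P3 *: ey by rewrite scalerA mulfV // scale1r.
exists lx, ly, lz, ex, ey, ez, (dot lx P1), (dot ly P3); split=> //; split.
  exact: kind2_of (fr) xP1 E1 O2_near mxy.
exact: kind2_of (fr_swap fr) yP3 E3 O4_near mxx.
Qed.

End Coordinates.

(** * Functions and forms defined over F *)

Section RationalFunctionFields.

Variables (F : finFieldType) (k : closedFieldType) (iota : {rmorphism F -> k}).
Local Notation K := {fraction {mpoly k[3]}}.
Local Notation cst := (@cst k).


Lemma frob_fixed_homog n d (A : {mpoly k[n]}) : A \is d.-homog -> frobm iota A = A ->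
  exists2 A0 : {mpoly F[n]}, A0 \is d.-homog & A = map_mpoly iota A0.
Proof.
move=> hA /frob_fixed_mpoly[A0 AE]; exists A0 => //.
apply/dhomogP => m mA0; move/dhomogP: hA; apply; rewrite AE.
by rewrite (perm_mem (msupp_map_mpoly _ _)) //; exact: fmorph_inj.
Qed.

Section Field.

Variables (n : nat) (s : 'I_n -> K).
Local Notation FF := (function_field iota s).
Local Notation gev A := (geval s (map_mpoly iota A)).

Lemma gevM A B : gev (A * B) = gev A * gev B.
Proof. by rewrite rmorphM gevalM. Qed.

Lemma gevD A B : gev (A + B) = gev A + gev B.
Proof. by rewrite rmorphD gevalD. Qed.

Lemma function_fieldC a : FF (cst (iota a)).
Proof.
have g1 : gev 1 = 1 by rewrite -mpolyC1 map_mpolyC gevalC /= !rmorph1.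
exists 0%N, a%:MP, 1; rewrite g1 divr1 map_mpolyC gevalC oner_neq0; split=> //.
  by rewrite -alg_mpolyC; apply: dhomogZ; exact: dhomog1.
exact: dhomog1.
Qed.

Lemma function_fieldM f h : FF f -> FF h -> FF (f * h).
Proof.
move=> [d [A [B [hA hB B0 ->]]]] [d' [A' [B' [hA' hB' B0' ->]]]].
exists (d + d')%N, (A * A'), (B * B'); rewrite !gevM; split; [exact: dhomogM|exact: dhomogM| |].
  exact: mulf_neq0 B0 B0'.
exact: mulf_div.
Qed.

Lemma function_fieldD f h : FF f -> FF h -> FF (f + h).
Proof.
move=> [d [A [B [hA hB B0 ->]]]] [d' [A' [B' [hA' hB' B0' ->]]]].
exists (d + d')%N, (A * B' + A' * B), (B * B'); rewrite gevD !gevM (addf_div _ _ B0 B0').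
split; [|exact: dhomogM|exact: mulf_neq0 B0 B0'|by []].
by apply: rpredD; [|rewrite addnC]; exact: dhomogM.
Qed.

Lemma function_fieldV f : FF f -> FF f^-1.
Proof.
move=> [d [A [B [hA hB B0 ->]]]]; have [A0|A0] := eqVneq (gev A) 0.
  by rewrite A0 mul0r invr0 -(rmorph0 cst) -(rmorph0 iota); exact: function_fieldC.
by exists d, B, A; rewrite invf_div.
Qed.

Lemma function_field_geval m (t : 'I_m -> K) (A : {mpoly F[m]}) :
  (forall i, FF (t i)) -> FF (geval t (map_mpoly iota A)).
Proof.
move=> ht; elim/mpolyind: A => [|c e p _ _ IH].
  by rewrite rmorph0 /geval mmap0 -(rmorph0 cst) -(rmorph0 iota); exact: function_fieldC.
rewrite rmorphD /= gevalD map_mpolyZ gevalZ map_mpolyX; apply: function_fieldD => //.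
apply: function_fieldM; first exact: function_fieldC.
rewrite /geval mmapX /mmap1; elim/big_ind: _ => [|u v|i _].
- by rewrite -(rmorph1 cst) -(rmorph1 iota); exact: function_fieldC.
- exact: function_fieldM.
- elim: (e i) => [|j IHj]; first by rewrite expr0 -(rmorph1 cst) -(rmorph1 iota); exact: function_fieldC.
  by rewrite exprS; apply: function_fieldM.
Qed.

End Field.

Lemma function_field_trans n m (s : 'I_n -> K) (t : 'I_m -> K) f :
  (forall i, function_field iota s (t i)) -> function_field iota t f ->
  function_field iota s f.
Proof.
move=> st [d [A [B [_ _ _ ->]]]]; apply: function_fieldM; last apply: function_fieldV;
exact: function_field_geval.
Qed.

Lemma frobm_linp (l : 'rV[k]_3) : frobm iota (linp l) = linp (frob_pt F l).
Proof.
rewrite /frobm /linp rmorph_sum; apply: eq_bigr => i _.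
by rewrite /= map_mpolyZ map_mpolyX mxE.
Qed.

End RationalFunctionFields.

Section Descent.

Variables (F : finFieldType) (k : closedFieldType) (iota : {rmorphism F -> k}).
Local Notation K := {fraction {mpoly k[3]}}.
Local Notation cst := (@cst k).
Local Notation X := (@P2gen k).
Local Notation subring := (K -> Prop).
Local Notation im := (map_mx iota).
Local Notation Phi := (frobK iota).

Lemma nice_rescale (g N Z : K) O V (R R' : 'rV[k]_3) tau kappa w c d :
  nice g N Z O V R tau kappa w -> c != 0 -> d != 0 -> R = c *: R' ->
  nice g N Z O V R' (d * c * tau) (d * c * kappa) (cst d^-1 * w).
Proof.
move=> nO c0 d0 RE; have hV := nice_place nO; have dc0 := mulf_neq0 d0 c0.
have cd0 : cst d != 0 by rewrite fmorph_eq0.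
have val u t i : V (u / w) (t * R 0 i) -> V (u / (cst d^-1 * w)) (d * c * t * R' 0 i).
  have -> : u / (cst d^-1 * w) = cst d * (u / w).
    by rewrite fmorphV invfM invrK mulrCA.
  have -> : d * c * t * R' 0 i = d * (t * R 0 i) by rewrite RE mxE; ring.
  exact: (placeM hV.1 (placeC hV.1 d)).
split.
- exact: hV.
- exact: nice_ring nO.
- by move=> i; apply/val/(nice_N nO).
- by move=> i; apply/val/(nice_Z nO).
- by case: (nice_tk nO) => h; [left|right]; exact: mulf_neq0 dc0 h.
- by have := nice_R nO; rewrite RE; apply: contra_neq => ->; rewrite scaler0.
- by apply: mulf_neq0 (nice_w nO); rewrite fmorph_eq0 invr_eq0.
- move=> w' /(nice_canon nO)[e [v [Ve v0 ->]]].
  exists (e * cst d), (v * d); split; first exact: (placeM hV.1 Ve (placeC hV.1 d)).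
    exact: mulf_neq0 v0 d0.
  by rewrite -mulrA [cst d * _]mulrA fmorphV (divff cd0) mul1r.
- move=> c' c'0; rewrite mulrA -rmorphM; apply: (nice_exists nO).
  exact: mulf_neq0 c'0 (invr_neq0 d0).
Qed.

Variables (lx ly lz ex ey ez : 'rV[k]_3) (O1 O3 O2 O4 : subring) (g : K).
Hypothesis fr : frame lx lz ly ex ez ey.
Hypotheses (fz : frob_pt F lz = lz) (fy : frob_pt F ly = lx) (fx : frob_pt F lx = ly).
Hypotheses (O1E : forall f, O1 f <-> ring_of (lv X ex) f)
           (O3E : forall f, O3 f <-> ring_of (lv X ey) f)
           (O2E : kind2 lx ly lz O2 0) (O4E : kind2 ly lx lz O4 0).
Hypotheses (g_rat : function_field iota X g) (g0 : g != 0).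
Local Notation N := (lin lx * lin ly).
Local Notation Z := (lin lz).
Local Notation S := (surf O1 O3 O2 O4).

Lemma surf_nice O : S O -> exists V R tau kappa w, nice g N Z O V R tau kappa w /\
  [\/ R = ex, R = ey | forall f, O f <-> ring_of (lv X R) f].
Proof.
move=> /(surf_cases fr O1E O3E O2E O4E) [[R [R0 nx ny OR]]|sO|sO].
- have [c [w [c0 nO]]] := nice_P2 fr g0 R0 nx ny OR; do 5!eexists; split; first exact: nO.
  constructor 3 => f; split=> [/OR[v Vf]|[v Vf]].
    by exists v; apply/lv_scaleE.
  by apply/OR; exists v; apply/(lv_scaleE R f v c0).
- have [V [t [ka [w nO]]]] := nice_side fr g0 sO.
  by do 5!eexists; split; [exact: nO|constructor 1].
- have [V [t [ka [w nO]]]] := nice_side (fr_swap fr) g0 sO.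
  by do 5!eexists; split; [exact: nice_sym nO|constructor 2].
Qed.

(** At a rational point the values of x and y are conjugate, whereas exactly one of them vanishes at
    ex and at ey. *)
Lemma frob_not_proj (R : 'rV[k]_3) : frob_pt F R = R -> ~ proj_eq ex R /\ ~ proj_eq ey R.
Proof.
move=> fR; have xR := frob_dot iota lx R; have yR := frob_dot iota ly R.
rewrite fx fR in xR; rewrite fy fR in yR.
split=> -[c c0 RE]; [move: xR|move: yR]; rewrite RE !dotZr.
  rewrite (frame00 fr) (frame20 fr) mulr0 mulr1 => /esym/eqP.
  by rewrite expf_eq0 (negPf c0) andbF.
rewrite (frame02 fr) (frame22 fr) mulr0 mulr1 => /esym/eqP.
by rewrite expf_eq0 (negPf c0) andbF.
Qed.

Lemma nice_frob (R : 'rV[k]_3) O : frob_pt F R = R -> R != 0 ->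
  (forall f, O f <-> ring_of (lv X R) f) -> S O /\ exists w,
  nice g N Z O (lv X R) R (dot lx R * dot ly R) (dot lz R ^+ 2) w.
Proof.
move=> /frob_not_proj[nx ny] R0 OR; split; first exact: (surf_P2 fr O1E O3E O2E O4E R0 nx ny OR).
have [c [w [c0 nO]]] := nice_P2 fr g0 R0 nx ny OR.
(* The sections are cubic: rescaling w by c^3 turns tau and kappa into the values of xy and z^2 at
   the given representative R. *)
have := nice_rescale nO c0 (invr_neq0 (expf_neq0 3 c0)) (erefl _).
have E a b : (c ^+ 3)^-1 * c * (c * a * (c * b)) = a * b by field.
by rewrite !dotZr !E -expr2 => h; eexists; exact: h.
Qed.

Lemma function_field_rational f : function_field iota X f ->
  rational cst (lin lx / lin lz) (lin ly / lin lz) f.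
Proof.
move=> [d [A [B [hA hB B0 ->]]]].
exact: (ratio_rational fr (map_homog iota hA) (map_homog iota hB) B0).
Qed.

(** As xy and z^2 are coprime, z^2 would divide a nonzero linear form l1. Instead of factoring, the
    proof evaluates the cubic at a few points. *)
Lemma sec_eq0 l1 l2 : sec g N Z l1 l2 = 0 -> l1 = 0 /\ l2 = 0.
Proof.
move=> s0; have {s0} : N * lin l1 + Z ^+ 2 * lin l2 = 0.
  apply: (mulf_eq0_r _ s0); exact: mulf_neq0 g0 (invr_neq0 (expf_neq0 3 (X_neq0 k 0))).
pose A : {mpoly k[3]} := linp lx * linp ly * linp l1 + linp lz * linp lz * linp l2.
have AE : geval X A = N * lin l1 + Z ^+ 2 * lin l2.
  by rewrite gevalD expr2 !gevalM !geval_linp.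
rewrite -AE geval_P2gen => /eqP; rewrite tofrac_eq0 => /eqP A0.
have E R : dot lx R * dot ly R * dot l1 R + dot lz R ^+ 2 * dot l2 R = 0.
  have := congr1 (fun B : {mpoly k[3]} => B.@[R 0]) A0.
  by rewrite mevalD !mevalM !meval_linp meval0 expr2.
(* On the line z = 0 two points, with y/x = 1 and y/x = c, are needed to separate the coefficients
   of l1. A c other than 0 and 1 is found in k, but not in F when q = 2. *)
have p0 : 'X * ('X - 1%:P) != 0 :> {poly k} by rewrite mulf_neq0 ?polyX_eq0 ?polyXsubC_eq0.
have [c] := closed_nonrootP _ p0.
rewrite /root hornerM hornerXsubC hornerX mulf_eq0 negb_or => /andP[c0 c1] {p0}.
have {}E p t u : p * u * (p * dot l1 ex + t * dot l1 ez + u * dot l1 ey) +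
    t ^+ 2 * (p * dot l2 ex + t * dot l2 ez + u * dot l2 ey) = 0.
  rewrite -[RHS](E (p *: ex + t *: ez + u *: ey)) !dotDr !dotZr.
  rewrite (frame00 fr) (frame01 fr) (frame02 fr) (frame10 fr) (frame11 fr) (frame12 fr).
  by rewrite (frame20 fr) (frame21 fr) (frame22 fr); ring.
have z2 : dot l2 ez = 0 by rewrite -[RHS](E 0 1 0); ring.
have x2 : dot l2 ex = 0 by have := E 1 1 0; rewrite z2 => e; rewrite -[RHS]e; ring.
have y2 : dot l2 ey = 0 by have := E 0 1 1; rewrite z2 => e; rewrite -[RHS]e; ring.
have xy : dot l1 ex + dot l1 ey = 0 by rewrite -[RHS](E 1 0 1); ring.
have y1 : dot l1 ey = 0.
  have : c * (c - 1) * dot l1 ey =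
      1 * c * (1 * dot l1 ex + 0 * dot l1 ez + c * dot l1 ey) +
      0 ^+ 2 * (1 * dot l2 ex + 0 * dot l2 ez + c * dot l2 ey) -
      c * (dot l1 ex + dot l1 ey) by ring.
  by rewrite E xy mulr0 subr0 => /eqP; rewrite !mulf_eq0 (negPf c0) (negPf c1) => /eqP.
have x1 : dot l1 ex = 0 by rewrite -xy y1 addr0.
have z1 : dot l1 ez = 0.
  by have := E 1 1 1; rewrite x1 y1 x2 y2 z2 => e; rewrite -[RHS]e; ring.
by split; [rewrite (frame_dual l1 fr) x1 y1 z1|rewrite (frame_dual l2 fr) x2 y2 z2];
  rewrite !scale0r !addr0.
Qed.

Lemma sec_inj l1 l2 m1 m2 : sec g N Z l1 l2 = sec g N Z m1 m2 -> l1 = m1 /\ l2 = m2.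
Proof.
move=> /eqP; rewrite -subr_eq0 => /eqP s0.
have [|/eqP d1 /eqP d2] := @sec_eq0 (l1 - m1) (l2 - m2).
  by rewrite -s0 /sec !linB; ring.
by split; apply/eqP; rewrite -subr_eq0.
Qed.

Lemma frobK_sec l1 l2 : Phi (sec g N Z l1 l2) = sec g N Z (frob_pt F l1) (frob_pt F l2).
Proof.
rewrite /sec !(rmorphM, rmorphD, rmorphXn, fmorphV) /= !frobK_lin frobK_X.
rewrite (frobK_fixed g_rat) fz fy fx (mulrC (lin ly) (lin lx)); exact: erefl.
Qed.

Definition fsec (a b : 'rV[F]_3) : K := sec g N Z (im a) (im b).

Lemma fsec_rational a b : function_field iota X (fsec a b).
Proof.
pose A : {mpoly k[3]} := linp lx * linp ly * linp (im a) + linp lz ^+ 2 * linp (im b).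
have hl (l : 'rV[k]_3) := linp_homog l.
have hA : A \is 3.-homog.
  apply: rpredD; first exact: (dhomogM (dhomogM (hl lx) (hl ly)) (hl _)).
  by rewrite expr2; exact: (dhomogM (dhomogM (hl lz) (hl lz)) (hl _)).
have fA : frobm iota A = A.
  rewrite /A expr2 frobmD !frobmM !frobm_linp !frob_map_mx fx fy fz.
  by rewrite [linp ly * _]mulrC.
have [A0 hA0 A0E] := frob_fixed_homog hA fA.
have hX : ('X_0 : {mpoly F[3]}) ^+ 3 \is 3.-homog.
  by rewrite -[X in X.-homog]mul1n; apply: dhomogMn; rewrite dhomogX /= mdeg1.
have XE : geval X (map_mpoly iota ('X_0 ^+ 3)) = X 0 ^+ 3.
  by rewrite rmorphXn /= map_mpolyX geval_P2gen rmorphXn.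
have -> : fsec a b = g * (geval X A / X 0 ^+ 3).
  by rewrite gevalD expr2 !gevalM !geval_linp /fsec /sec expr2 mulrAC mulrA.
apply: function_fieldM g_rat _; exists 3%N, A0, ('X_0 ^+ 3); rewrite XE -A0E.
by split; [exact: hA0|exact: hX|exact: expf_neq0 3 (X_neq0 k 0)|exact: erefl].
Qed.

Lemma sec_regular l1 l2 O w : S O -> canonical_eq g O w -> O (sec g N Z l1 l2 / w).
Proof.
move=> /surf_nice[V [R [tau [kappa [w0 [nO _]]]]]] /(nice_canon nO)[e [c [Ve c0 ->]]].
apply/(nice_ring nO); eexists.
rewrite (mulrC e) div_mul.
exact: (place_div (nice_place nO).1 (nice_sec l1 l2 nO) Ve c0).
Qed.

(** Over k a section is given by a unique pair (l1, l2). The Frobenius fixes xy, z and the section,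
    hence both forms, which are therefore defined over F. *)
Lemma anticanonical_sectionE f :
  anticanonical_section iota S g f <-> exists a b, f = fsec a b.
Proof.
split=> [[f_rat f_reg]|[a [b ->]]]; last first.
  by split; [exact: fsec_rational|move=> O w; exact: sec_regular].
have [l1 [l2 fE]] := section_cubic fr O1E O3E O2E O4E g0 (function_field_rational f_rat)
  (function_field_rational g_rat) f_reg.
have := frobK_fixed f_rat; rewrite fE frobK_sec => /sec_inj[f1 f2].
have [a aE] := frob_fixed_point iota f1; have [b bE] := frob_fixed_point iota f2.
by exists a, b; rewrite /fsec -aE -bE.
Qed.

End Descent.

(** * Rational coordinates and the norm form *)

Section RationalCoordinates.

Variables (F : finFieldType) (k : closedFieldType) (iota : {rmorphism F -> k}).
Local Notation q := #|F|.
Local Notation im := (map_mx iota).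

Definition pt (D : 'rV[F]_3 * 'rV[F]_3 * 'rV[F]_3) (e : F * F * F) : 'rV[F]_3 :=
  e.1.1 *: D.1.1 + e.1.2 *: D.1.2 + e.2 *: D.2.

Variables (lx ly lz ex ey ez : 'rV[k]_3).
Hypothesis fr : frame lx lz ly ex ez ey.
Hypotheses (fz : frob_pt F lz = lz) (fy : frob_pt F ly = lx) (fx : frob_pt F lx = ly).

(* The basis consists of the traces of ex and theta * ex and of ez, where theta
   is a coordinate of ly outside of F; N = lx * ly becomes the norm form. *)
Lemma rational_coordinates : exists D n1 n2 n3, [/\ bijective (pt D),
  forall a b, qform n1 n2 n3 a b = 0 -> a = 0 /\ b = 0,
  forall e, dot lx (im (pt D e)) * dot ly (im (pt D e)) = iota (qform n1 n2 n3 e.1.1 e.1.2) &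
  forall e, dot lz (im (pt D e)) = iota e.2].
Proof.
have qn0 : (q == 0)%N = false by apply/eqP => q0; have := q_gt1 F; rewrite q0.
have dotf (l R : 'rV[k]_3) : dot (frob_pt F l) (frob_pt F R) = dot l R ^+ q by exact: (frob_dot iota).
have frobE (R : 'rV[k]_3) : frob_pt F R =
    dot ly R ^+ q *: ex + dot lz R ^+ q *: ez + dot lx R ^+ q *: ey.
  by rewrite -!dotf fz fy fx; exact: frameE fr _.
have fex : frob_pt F ex = ey.
  rewrite frobE (frame20 fr) (frame10 fr) (frame00 fr) expr0n qn0 expr1n.
  by rewrite !scale0r scale1r !add0r.
have fey : frob_pt F ey = ex.
  rewrite frobE (frame22 fr) (frame12 fr) (frame02 fr) expr0n qn0 expr1n.
  by rewrite !scale0r scale1r !addr0.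
have fez : frob_pt F ez = ez.
  rewrite frobE (frame21 fr) (frame11 fr) (frame01 fr) expr0n qn0 expr1n.
  by rewrite !scale0r scale1r addr0 add0r.
(* If all coordinates of ly were in F, its conjugate lx would equal ly, but the two differ at ex. *)
have [i yi] : exists i, ly 0 i ^+ q != ly 0 i.
  apply: NNPP => h; have := frame00 fr; rewrite -fy.
  have -> : frob_pt F ly = ly.
    apply/rowP => i; rewrite mxE; apply/eqP/negPn/negP => yi; apply: h.
    by exists i.
  by rewrite (frame20 fr) => /eqP; rewrite eq_sym oner_eq0.
have := congr1 (fun R : 'rV[k]_3 => R 0 i) fx; rewrite -fy !mxE.
move: (ly 0 i) yi => th th1 th2.
have frobX (c d : k) : (c + d) ^+ q = c ^+ q + d ^+ q by exact: (rmorphD (frobk iota)).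
have thF b a : iota a + iota b * th = 0 -> a = 0 /\ b = 0.
  have [->|b0] := eqVneq b 0.
    by rewrite rmorph0 mul0r addr0 => /eqP; rewrite fmorph_eq0 => /eqP.
  move=> E; case/eqP: th1; have -> : th = iota (- a / b).
    by rewrite rmorphM rmorphN fmorphV -(addrK (iota b * th) (iota a)) E sub0r opprK mulrC mulKf ?fmorph_eq0.
  exact: frobk_iota.
have f1 : frob_pt F (ex + ey) = ex + ey by rewrite (frob_ptD iota) fex fey addrC.
have f2 : frob_pt F (th *: ex + th ^+ q *: ey) = th *: ex + th ^+ q *: ey.
  by rewrite (frob_ptD iota) !frob_ptZ fex fey th2 addrC.
have [D1 D1E] := frob_fixed_point iota f1; have [D2 D2E] := frob_fixed_point iota f2.
have [Q QE] := frob_fixed_point iota fez.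
have [n2 n2E] : exists n2, th + th ^+ q = iota n2.
  by apply: frobk_fixed; rewrite frobX th2 addrC.
have [n3 n3E] : exists n3, th * th ^+ q = iota n3.
  by apply: frobk_fixed; rewrite exprMn th2 mulrC.
have ptE e : im (pt (D1, D2, Q) e) =
    iota e.1.1 *: (ex + ey) + iota e.1.2 *: (th *: ex + th ^+ q *: ey) + iota e.2 *: ez.
  by rewrite /pt !map_mxD !map_mxZ -D1E -D2E -QE.
have dx e : dot lx (im (pt (D1, D2, Q) e)) = iota e.1.1 + iota e.1.2 * th.
  rewrite ptE !(dotDr, dotZr) (frame00 fr) (frame01 fr) (frame02 fr); ring.
have dy e : dot ly (im (pt (D1, D2, Q) e)) = iota e.1.1 + iota e.1.2 * th ^+ q.
  rewrite ptE !(dotDr, dotZr) (frame20 fr) (frame21 fr) (frame22 fr); ring.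
have dz e : dot lz (im (pt (D1, D2, Q) e)) = iota e.2.
  rewrite ptE !(dotDr, dotZr) (frame10 fr) (frame11 fr) (frame12 fr); ring.
have nE a b : (iota a + iota b * th) * (iota a + iota b * th ^+ q) = iota (qform 1 n2 n3 a b).
  by rewrite /qform !(rmorphD, rmorphM, rmorphXn, rmorph1) /= -n2E -n3E; ring.
exists (D1, D2, Q), 1, n2, n3; split=> [|a b|e|//].
- apply: inj_card_bij => [[[a b] c] [[a' b'] c'] E|]; last first.
    by rewrite !card_prod card_mx mul1n !expnS expn0 muln1 mulnA.
  have := dz (a, b, c); have := dx (a, b, c); rewrite E dx dz /=.
  move=> /eqP; rewrite eq_sym -subr_eq0 => /eqP X0 /fmorph_inj ->.
  have [|/eqP a0 /eqP b0] := @thF (b - b') (a - a').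
    by rewrite !rmorphB -[RHS]X0; ring.
  by rewrite subr_eq0 in a0; rewrite subr_eq0 in b0; rewrite (eqP a0) (eqP b0).
- move=> /(congr1 iota); rewrite -nE rmorph0 => /eqP; rewrite mulf_eq0 => /orP[] /eqP.
    exact: thF.
  have -> : iota a + iota b * th ^+ q = (iota a + iota b * th) ^+ q.
    by rewrite frobX exprMn !frobk_iota.
  by move/eqP; rewrite expf_eq0 => /andP[_ /eqP]; exact: thF.
- by rewrite fy dx dy nE.
Qed.

End RationalCoordinates.

(** * Rational points and the code *)

Section ProjectiveCounting.

Variable F : finFieldType.
Local Notation q := #|F|.

Definition scale3 (c : F) (e : F * F * F) : F * F * F := (c * e.1.1, c * e.1.2, c * e.2).

Lemma scale3K (c : F) e : c != 0 -> scale3 c^-1 (scale3 c e) = e.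
Proof. by case: e => [[a b] d] c0; rewrite /scale3 /= !mulKf. Qed.

Lemma scale3A (c d : F) e : scale3 c (scale3 d e) = scale3 (c * d) e.
Proof. by rewrite /scale3 /= !mulrA. Qed.

Lemma scale3_neq0 (c : F) e : c != 0 -> e != (0, 0, 0) -> scale3 c e != (0, 0, 0).
Proof.
move=> c0; apply: contra_neq => e0; rewrite -(scale3K e c0) e0.
by rewrite /scale3 /= !mulr0.
Qed.

(** The nonzero vectors satisfying Q are in bijection with pairs of a nonzero scalar and a listed
    representative satisfying Q. *)
Lemma card_projective N (e_ : 'I_N -> F * F * F) (Q : pred (F * F * F)) :
  (forall j, e_ j != (0, 0, 0)) ->
  (forall j j' c, c != 0 -> e_ j = scale3 c (e_ j') -> j = j') ->
  (forall e, e != (0, 0, 0) -> exists j c, c != 0 /\ e = scale3 c (e_ j)) ->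
  (forall c e, c != 0 -> Q (scale3 c e) = Q e) ->
  #|[set e | (e != (0, 0, 0)) && Q e]| = (#|[set j | Q (e_ j)]| * q.-1)%N.
Proof.
move=> e0 einj esurj Qc.
have -> : q.-1 = #|[set c : F | c != 0]|.
  by rewrite -(cardsC1 (0 : F)); apply: eq_card => c; rewrite !inE.
rewrite -cardsX; pose f (u : 'I_N * F) := scale3 u.2 (e_ u.1).
rewrite -(@card_in_imset _ _ f) => [|[j c] [j' c']]; last first.
  rewrite !inE /= /f /= => /andP[_ c0] /andP[_ c'0] E.
  have jj' : j = j'.
    apply: (einj _ _ (c^-1 * c')); first by rewrite mulf_neq0 ?invr_eq0.
    by rewrite -scale3A -E scale3K.
  rewrite -jj' in E *; congr (_, _); move: (e0 j) E.
  case: (e_ j) => [[a b] d]; rewrite /scale3 /= => n0 [] Ea Eb Ed.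
  apply/eqP; apply: contraNT n0 => cc'; rewrite !xpair_eqE.
  have z x : c * x = c' * x -> x == 0.
    move/eqP; rewrite -subr_eq0 -mulrBl mulf_eq0 subr_eq0 (negPf cc') /=.
    exact.
  by rewrite (z a) // (z b) // (z d).
apply: eq_card => e; rewrite inE; apply/andP/imsetP => [[n0 Qe]|[[j c]]].
  have [j [c [c0 eE]]] := esurj _ n0; exists (j, c) => //.
  by rewrite !inE c0 andbT /= -(Qc c _ c0) -eE.
rewrite !inE /= /f /= => /andP[Qj c0] ->; split; last by rewrite Qc.
exact: scale3_neq0.
Qed.

End ProjectiveCounting.

Lemma sec_scale_id (K : comNzRingType) (G N Z c u v : K) :
  G * (N * (c * u) + Z * (c * v)) = c * (G * (N * u + Z * v)).
Proof. by ring. Qed.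

Lemma unit_quot_id (K : fieldType) (f c w : K) : c != 0 -> f * c * (c * w)^-1 = f / w.
Proof. by move=> c0; rewrite invfM mulrA (mulfK c0). Qed.

Lemma quot_unit_id (K : fieldType) (f c w : K) : w != 0 -> f / w * (c * w) = f * c.
Proof. by move=> w0; rewrite mulrCA (divfK w0) mulrC. Qed.

Lemma ratio_inv_id (K : fieldType) (G u v : K) : G != 0 -> v^-1 * u = (G * u) / (G * v).
Proof. by move=> G0; rewrite (cancel_id _ _ G0) mulrC. Qed.

Section RationalPoints.

Variables (F : finFieldType) (k : closedFieldType) (iota : {rmorphism F -> k}).
Local Notation K := {fraction {mpoly k[3]}}.
Local Notation cst := (@cst k).
Local Notation X := (@P2gen k).
Local Notation subring := (K -> Prop).
Local Notation im := (map_mx iota).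

Definition dotF (a R : 'rV[F]_3) : F := \sum_i a 0 i * R 0 i.

Lemma iota_dotF a R : iota (dotF a R) = dot (im a) (im R).
Proof. by rewrite rmorph_sum; apply: eq_bigr => i _; rewrite rmorphM !mxE. Qed.

Lemma dotF_sumr (I : finType) (c : I -> F) (R : I -> 'rV[F]_3) a :
  dotF a (\sum_i c i *: R i) = \sum_i c i * dotF a (R i).
Proof.
rewrite /dotF; under eq_bigr do rewrite summxE mulr_sumr.
rewrite exchange_big; apply: eq_bigr => i _; rewrite mulr_sumr.
by apply: eq_bigr => j _; rewrite mxE mulrCA.
Qed.

Lemma dotFC a R : dotF a R = dotF R a.
Proof. by apply: eq_bigr => i _; exact: mulrC. Qed.

Lemma dotF_suml (I : finType) (c : I -> F) (a : I -> 'rV[F]_3) R :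
  dotF (\sum_i c i *: a i) R = \sum_i c i * dotF (a i) R.
Proof. by rewrite dotFC dotF_sumr; apply: eq_bigr => i _; rewrite dotFC. Qed.

Lemma dotF_delta i R : dotF (delta_mx 0 i) R = R 0 i.
Proof.
rewrite /dotF (bigD1 i) //= mxE !eqxx mul1r big1 ?addr0 // => j /negPf ji.
by rewrite mxE ji andbF mul0r.
Qed.

Lemma lin0 : lin (0 : 'rV[k]_3) = 0.
Proof. by rewrite -[X in lin X](scale0r 0) linZ rmorph0 mul0r. Qed.

Lemma lin_delta i : lin (im (delta_mx 0 i)) = X i.
Proof.
rewrite /lin (bigD1 i) //= big1 => [|j /negPf ji]; rewrite !mxE.
  by rewrite !eqxx !rmorph1 mul1r addr0.
by rewrite ji andbF !rmorph0 mul0r.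
Qed.

Variables (lx ly lz ex ey ez : 'rV[k]_3) (O1 O3 O2 O4 : subring) (g : K).
Hypothesis fr : frame lx lz ly ex ez ey.
Hypotheses (fz : frob_pt F lz = lz) (fy : frob_pt F ly = lx) (fx : frob_pt F lx = ly).
Hypotheses (O1E : forall f, O1 f <-> ring_of (lv X ex) f)
           (O3E : forall f, O3 f <-> ring_of (lv X ey) f)
           (O2E : kind2 lx ly lz O2 0) (O4E : kind2 ly lx lz O4 0).
Hypotheses (g_rat : function_field iota X g) (g0 : g != 0).
Variables (D : 'rV[F]_3 * 'rV[F]_3 * 'rV[F]_3) (n1 n2 n3 : F).
Hypothesis D_bij : bijective (pt D).
Hypothesis anis : forall a b, qform n1 n2 n3 a b = 0 -> a = 0 /\ b = 0.
Hypothesis DN : forall e, dot lx (im (pt D e)) * dot ly (im (pt D e)) =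
  iota (qform n1 n2 n3 e.1.1 e.1.2).
Hypothesis DZ : forall e, dot lz (im (pt D e)) = iota e.2.
Local Notation N := (lin lx * lin ly).
Local Notation Z := (lin lz).
Local Notation S := (surf O1 O3 O2 O4).
Local Notation fsec := (fsec iota lx ly lz g).

(** The cubic of the section [fsec] a b in the coordinates e: xy has become the norm form and z the
    last coordinate. *)
Definition eval_pt (a b : 'rV[F]_3) (e : F * F * F) : F :=
  qform n1 n2 n3 e.1.1 e.1.2 * dotF a (pt D e) + e.2 ^+ 2 * dotF b (pt D e).

Lemma pt_scale c e : pt D (scale3 c e) = c *: pt D e.
Proof. by rewrite /pt /= !scalerDr !scalerA. Qed.

Lemma val_scale a b c e : eval_pt a b (scale3 c e) = c ^+ 3 * eval_pt a b e.
Proof.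
rewrite /eval_pt pt_scale; have dZ l R : dotF l (c *: R) = c * dotF l R.
  by rewrite /dotF mulr_sumr; apply: eq_bigr => i _; rewrite mxE mulrCA.
by rewrite !dZ /qform /=; ring.
Qed.

Lemma pt_neq0 e : e != (0, 0, 0) -> pt D e != 0.
Proof.
apply: contra_neq => e0; apply: (bij_inj D_bij); rewrite e0 /pt /=.
by rewrite !scale0r !addr0.
Qed.

Lemma im_neq0 m (R : 'rV[F]_m) : R != 0 -> im R != 0.
Proof. by apply: contra_neq => /eqP; rewrite map_mx_eq0 => /eqP. Qed.

Lemma nice_point e O : e != (0, 0, 0) ->
  (forall f, O f <-> ring_of (lv X (im (pt D e))) f) ->
  S O /\ exists w, nice g N Z O (lv X (im (pt D e))) (im (pt D e))
    (iota (qform n1 n2 n3 e.1.1 e.1.2)) (iota (e.2 ^+ 2)) w.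
Proof.
move=> e0; rewrite rmorphXn /= -DN -DZ.
apply: (nice_frob iota fr fy fx O1E O3E O2E O4E g0 (frob_map_mx iota _)).
exact: im_neq0 (pt_neq0 e0).
Qed.

Variables (n : nat) (s : 'I_n -> K).
Hypothesis s_basis : is_basis iota s (anticanonical_section iota S g).

Lemma fsec_sum (I : finType) (c : I -> F) (a b : I -> 'rV[F]_3) :
  fsec (\sum_i c i *: a i) (\sum_i c i *: b i) =
  \sum_i cst (iota (c i)) * fsec (a i) (b i).
Proof.
have linS (d : I -> 'rV[F]_3) :
    lin (im (\sum_i c i *: d i)) = \sum_i cst (iota (c i)) * lin (im (d i)).
  rewrite /lin; under [RHS]eq_bigr do rewrite mulr_sumr.
  rewrite exchange_big; apply: eq_bigr => j _.
  rewrite mxE summxE !rmorph_sum mulr_suml; apply: eq_bigr => i _.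
  by rewrite !mxE !rmorphM mulrA.
rewrite /fsec /sec !linS !mulr_sumr -big_split mulr_sumr.
apply: eq_bigr => i _; exact: sec_scale_id.
Qed.

Lemma fsec_inj a b a' b' : fsec a b = fsec a' b' -> a = a' /\ b = b'.
Proof. by move=> /(sec_inj fr g0)[/map_mx_inj-> /map_mx_inj->]. Qed.

Lemma section_fsec a b : anticanonical_section iota S g (fsec a b).
Proof.
by apply/(anticanonical_sectionE fr fz fy fx O1E O3E O2E O4E g_rat g0); exists a, b.
Qed.

Lemma basis_forms : exists al be : 'I_n -> 'rV[F]_3,
  (forall i, s i = fsec (al i) (be i)) /\
  forall a b, exists c : 'rV[F]_n,
    a = \sum_i c 0 i *: al i /\ b = \sum_i c 0 i *: be i.
Proof.
have [sS sU] := s_basis.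
have /fin_all_exists[ab sE] i : exists ab : 'rV[F]_3 * 'rV[F]_3, s i = fsec ab.1 ab.2.
  have /(anticanonical_sectionE fr fz fy fx O1E O3E O2E O4E g_rat g0)[a [b ->]] := sS i.
  by exists (a, b).
exists (fun i => (ab i).1), (fun i => (ab i).2); split=> // a b.
have [c [E _]] := sU _ (section_fsec a b); exists c.
by apply: fsec_inj; rewrite fsec_sum E; apply: eq_bigr => i _; rewrite sE.
Qed.

Variables al be : 'I_n -> 'rV[F]_3.
Hypothesis sE : forall i, s i = fsec (al i) (be i).
Hypothesis span : forall a b, exists c : 'rV[F]_n,
    a = \sum_i c 0 i *: al i /\ b = \sum_i c 0 i *: be i.
Let alk i := im (al i).
Let bek i := im (be i).

Lemma sEk i : s i = sec g N Z (alk i) (bek i). Proof. exact: sE. Qed.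

Lemma fsec_comb a b : exists c : 'rV[F]_n, fsec a b = comb s (fun j => iota (c 0 j)).
Proof.
have [c [-> ->]] := span a b; exists c.
by rewrite fsec_sum; apply: eq_bigr => j _; rewrite sE.
Qed.

Lemma spanNF i : exists c : 'rV[F]_n,
  g / X 0 ^+ 3 * N * X i = comb s (fun j => iota (c 0 j)).
Proof.
have [c E] := fsec_comb (delta_mx 0 i) 0; exists c; rewrite -E /fsec /sec lin_delta.
by rewrite map_mx0 lin0 mulr0 addr0 [RHS]mulrA.
Qed.

Lemma spanNk i : exists c, g / X 0 ^+ 3 * N * X i = comb s c.
Proof. by have [c E] := spanNF i; eexists; exact: E. Qed.

Lemma spanZk i : exists c, g / X 0 ^+ 3 * Z ^+ 2 * X i = comb s c.
Proof.
have [c E] := fsec_comb 0 (delta_mx 0 i); exists (fun j => iota (c 0 j)); rewrite -E /fsec /sec lin_delta.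
by rewrite map_mx0 lin0 mulr0 add0r [RHS]mulrA.
Qed.

Definition ev_pt (e : F * F * F) : 'rV[F]_n := \row_i eval_pt (al i) (be i) e.

Lemma image_ev_pt e : image alk bek (im (pt D e)) (iota (qform n1 n2 n3 e.1.1 e.1.2))
  (iota (e.2 ^+ 2)) = im (ev_pt e).
Proof. by apply/rowP => i; rewrite !mxE /alk /bek -!iota_dotF -!rmorphM -rmorphD. Qed.

Lemma val_sum (c : 'rV[F]_n) e : eval_pt (\sum_i c 0 i *: al i) (\sum_i c 0 i *: be i) e =
  \sum_i c 0 i * ev_pt e 0 i.
Proof.
rewrite /eval_pt !dotF_suml !mulr_sumr -big_split; apply: eq_bigr => i _.
by rewrite [ev_pt e 0 i]mxE mulrDr !(mulrCA (c 0 i)).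
Qed.

Lemma ev_pt_scale c e : ev_pt (scale3 c e) = c ^+ 3 *: ev_pt e.
Proof. by apply/rowP => i; rewrite !mxE val_scale. Qed.

(** The coordinates of the point are recovered from the values of N X_i, or from those of Z^2 X_i
    when the norm form vanishes at e; then e.2 is nonzero by anisotropy. *)
Lemma ev_pt_inj e e' c : e != (0, 0, 0) -> c != 0 -> ev_pt e = c *: ev_pt e' ->
  exists2 d, d != 0 & e = scale3 d e'.
Proof.
move=> e0 c0 E.
have V a b : eval_pt a b e = c * eval_pt a b e'.
  have [d [-> ->]] := span a b; rewrite !val_sum mulr_sumr.
  by apply: eq_bigr => i _; rewrite E mxE mulrCA.
have fin r r' : r != 0 -> r *: pt D e = r' *: pt D e' ->
    exists2 d, d != 0 & e = scale3 d e'.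
  move=> r0 rE; have eE : e = scale3 (r^-1 * r') e'.
    apply: (bij_inj D_bij).
    by rewrite pt_scale -scalerA -rE scalerA mulVf // scale1r.
  exists (r^-1 * r') => //; apply: contra_neq e0 => d0.
  by rewrite eE d0 /scale3 !mul0r.
have [q0|q0] := eqVneq (qform n1 n2 n3 e.1.1 e.1.2) 0; last first.
  apply: (fin _ (c * qform n1 n2 n3 e'.1.1 e'.1.2) q0); apply/rowP => i; rewrite [LHS]mxE [RHS]mxE.
  have := V (delta_mx 0 i) 0; rewrite /eval_pt !dotF_delta.
  have z R : dotF 0 R = 0 by rewrite /dotF big1 // => j _; rewrite mxE mul0r.
  by rewrite !z !mulr0 !addr0 mulrA.
have e2 : e.2 != 0.
  apply: contra_neq e0 => e2; have [a0 b0] := anis q0.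
  by case: (e) a0 b0 e2 => [[a b] d] /= -> -> ->.
apply: (fin _ (c * e'.2 ^+ 2) (expf_neq0 2 e2)); apply/rowP => i; rewrite [LHS]mxE [RHS]mxE.
have := V 0 (delta_mx 0 i); rewrite /eval_pt !dotF_delta.
have z R : dotF 0 R = 0 by rewrite /dotF big1 // => j _; rewrite mxE mul0r.
by rewrite !z !mulr0 !add0r mulrA.
Qed.

(** Combinations over F of the coordinates of x give c tau R_i and c kappa R_i, so a nonzero
    multiple of R has coordinates in F. This excludes ex and ey: the exceptional curves have no
    rational point in their images. *)
Lemma model_point O V R tau kappa w c x : S O -> nice g N Z O V R tau kappa w ->
  [\/ R = ex, R = ey | forall f, O f <-> ring_of (lv X R) f] -> c != 0 ->
  im x = c *: image alk bek R tau kappa ->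
  exists2 e, e != (0, 0, 0) & forall f, O f <-> ring_of (lv X (im (pt D e))) f.
Proof.
move=> SO nO Rcase c0 xE.
have lin_x a b : exists y, c * (tau * dot (im a) R + kappa * dot (im b) R) = iota y.
  have [d [-> ->]] := span a b; exists (\sum_i d 0 i * x 0 i).
  have imS (a' : 'I_n -> 'rV[F]_3) :
      dot (im (\sum_i d 0 i *: a' i)) R = \sum_i iota (d 0 i) * dot (im (a' i)) R.
    rewrite /dot; under [RHS]eq_bigr do rewrite mulr_sumr.
    rewrite exchange_big; apply: eq_bigr => j _.
    rewrite mxE summxE rmorph_sum mulr_suml; apply: eq_bigr => i _.
    by rewrite !mxE rmorphM mulrA.
  rewrite !imS !mulr_sumr -big_split mulr_sumr rmorph_sum; apply: eq_bigr => i _.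
  have := congr1 (fun y : 'rV[k]_n => y 0 i) xE; rewrite [LHS]mxE [RHS]mxE.
  rewrite [image _ _ _ _ _ 0 i]mxE rmorphM => ->; rewrite /alk /bek.
  rewrite /=; ring.
have dk i : dot (im (delta_mx 0 i)) R = R 0 i.
  rewrite /dot (bigD1 i) //= !mxE !eqxx rmorph1 mul1r big1 ?addr0 // => j /negPf ji.
  by rewrite !mxE ji andbF rmorph0 mul0r.
have z0 : dot (im 0) R = 0.
  by rewrite /dot big1 // => i _; rewrite !mxE rmorph0 mul0r.
have [m m0 /fin_all_exists[u uE]] : exists2 m, m != 0 & forall i, exists y, m * R 0 i = iota y.
  case: (nice_tk nO) => t0; [exists (c * tau)|exists (c * kappa)]; rewrite ?mulf_neq0 // => i.
    by have [y E] := lin_x (delta_mx 0 i) 0; exists y; rewrite -E dk z0 mulr0 addr0 mulrA.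
  by have [y E] := lin_x 0 (delta_mx 0 i); exists y; rewrite -E dk z0 mulr0 add0r mulrA.
have [ptV _ ptK] := D_bij; pose u' : 'rV[F]_3 := \row_i u i; pose e := ptV u'.
have RE : im (pt D e) = m *: R by rewrite ptK; apply/rowP => i; rewrite !mxE uE.
exists e.
  apply/negP => /eqP e0; have := nice_R nO; have : im (pt D e) = 0.
    by rewrite e0 /pt /= !scale0r !addr0 map_mx0.
  by rewrite RE => /eqP; rewrite scaler_eq0 (negPf m0) => /= ->.
have [nx ny] := frob_not_proj iota fr fy fx (frob_map_mx iota (pt D e)).
case: Rcase => [RX|RX|OR]; first by case: nx; exists m => //; rewrite RE RX.
  by case: ny; exists m => //; rewrite RE RX.
move=> f; rewrite RE; split=> [/OR[v Vf]|[v Vf]].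
  by exists v; apply/lv_scaleE.
by apply/OR; exists v; apply/(lv_scaleE R f v m0).
Qed.

Lemma map_ev_pt e O : e != (0, 0, 0) ->
  (forall f, O f <-> ring_of (lv X (im (pt D e))) f) -> forall x,
  anticanonical_map g s O (im x) <-> exists2 c, c != 0 & x = c *: ev_pt e.
Proof.
move=> e0 OE x; have [SO [w nO]] := nice_point e0 OE.
have := anticanonical_mapE sEk spanNk spanZk nO (im x); rewrite image_ev_pt => ->.
split=> [[c c0 E]|[c c0 ->]]; last first.
  by exists (iota c); [rewrite fmorph_eq0|rewrite map_mxZ].
have := image_neq0 sEk spanNk spanZk nO; rewrite image_ev_pt => /rV0Pn[i].
rewrite mxE fmorph_eq0 => vi; have cE : c = iota (x 0 i / ev_pt e 0 i).
  have := congr1 (fun y : 'rV[k]_n => y 0 i) E; rewrite [LHS]mxE [RHS]mxE.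
  rewrite [map_mx _ _ 0 i]mxE rmorphM fmorphV => ->.
  by rewrite mulfK // fmorph_eq0.
exists (x 0 i / ev_pt e 0 i); first by rewrite -(fmorph_eq0 iota) -cE.
by apply: (@map_mx_inj _ _ iota); rewrite E cE map_mxZ.
Qed.

(** X_i / X_0 is the quotient of the sections G N X_i and G N X_0, which are combinations of s over
    F: the model is birational to the plane over F. *)
Lemma function_fieldE f : function_field iota s f <-> function_field iota X f.
Proof.
split; first by apply: function_field_trans => i; rewrite sE; exact: fsec_rational.
move=> [d [A [B [hA hB B0 ->]]]]; have X0 := X_neq0 k 0.
have GN0 : g / X 0 ^+ 3 * N != 0.
  have G0 : g / X 0 ^+ 3 != 0 := mulf_neq0 g0 (invr_neq0 (expf_neq0 3 X0)).
  exact: mulf_neq0 G0 (mulf_neq0 (frame_neq0 fr) (frame_neq0 (fr_swap fr))).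
have combE (c : 'rV[F]_n) : exists2 L : {mpoly F[n]}, L \is 1.-homog &
    comb s (fun j => iota (c 0 j)) = geval s (map_mpoly iota L).
  exists (\sum_j c 0 j *: 'X_j).
    by apply: rpred_sum => j _; apply: dhomogZ; rewrite dhomogX /= mdeg1.
  rewrite rmorph_sum (big_morph (geval s) (gevalD s) (mmap0 _ _)).
  by apply: eq_bigr => j _; rewrite /= map_mpolyZ map_mpolyX gevalZ gevalX.
have Xd : (X 0)^-1 ^+ d != 0 := expf_neq0 d (invr_neq0 X0).
rewrite -(ratio_id _ _ Xd).
rewrite -(geval_homog X (X 0)^-1 (map_homog iota hA)).
rewrite -(geval_homog X (X 0)^-1 (map_homog iota hB)).
have t_rat i : function_field iota s ((X 0)^-1 * X i).
  have [c cE] := spanNF i; have [c' c'E] := spanNF 0.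
  have [L hL LE] := combE c; have [L' hL' L'E] := combE c'.
  rewrite (ratio_inv_id _ _ GN0) cE c'E LE L'E; exists 1%N, L, L'; split.
  - exact: hL.
  - exact: hL'.
  - by rewrite -L'E -c'E; exact: mulf_neq0 GN0 X0.
  - exact: erefl.
apply: function_fieldM; last apply: function_fieldV; exact: function_field_geval.
Qed.

Variable E : cartier iota (anticanonical_model S g s).
Hypothesis E_anti : is_anticanonical_divisor E.

Lemma copen_pts i P : copen E i P -> exists2 O, S O & anticanonical_map g s O P.
Proof. by have [Z' [_ h]] := copenP i => /h[]. Qed.

(** From left to right, the local ring of X dominates that of the image point, and the equation of D
    is inverse to that of K_X up to a unit. The converse is normality: f times the equation of D is
    regular at all points of X over P, and [model_regular] descends this to P. *)
Lemma global_sectionE f : global_section E f <-> anticanonical_section iota S g f.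
Proof.
split=> [[f_rat f_loc]|[f_rat f_reg]].
  split; first exact/function_fieldE.
  move=> O w SO wO; have [V [R [tau [kappa [w0 [nO _]]]]]] :=
    surf_nice fr O1E O3E O2E O4E g0 SO.
  pose P := image alk bek R tau kappa.
  have mP : anticanonical_map g s O P.
    apply/(anticanonical_mapE sEk spanNk spanZk nO).
    by exists 1; rewrite ?oner_neq0 ?scale1r.
  have [|i iP] := @ccover _ _ _ _ _ E P; first by exists O.
  have [nz _ Oinv] := E_anti SO wO mP iP.
  have [_ c0] := ceqP i.
  have [v fv] := proj1 (local_ringE _ _ _) (f_loc i P iP).
  have [v' iv] := proj1 (nice_ring nO _) Oinv.
  apply/(nice_ring nO); exists (v * v'); rewrite -(unit_quot_id f w c0).
  apply: (placeM (nice_place nO).1) iv.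
  exact: (model_sub sEk nO (oner_neq0 _) (esym (scale1r _)) fv).
split=> [|i P iP]; first exact/function_fieldE.
have [O SO mP] := copen_pts iP; have [c_rat c0] := ceqP i.
apply: (model_regular fr O1E O3E O2E O4E g0 sEk spanNk spanZk _ _ SO mP).
  apply: (function_field_rational fr (iota := iota)).
  by apply: function_fieldM => //; apply/function_fieldE.
move=> O' SO' mO'; have [_ [w wO' _]] := mO'.
have [nz Ocw _] := E_anti SO' wO' mO' iP.
have [V [R [tau [kappa [w0 [nO' _]]]]]] := surf_nice fr O1E O3E O2E O4E g0 SO'.
have [v fv] := proj1 (nice_ring nO' _) (f_reg _ _ SO' wO').
have [v' cv] := proj1 (nice_ring nO' _) Ocw.
apply/(nice_ring nO'); exists (v * v').
have w0' : w != 0 by apply: contra_neq nz => ->; rewrite mulr0.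
by rewrite -(quot_unit_id f _ w0'); exact: (placeM (nice_place nO').1).
Qed.

Lemma rational_pt x O : S O -> anticanonical_map g s O (im x) ->
  exists e c, [/\ e != (0, 0, 0), c != 0 & x = c *: ev_pt e].
Proof.
move=> SO mO; have [V [R [tau [kappa [w [nO Rc]]]]]] := surf_nice fr O1E O3E O2E O4E g0 SO.
have [c c0 xE] := proj1 (anticanonical_mapE sEk spanNk spanZk nO (im x)) mO.
have [e e0 OE] := model_point SO nO Rc c0 xE.
by have [c' c'0 ->] := proj1 (map_ev_pt e0 OE x) mO; exists e, c'.
Qed.

Lemma ev_pt_on_model e : e != (0, 0, 0) ->
  exists2 O, S O & anticanonical_map g s O (im (ev_pt e)).
Proof.
move=> e0; have OE := local_ringE X (im (pt D e)).
exists (P2ring (im (pt D e))); first exact: (nice_point e0 OE).1.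
by apply/(map_ev_pt e0 OE); exists 1; rewrite ?oner_neq0 ?scale1r.
Qed.

(** The equation of D times w is a unit at the point; its value u' is the same for all sections and
    is the factor sought. It lies in F because a section s_i0 not vanishing there, times the
    equation of D, is a function over F, whose value at a rational point is fixed by the
    Frobenius. *)
Lemma point_value e c i : e != (0, 0, 0) -> c != 0 ->
  copen E i (im (c *: ev_pt e)) -> exists2 u, u != 0 & forall a b y,
  local_value (local_ring s (im (c *: ev_pt e))) (fsec a b * ceq E i) (iota y) <->
  y = eval_pt a b e * u.
Proof.
set x := c *: ev_pt e => e0 c0 iP; set R := im (pt D e).
have OE : forall f, P2ring R f <-> ring_of (lv X R) f := local_ringE X R.
have [SO [w nO]] := nice_point e0 OE; have hV := nice_place nO.
have mO : anticanonical_map g s (P2ring R) (im x) by apply/(map_ev_pt e0 OE); exists c.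
have := E_anti SO (nice_exists nO (oner_neq0 _)) mO iP.
rewrite rmorph1 mul1r => -[nz /OE[u' Vu] /OE[v' Vv]].
have w0 := nice_w nO.
have u'0 : u' != 0.
  have := placeM hV.1 Vu Vv; rewrite (mulfV nz) => V1.
  have := place_uniq hV V1 (place1 hV.1) => uv; apply/negP => /eqP u0.
  by move/eqP: uv; rewrite u0 mul0r eq_sym oner_eq0.
have Vf a b : lv X R (fsec a b * ceq E i) (iota (eval_pt a b e) * u').
  have := placeM hV.1 (nice_sec (im a) (im b) nO) Vu.
  by rewrite (quot_unit_id _ _ w0) -!iota_dotF -!rmorphM -rmorphD.
have ic0 : iota c != 0 by rewrite fmorph_eq0.
have xE : im x = iota c *: image alk bek R (iota (qform n1 n2 n3 e.1.1 e.1.2)) (iota (e.2 ^+ 2)).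
  by rewrite image_ev_pt map_mxZ.
have sub := model_sub sEk nO ic0 xE.
have loc a b v : local_value (local_ring s (im x)) (fsec a b * ceq E i) v <->
    v = iota (eval_pt a b e) * u'.
  have lvP := model_place sEk nO ic0 xE.
  split=> [/(local_valueE _ _ lvP (local_ringE s (im x)))/sub V1|->].
    exact: (place_uniq hV V1 (Vf a b)).
  apply/(local_valueE _ _ lvP (local_ringE s (im x))).
  have [_ reg] := proj2 (global_sectionE _) (section_fsec a b).
  have [v0 lv0] := proj1 (local_ringE _ _ _) (reg i _ iP).
  by rewrite -(place_uniq hV (sub _ _ lv0) (Vf a b)).
have [i0 vi] : exists i0, ev_pt e 0 i0 != 0.
  have := image_neq0 sEk spanNk spanZk nO; rewrite image_ev_pt => /rV0Pn[i0].
  by rewrite mxE fmorph_eq0; exists i0.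
rewrite mxE in vi; have h_rat : function_field iota X (fsec (al i0) (be i0) * ceq E i).
  apply: function_fieldM; first exact: fsec_rational.
  by apply/function_fieldE; exact: (ceqP i).1.
have := frobK_lv iota (Vf (al i0) (be i0)).
rewrite frob_map_mx (frobK_fixed h_rat) => V2.
have /(frobk_fixed iota)[y yE] := place_uniq hV V2 (Vf (al i0) (be i0)).
have u'E : u' = iota (y / eval_pt (al i0) (be i0) e).
  by rewrite rmorphM fmorphV -yE mulrC mulKf // fmorph_eq0.
exists (y / eval_pt (al i0) (be i0) e); first by rewrite -(fmorph_eq0 iota) -u'E.
move=> a b y'; apply: (iff_trans (loc a b _)); rewrite u'E -rmorphM.
by split=> [/fmorph_inj|->].
Qed.

End RationalPoints.

Lemma weight_arith1 (q m z N : nat) : (m + z = N -> N = q ^ 2 + q + 1 ->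
  z <= q.*2.+2 -> q ^ 2 - q - 1 <= m)%N.
Proof. by rewrite -mulnn; lia. Qed.

Lemma weight_arith2 (q m z N : nat) : (m + z = N -> N = q ^ 2 + q + 1 ->
  q.*2.+2 <= z -> m <= q ^ 2 - q - 1)%N.
Proof. by rewrite -mulnn; lia. Qed.

Lemma distance_gt0 (q : nat) : (1 < q -> 0 < q ^ 2 - q - 1)%N.
Proof. by rewrite -mulnn; nia. Qed.

(** * The parameters of the code of cubics *)

Section CubicCode.

Variables (F : finFieldType) (D : 'rV[F]_3 * 'rV[F]_3 * 'rV[F]_3) (n1 n2 n3 : F).
Local Notation q := #|F|.
Local Notation val := (eval_pt D n1 n2 n3).
Hypothesis D_bij : bijective (pt D).
Hypothesis anis : forall a b, qform n1 n2 n3 a b = 0 -> a = 0 /\ b = 0.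

Definition coords (a : 'rV[F]_3) : F * F * F := (dotF a D.1.1, dotF a D.1.2, dotF a D.2).

Lemma dotF_pt a e : dotF a (pt D e) =
  (coords a).1.1 * e.1.1 + (coords a).1.2 * e.1.2 + (coords a).2 * e.2.
Proof.
rewrite /dotF /coords /= /dotF !mulr_suml -!big_split; apply: eq_bigr => i _.
by rewrite /= !mxE; ring.
Qed.

Lemma val_cubic a b e :
  val a b e = cubic n1 n2 n3 (coords a) (coords b) e.1.1 e.1.2 e.2.
Proof. by rewrite /eval_pt !dotF_pt. Qed.

Lemma coords0 : coords 0 = (0, 0, 0).
Proof. by rewrite /coords /dotF !big1 // => i _; rewrite mxE mul0r. Qed.

Lemma coords_bij : bijective coords.
Proof.
apply: inj_card_bij => [a a' E|]; last first.
  by rewrite !card_prod card_mx mul1n !expnS expn0 muln1 mulnA.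
have [ptV _ ptK] := D_bij; apply/rowP => i.
by rewrite -!dotF_delta dotFC -(ptK (delta_mx 0 i)) dotF_pt E -dotF_pt ptK dotFC.
Qed.

Variables (N : nat) (e_ : 'I_N -> F * F * F) (u_ : 'I_N -> F).
Hypothesis e0 : forall j, e_ j != (0, 0, 0).
Hypothesis einj : forall j j' c, c != 0 -> e_ j = scale3 c (e_ j') -> j = j'.
Hypothesis esurj : forall e, e != (0, 0, 0) -> exists j c, c != 0 /\ e = scale3 c (e_ j).
Hypothesis u0 : forall j, u_ j != 0.

Lemma q1_gt0 : (0 < q.-1)%N.
Proof. by have := q_gt1 F; case: q => [|[|]]. Qed.

(** There are q^3 - 1 = (q^2 + q + 1) (q - 1) nonzero vectors, and q - 1 of them for each point. *)
Lemma card_points : N = (q ^ 2 + q + 1)%N.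
Proof.
have := @card_projective _ _ _ predT e0 einj esurj (fun _ _ _ => erefl).
have -> : [set j | predT (e_ j)] = [set: 'I_N] by apply/setP => j; rewrite !inE.
have -> : [set e : F * F * F | (e != (0, 0, 0)) && predT e] = [set~ (0, 0, 0)].
  by apply/setP => e; rewrite !inE andbT.
rewrite cardsT card_ord cardsC1 !card_prod; have := q_gt1 F; move: q => m m1 E.
apply/eqP; rewrite -(eqn_pmul2r (m := m.-1)); last by lia.
by apply/eqP; rewrite -E; nia.
Qed.

Definition zeros a b : nat := #|[set j | val a b (e_ j) == 0]|.

Lemma zeros_cone a b : (zeros a b * q.-1)%N = #|cone n1 n2 n3 (coords a) (coords b)|.
Proof.
rewrite -(@card_projective _ _ e_ (fun e => val a b e == 0)) //.
  by apply: eq_card => e; rewrite !inE val_cubic.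
by move=> c e c0; rewrite val_scale mulf_eq0 expf_eq0 (negPf c0) andbF.
Qed.

Lemma zeros_le a b : (a, b) != (0, 0) -> (zeros a b <= q.*2.+2)%N.
Proof.
move=> ab; rewrite -(leq_pmul2r q1_gt0) zeros_cone; apply: card_cone => //.
apply: contra_neq ab => -[] /= a1 a2 a3 b1 b2 b3.
by congr (_, _); apply: (bij_inj coords_bij); rewrite coords0 /coords ?a1 ?a2 ?a3 ?b1 ?b2 ?b3.
Qed.

Lemma zeros_max : exists a b, a != 0 /\ (q.*2.+2 <= zeros a b)%N.
Proof.
have [cV _ cK] := coords_bij.
exists (cV (0, 0, 1)), (cV (0, -1, 0)); split.
  apply/negP => /eqP a0; have := cK (0, 0, 1); rewrite a0 coords0 => -[].
  by apply/eqP; rewrite eq_sym oner_eq0.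
rewrite -(leq_pmul2r q1_gt0) zeros_cone !cK.
exact: card_cone_max.
Qed.

(** A generator matrix, with one row for each product of xy or z^2 with a coordinate; [u_] accounts
    for the charts of the divisor. *)
Definition code_mx : 'M[F]_(3 + 3, N) := col_mx
  (\matrix_(i, j) (qform n1 n2 n3 (e_ j).1.1 (e_ j).1.2 * pt D (e_ j) 0 i * u_ j))
  (\matrix_(i, j) ((e_ j).2 ^+ 2 * pt D (e_ j) 0 i * u_ j)).

Lemma code_mxE a b j : (row_mx a b *m code_mx) 0 j = val a b (e_ j) * u_ j.
Proof.
rewrite mul_row_col mxE !mxE /eval_pt mulrDl -!mulrA /dotF; congr (_ + _).
  rewrite !(mulr_suml, mulr_sumr); apply: eq_bigr => i _; rewrite !mxE; ring.
rewrite !(mulr_suml, mulr_sumr); apply: eq_bigr => i _; rewrite !mxE; ring.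
Qed.

Lemma card_nonzero a b : (#|[set j | (row_mx a b *m code_mx)%R 0%R j != 0%R]| + zeros a b)%N = N.
Proof.
rewrite -[RHS]card_ord -(cardsC [set j | val a b (e_ j) == 0]) addnC /zeros.
congr (_ + _)%N; apply: eq_card => j.
by rewrite !inE code_mxE mulf_eq0 (negPf (u0 j)) orbF.
Qed.

Lemma weight_ge (v : 'rV[F]_(3 + 3)) : v != 0 ->
  (q ^ 2 - q - 1 <= #|[set j | (v *m code_mx)%R 0%R j != 0%R]|)%N.
Proof.
rewrite -(hsubmxK v); move: (lsubmx v) (rsubmx v) => a b v0.
have ab : (a, b) != (0, 0) by apply: contra_neq v0 => -[-> ->]; exact: row_mx0.
exact: (weight_arith1 (card_nonzero a b) card_points (zeros_le ab)).
Qed.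

(** Nonzero messages have weight at least q^2 - q - 1, which is positive already for q = 2; so the
    code has the full dimension 6. *)
Lemma code_mx_inj (v w : 'rV[F]_(3 + 3)) : v *m code_mx = w *m code_mx -> v = w.
Proof.
move=> vw; apply/eqP; rewrite -subr_eq0; apply: contraT => /weight_ge.
have -> : [set j | ((v - w) *m code_mx) 0 j != 0] = set0.
  by apply/setP => j; rewrite !inE mulmxBl vw subrr mxE eqxx.
by rewrite cards0 leqNgt distance_gt0 ?q_gt1.
Qed.

Lemma cubic_code (C : 'rV[F]_N -> Prop) :
  (forall c, C c <-> exists a b, forall j, c 0 j = val a b (e_ j) * u_ j) ->
  has_parameters C (q ^ 2 + q + 1) 6 (q ^ 2 - q - 1).
Proof.
move=> CE; split; first exact: card_points.
pose f : 'Hom('rV[F]_(3 + 3), 'rV[F]_N) := linfun (mulmxr code_mx).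
have fE v : f v = v *m code_mx by rewrite lfunE.
have Vf c : c \in limg f <-> exists v, c = v *m code_mx.
  split=> [/memv_imgP[v _ ->]|[v ->]]; first by exists v; rewrite fE.
  by rewrite -fE memv_img ?memvf.
exists (limg f); split.
- move=> c; apply: (iff_trans (Vf c)); apply: iff_sym; apply: (iff_trans (CE c)).
  split=> [[a [b E]]|[v ->]].
    by exists (row_mx a b); apply/rowP => j; rewrite code_mxE.
  by exists (lsubmx v), (rsubmx v) => j; rewrite -code_mxE hsubmxK.
- rewrite limg_dim_eq ?dimvf ?dim_matrix //.
  have /lker0P/eqP-> : injective f by move=> v w; rewrite !fE; exact: code_mx_inj.
  exact: capv0.
- split=> [|x y /Vf[v ->] /Vf[w ->] vw].
    have [a [b [a0 zab]]] := zeros_max; exists (row_mx a b *m code_mx), 0.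
    have hE : hamming (row_mx a b *m code_mx) 0 = (q ^ 2 - q - 1)%N.
      have ab0 : row_mx a b != 0.
        by rewrite row_mx_eq0 negb_and a0.
      have -> : hamming (row_mx a b *m code_mx) 0 =
          #|[set j | (row_mx a b *m code_mx) 0 j != 0]|.
        by apply: eq_card => j; rewrite !inE [(0 : 'rV_N) 0 j]mxE.
      apply/eqP; rewrite eqn_leq (weight_ge ab0) andbT.
      exact: (weight_arith2 (card_nonzero a b) card_points zab).
    split=> //; [by apply/Vf; exists (row_mx a b)|exact: mem0v|].
    apply: contra_eq_neq hE => ->; have -> : hamming 0 (0 : 'rV[F]_N) = 0%N.
      by apply/eqP; rewrite cards_eq0; apply/eqP/setP => j; rewrite !inE eqxx.
    by rewrite neq_ltn distance_gt0 ?q_gt1.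
  have -> : hamming (v *m code_mx) (w *m code_mx) =
      #|[set j | ((v - w) *m code_mx) 0 j != 0]|.
    apply: eq_card => j; rewrite !inE mulmxBl.
    by move: (v *m _) (w *m _) => r r'; rewrite !mxE subr_eq0.
  by apply: weight_ge; rewrite subr_eq0; apply: contra_neq vw => ->.
Qed.

End CubicCode.

Theorem proposition4p3
  (* F = F_q, with algebraic closure k *)
  (F : finFieldType) (k : closedFieldType) (iota : {rmorphism F -> k})
  (k_alg : integralRange iota)
  (* p1, p3 : distinct conjugate points of P^2(F_{q^2}) *)
  (P1 P3 : 'rV[k]_3) (P1_neq0 : P1 != 0) (P3_neq0 : P3 != 0)
  (P1_rat : forall i, P1 0 i ^+ (#|F| ^ 2) = P1 0 i)
  (P3_rat : forall i, P3 0 i ^+ (#|F| ^ 2) = P3 0 i)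
  (P13_dist : ~ proj_eq P1 P3)
  (P13_conj : proj_eq P3 (frob_pt F P1) /\ proj_eq P1 (frob_pt F P3))
  (* p2, p4 : conjugate points infinitely near p1, p3, given by local rings *)
  (O2 O4 : {fraction {mpoly k[3]}} -> Prop)
  (O2_near : infinitely_near (P2ring P1) O2)
  (O4_near : infinitely_near (P2ring P3) O4)
  (O24_conj : frob_ring F O2 O4 /\ frob_ring F O4 O2)
  (O2_line : ~ curve_passes_through (line_ring P1 P3) O2)
  (O4_line : ~ curve_passes_through (line_ring P1 P3) O4)
  (X : surface k)
  (X_def : X = blowup (blowup (@P2 k) (two_points (P2ring P1) (P2ring P3)))
                      (two_points O2 O4))
  (* K_X = the divisor of the 2-form g dx /\ dy *)
  (g : {fraction {mpoly k[3]}})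
  (g_rat : function_field iota (@P2gen k) g) (g_neq0 : g != 0)
  (* coordinates on P(H^0(X, -K_X)) *)
  (n : nat) (s : 'I_n -> {fraction {mpoly k[3]}})
  (s_basis : is_basis iota s (anticanonical_section iota X g))
  (* D = -K_{X_s} *)
  (D : cartier iota (anticanonical_model X g s))
  (D_anti : is_anticanonical_divisor D)
  (* p_1, ..., p_N = X_s(F_q), with the charts of D used for evaluation *)
  (N : nat) (p : 'I_N -> 'rV[F]_n)
  (p_enum : enumerates_rational_points iota (anticanonical_model X g s) p)
  (ip : 'I_N -> cidx D)
  (ip_chart : forall j, copen D (ip j) (Fpoint iota (p j))) :
  let q := #|F| in
  has_parameters (evaluation_code p ip) (q ^ 2 + q + 1) 6 (q ^ 2 - q - 1).
Proof.
move=> q; have [lx [ly [lz [ex [ey [ez [c1 [c3 [fr [fz fy fx]]]]]]]]]] :=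
  coordinates iota P1_neq0 P3_neq0 P1_rat P13_dist P13_conj O2_near O4_near O24_conj O2_line.
move=> [c10 P1E c30 P3E] [O2E O4E].
have ringE P c e : c != 0 -> P = c *: e -> forall f, P2ring P f <-> ring_of (lv (@P2gen k) e) f.
  move=> c0 -> f; split=> [/local_ringE[v /lv_scaleE Vf]|[v Vf]]; first by exists v; exact: Vf.
  by apply/local_ringE; exists v; apply/lv_scaleE.
have O1E := ringE _ _ _ c10 P1E; have O3E := ringE _ _ _ c30 P3E.
have {X_def} XE : X = surf (P2ring P1) (P2ring P3) O2 O4 := X_def.
move: s_basis D D_anti p_enum ip ip_chart; rewrite XE => s_basis D D_anti p_enum ip ip_chart.
have [B [n1 [n2 [n3 [B_bij anis BN BZ]]]]] := rational_coordinates iota fr fz fy fx.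
have [al [be [sE span]]] := basis_forms fr fz fy fx O1E O3E O2E O4E g_rat g_neq0 s_basis.
have [p_pts p_inj p_surj] := p_enum.
(* Each listed point is a multiple [(ec j).2] of the image of the vector [(ec j).1]; the effect of
   this multiple on the values is contained in the factor u below. *)
have /fin_all_exists[ec ecP] j : exists ec : (F * F * F) * F,
    [/\ ec.1 != (0, 0, 0), ec.2 != 0 & p j = ec.2 *: ev_pt B n1 n2 n3 al be ec.1].
  have [O SO mO] := p_pts j.
  have [e [c h]] := rational_pt fr fy fx O1E O3E O2E O4E g_neq0 B_bij BN BZ sE span SO mO.
  by exists (e, c).
have /fin_all_exists[u uP] j : exists u, u != 0 /\ forall a b y,
    local_value (local_ring s (Fpoint iota (p j))) (fsec iota lx ly lz g a b * ceq D (ip j))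
      (iota y) <-> y = eval_pt B n1 n2 n3 a b (ec j).1 * u.
  have [e0 c0 pE] := ecP j; have := ip_chart j; rewrite /Fpoint pE => h.
  have [u u0 U] := point_value fr fz fy fx O1E O3E O2E O4E g_rat g_neq0 B_bij BN BZ sE span
    D_anti e0 c0 h.
  by exists u.
apply: (cubic_code B_bij anis (e_ := fun j => (ec j).1) (u_ := u)).
- by move=> j; have [] := ecP j.
- move=> j j' c c0 E; apply: p_inj; have [_ d0 ->] := ecP j; have [_ d'0 ->] := ecP j'.
  (* Coordinates on the model are cubic in e, so replacing e by c e multiplies them by c^3; this is
     the resulting ratio of p j' to p j. *)
  exists ((ec j').2 / ((ec j).2 * c ^+ 3)).
    by rewrite mulf_neq0 ?invr_eq0 ?mulf_neq0 ?expf_neq0.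
  rewrite E ev_pt_scale !scalerA divfK // mulf_neq0 ?expf_neq0 //.
- move=> e e0; have [j [d d0 E]] := p_surj _
    (ev_pt_on_model fr fy fx O1E O3E O2E O4E g_neq0 B_bij BN BZ sE span e0).
  have [_ c0 pE] := ecP j; rewrite pE scalerA in E.
  have [d' d'0 eE] := ev_pt_inj B_bij anis span e0 (mulf_neq0 d0 c0) E.
  by exists j, d'.
- by move=> j; have [] := uP j.
have secE := anticanonical_sectionE fr fz fy fx O1E O3E O2E O4E g_rat g_neq0.
have globE := global_sectionE fr fz fy fx O1E O3E O2E O4E g_rat g_neq0 sE span D_anti.
move=> c; split=> [[f /globE/secE[a [b ->]] fv]|[a [b cE]]].
  by exists a, b => j; apply/((uP j).2 a b); exact: fv.
exists (fsec iota lx ly lz g a b) => [|j]; last by apply/((uP j).2 a b).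
by apply/globE/secE; exists a, b.
Qed.
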